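(* Let $N\ge 0$ be an integer, $s\ge 0$ a real number and $1\le p<\infty$. Let $u$ be the solution of the Cauchy problem for the heat equation $$\partial_t u-\Delta u=0\quad (x\in\mathbb{R}^3,\ t>0),\qquad u(x,0)=u_0(x)\quad (x\in\mathbb{R}^3).$$ If $u_0\in \dot B^{N}_{p,1}(\mathbb{R}^3)\cap \dot B^{-s}_{p,1}(\mathbb{R}^3)$, then for any real number $\ell\in[-s,N]$ there exists a constant $C_0$ such that, for all $t\ge 0$, $$\|u(t)\|_{\dot B^{\ell}_{p,1}}\le C_0(1+t)^{-\frac{\ell+s}{2}}.$$
   Context: Littlewood-Paley decomposition: fix a smooth radial $\varphi\in\mathcal S(\mathbb{R}^3)$ with values in $[0,1]$, supported in $\{\frac34\le|\xi|\le\frac83\}$, with $\sum_{j\in\mathbb{Z}}\varphi(2^{-j}\xi)=1$ for all $\xi\neq0$. For $f\in\mathcal S'(\mathbb{R}^3)$ and $j\in\mathbb{Z}$ set $\Delta_j f:=\varphi(2^{-j}D)f$ (Fourier multiplier). Homogeneous Besov spaces: for $\sigma\in\mathbb{R}$, $1\le p\le\infty$, $\|f\|_{\dot B^{\sigma}_{p,1}}:=\sum_{j\in\mathbb{Z}}2^{j\sigma}\|\Delta_j f\|_{L^p}$. If $\sigma\le\frac3p$, $\dot B^{\sigma}_{p,1}(\mathbb{R}^3)$ is the set of $f\in\mathcal S'(\mathbb{R}^3)$ with $\|f\|_{\dot B^{\sigma}_{p,1}}<\infty$, where $f$ is understood to be realized as $f=\sum_{j}\Delta_j f$ in $\mathcal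 S'$ (so that the space is a Banach space continuously embedded in $\mathcal S'$). If $\frac3p+k<\sigma\le\frac3p+k+1$ with $k\in\{0,1,2,\dots\}$, it is the set of $f\in\mathcal S'(\mathbb{R}^3)$ with $\partial^\beta f\in\dot B^{\sigma-k-1}_{p,1}(\mathbb{R}^3)$ for all $|\beta|=k+1$. The constant $C_0$ may depend on $u_0,p,s,N,\ell$ but not on $t$. *)

(* Defs.v *)
(* MathComp-Analysis, complex numbers R[i] from mathcomp real-closed. *)
From HB Require Import structures.
From mathcomp Require Import all_boot all_order all_algebra.
From mathcomp Require Import complex.
From mathcomp Require Import all_classical all_reals all_analysis.

Set Implicit Arguments.
Unset Strict Implicit.
Unset Printing Implicit Defensive.

Import Order.TTheory GRing.Theory Num.Theory.
Import numFieldNormedType.Exports.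

Local Open Scope classical_set_scope.
Local Open Scope ring_scope.
Local Open Scope complex_scope.

(* The library norm on this product is the sup norm; the Euclidean norm is
   [enorm] below. *)
Notation R3 R := (R * R * R)%type.

Definition dot3 {R : realType} (x y : R3 R) : R :=
  x.1.1 * y.1.1 + x.1.2 * y.1.2 + x.2 * y.2.

Definition enorm {R : realType} (x : R3 R) : R := Num.sqrt (dot3 x x).

Definition basis3 {R : realType} (i : 'I_3) : R3 R :=
  ((val i == 0%N)%:R, (val i == 1%N)%:R, (val i == 2%N)%:R).

Notation M3 R :=
  (measurableTypeR R * measurableTypeR R * measurableTypeR R)%type.

(* [M3 R] is [R3 R] with the measurable structure on which the library defines
   the Lebesgue measure of R (Borel sets). *)
Definition leb3 (R : realType) : {measure set (M3 R) -> \bar R} :=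
  ((@lebesgue_measure R \x @lebesgue_measure R) \x @lebesgue_measure R)%E.

Definition cmod {R : realType} (z : R[i]) : R :=
  Num.sqrt (complex.Re z ^+ 2 + complex.Im z ^+ 2).

Definition cexpi {R : realType} (a : R) : R[i] := cos a +i* sin a.

Definition cmeasurable {R : realType} (f : R3 R -> R[i]) : Prop :=
  measurable_fun [set: M3 R] (fun x => complex.Re (f x)) /\
  measurable_fun [set: M3 R] (fun x => complex.Im (f x)).

Definition cintegrable {R : realType} (f : R3 R -> R[i]) : Prop :=
  (leb3 R).-integrable setT (fun x => (complex.Re (f x))%:E) /\
  (leb3 R).-integrable setT (fun x => (complex.Im (f x))%:E).

Definition cint {R : realType} (f : R3 R -> R[i]) : R[i] :=
  (\int[leb3 R]_x complex.Re (f x)) +i* (\int[leb3 R]_x complex.Im (f x)).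

Definition pd {R : realType} (i : 'I_3) (f : R3 R -> R[i]) : R3 R -> R[i] :=
  fun x => ('D_(basis3 i) (fun y => complex.Re (f y)) x)
        +i* ('D_(basis3 i) (fun y => complex.Im (f y)) x).

(* A multi-index beta is written as a word in the three directions, of length
   |beta|; on smooth functions the order of the letters is irrelevant. *)
Definition pds {R : realType} (b : seq 'I_3) (f : R3 R -> R[i]) :
  R3 R -> R[i] := foldr pd f b.

Definition csmooth {R : realType} (f : R3 R -> R[i]) : Prop :=
  forall (b : seq 'I_3) (x : R3 R),
    differentiable (fun y => complex.Re (pds b f y)) x /\
    differentiable (fun y => complex.Im (pds b f y)) x.

Definition schwartz {R : realType} (f : R3 R -> R[i]) : Prop :=
  csmooth f /\
  forall (n : nat) (b : seq 'I_3), exists M : R,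
    forall x, (1 + enorm x) ^+ n * cmod (pds b f x) <= M.

Definition laplacian {R : realType} (f : R3 R -> R[i]) : R3 R -> R[i] :=
  fun x => \sum_(i < 3) pd i (pd i f) x.

Definition fourier {R : realType} (f : R3 R -> R[i]) : R3 R -> R[i] :=
  fun xi => cint (fun x => cexpi (- dot3 x xi) * f x).

Definition inv_fourier {R : realType} (f : R3 R -> R[i]) : R3 R -> R[i] :=
  fun x => ((2 * pi) ^- 3)%:C * cint (fun xi => cexpi (dot3 x xi) * f xi).

(* A tempered distribution is a functional on all functions R^3 -> C of which
   only the values on Schwartz functions matter: [tempered], and every notion
   below, evaluates it on Schwartz functions only. *)
Definition pre_distribution (R : realType) : Type := (R3 R -> R[i]) -> R[i].

Definition tempered {R : realType} (T : pre_distribution R) : Prop :=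
  (forall (a : R[i]) (f g : R3 R -> R[i]), schwartz f -> schwartz g ->
     T (fun x => a * f x + g x) = a * T f + T g) /\
  (exists (C : R) (n : nat), forall f : R3 R -> R[i], schwartz f ->
     forall M : R,
       (forall (b : seq 'I_3) x, (size b <= n)%N ->
          (1 + enorm x) ^+ n * cmod (pds b f x) <= M) ->
       cmod (T f) <= C * M).

Definition dpd {R : realType} (i : 'I_3) (T : pre_distribution R) :
  pre_distribution R := fun psi => - T (pd i psi).

Definition dpds {R : realType} (b : seq 'I_3) (T : pre_distribution R) :
  pre_distribution R := foldr dpd T b.

(* m(D) T = F^-1 (m F T), where F and F^-1 act on S' by transposition:
   < F^-1 (m F T), psi > = < T, F (m F^-1 psi) >. *)
Definition fmult {R : realType} (m : R3 R -> R) (T : pre_distribution R) :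
  pre_distribution R :=
  fun psi => T (fourier (fun xi => (m xi)%:C * inv_fourier psi xi)).

Definition LP_cutoff {R : realType} (phi : R3 R -> R) : Prop :=
  [/\ schwartz (fun xi => (phi xi)%:C),
      (forall xi eta, enorm xi = enorm eta -> phi xi = phi eta),
      (forall xi, 0 <= phi xi <= 1),
      (forall xi, phi xi != 0 -> 3 / 4 <= enorm xi <= 8 / 3) &
      (forall xi, xi != 0 ->
         \esum_(j in [set: int]) (phi ((2 : R) ^ (- j) *: xi))%:E = 1%E)].

Definition LPblock {R : realType} (phi : R3 R -> R) (j : int)
  (T : pre_distribution R) : pre_distribution R :=
  fmult (fun xi => phi ((2 : R) ^ (- j) *: xi)) T.

Definition represents {R : realType} (g : R3 R -> R[i])
  (T : pre_distribution R) : Prop :=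
  cmeasurable g /\
  forall psi, schwartz psi ->
    cintegrable (fun x => g x * psi x) /\ T psi = cint (fun x => g x * psi x).

(* +oo when T is not given by a function; otherwise the representing functions
   agree almost everywhere and the infimum is their common L^p norm. *)
Definition dLnorm {R : realType} (p : R) (T : pre_distribution R) : \bar R :=
  ereal_inf [set ('N[leb3 R]_p%:E [(fun x => (cmod (g x))%:E)])%E
            | g in [set g | represents g T]].

Definition besov_norm {R : realType} (phi : R3 R -> R) (p sigma : R)
  (T : pre_distribution R) : \bar R :=
  (\esum_(j in [set: int])
     ((2 : R) `^ (j%:~R * sigma))%:E * dLnorm p (LPblock phi j T))%E.

(* T = \sum_(j in Z) Delta_j T in S' : the partial sums over -n <= j < m tend
   to T as m and n tend independently to infinity. *)
Definition LPrealized {R : realType} (phi : R3 R -> R) (T : pre_distribution R) :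
  Prop :=
  forall psi, schwartz psi ->
    (fun mn : nat * nat =>
       cmod (\sum_(k < mn.1) LPblock phi k%:Z T psi
             + \sum_(k < mn.2) LPblock phi (- (k.+1)%:Z) T psi - T psi))
      @ filter_prod \oo \oo --> (0 : R).

Definition besov_low {R : realType} (phi : R3 R -> R) (p sigma : R)
  (T : pre_distribution R) : Prop :=
  [/\ tempered T, (besov_norm phi p sigma T < +oo)%E & LPrealized phi T].

Definition besov {R : realType} (phi : R3 R -> R) (p sigma : R)
  (T : pre_distribution R) : Prop :=
  (sigma <= 3 / p /\ besov_low phi p sigma T) \/
  (exists k : nat,
     [/\ 3 / p + k%:R < sigma <= 3 / p + k%:R + 1,
         tempered T &
         forall b : seq 'I_3, size b = k.+1 ->
           besov_low phi p (sigma - k%:R - 1) (dpds b T)]).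

(* u in C([0,oo); S') (weak-* topology) with u' = Delta u in S' for t > 0 and
   u(0) = u0.  Only u t with t >= 0 matters. *)
Definition heat_solution {R : realType} (u0 : pre_distribution R)
  (u : R -> pre_distribution R) : Prop :=
  (forall t : R, 0 <= t -> tempered (u t)) /\
  forall psi, schwartz psi ->
    [/\ u 0 psi = u0 psi,
        {within `[0, +oo[%classic, continuous (fun t => complex.Re (u t psi))},
        {within `[0, +oo[%classic, continuous (fun t => complex.Im (u t psi))},
        (forall t : R, 0 < t ->
           is_derive t 1 (fun r => complex.Re (u r psi))
             (complex.Re (u t (laplacian psi)))) &
        (forall t : R, 0 < t ->
           is_derive t 1 (fun r => complex.Im (u r psi))
             (complex.Im (u t (laplacian psi))))].

(* Main.v *)
Require Import Defs.
From HB Require Import structures.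
From mathcomp Require Import all_boot all_order all_algebra.
From mathcomp Require Import complex.
From mathcomp Require Import all_classical all_reals all_analysis.
From mathcomp Require Import measurable_realfun.
From mathcomp Require Import ring lra zify.

Set Implicit Arguments.
Unset Strict Implicit.
Unset Printing Implicit Defensive.

Import Order.TTheory GRing.Theory Num.Theory.
Import numFieldNormedType.Exports.

(** Write Delta_j for the block [LPblock phi j] and r = |xi|^2.  In frequency the heat flow is
multiplication by e^{-t r}, so that Delta_j u(t) = e^{-t r}(D) Delta_j u0.  On the block j one has
r ~ 4^j, and e^{-t r} acts there as the dilation by 2^j of the symbol e^{-tau r} phit(xi) with
tau = t 4^j, where phit is smooth, lives in a fixed shell and equals 1 on the support of phi.
The inverse Fourier transform of this symbol has L^1 norm at most C_k (1 + tau)^-k for every k,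
and the L^1 norm does not see the dilation.  Young's inequality then gives [heat_block]:
  || Delta_j u(t) ||_p <= C_k (1 + t 4^j)^-k || Delta_j u0 ||_p.
Put a = (l + s) / 2 and take an integer k >= a.  Separating j >= 0 from j < 0 one finds
([weight_bound])
  2^{j l} (1 + t 4^j)^-k <= (1 + t)^-a (2^{-j s} + 2^{j N}),
and the sum over j is bounded by (1 + t)^-a times the norms of u0 of orders - s and N.

Four points take work.

Uniqueness for the heat equation.  The solution is only known to be tempered at each time and
continuous and differentiable when tested, so the formula for Delta_j u(t) has to be derived
([heat_repr]).  For a cutoff chi supported in r <= d, the functions
f_n(t) = < u(t), F((-r)^n chi F^-1 psi) > satisfy f_n' = f_{n+1}, because the Laplacian of a
Fourier transform is the Fourier transform of the product with - r.  Temperedness at the fixed time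
t gives |f_n(t)| <= K(t) M^n, with M independent of t and no control of K(t).
The derivative relation makes K locally bounded ([uniform_bound]): otherwise there would be nested
intervals on which the functions are not uniformly bounded and which successively avoid the points
with K(t) <= 1, 2, 3, ..., and a common point would contradict the pointwise bound.  So f_0 is the
sum of its Taylor series at 0, and this series is also that of < u0, F(e^{-t r} chi F^-1 psi) >.

Smoothing symbols.  The seminorms of e^{-tau r} chi, of (-r)^n chi and of the Taylor
remainders of e^{-t r} chi must be bounded uniformly in tau or n.  In each case the profile
belongs to a family that differentiation in r maps to multiples of its members, and a single
induction ([fam_bound]) treats the three of them.

High regularity.  When N > 3/p the hypothesis concerns the derivatives of u0.  The identity
phi = sum_i xi_i (xi_i / r) phi writes a block as a combination of blocks of first derivatives
([bernstein1]); iterated, it bounds 2^{j N} || Delta_j u0 ||_p by the quantities that the hypothesis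
makes summable.  For - s, which is at most 3/p, the hypothesis is about u0 itself.

Fourier analysis.  Complex functions are handled through their real and imaginary parts, and all
transforms are combinations of tr th f (x) = int cos (x . xi + th) f(xi) dxi.  Differentiation in x
shifts the phase th by pi / 2 and multiplies f by a coordinate; multiplication by a coordinate
differentiates f.  Hence the transforms of Schwartz functions are Schwartz, with explicit control
of the seminorms ([tr_rSB]).  The transform of the Gaussian is computed from a differential
equation, and the inversion formula [tr_tr] follows by Gaussian regularisation and Fubini's theorem. *)

Local Open Scope classical_set_scope.
Local Open Scope ring_scope.

(** * Lebesgue measure under dilations and translations *)

Lemma sigma_finite_product d1 d2 (T1 : measurableType d1) (T2 : measurableType d2)
    (R : realType) (m1 : {sigma_finite_measure set T1 -> \bar R})
    (m2 : {sigma_finite_measure set T2 -> \bar R}) :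
  sigma_finite setT (m1 \x m2)%E.
Proof.
have /sigma_finiteP[F [TF ndF Foo]] := sigma_finiteT m1.
have /sigma_finiteP[G [TG ndG Goo]] := sigma_finiteT m2.
exists (fun n => F n `*` G n).
  rewrite -setXTT TF TG predeqE => -[x y]; split => [[/= [n _ Fn] [k _ Gk]]|].
    exists (maxn n k) => //; split => /=.
    - by move: x Fn; exact/subsetPset/ndF/leq_maxl.
    - by move: y Gk; exact/subsetPset/ndG/leq_maxr.
  by move=> [n _ []/= ? ?]; split; exists n.
move=> k; have [? ?] := Foo k; have [? ?] := Goo k.
split; first exact: measurableX.
by rewrite product_measure1E// lte_mul_pinfty// ge0_fin_numE.
Qed.

Definition leb2 (R : realType) : set (measurableTypeR R * measurableTypeR R)%type -> \bar R :=
  (@lebesgue_measure R \x @lebesgue_measure R)%E.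
Arguments leb2 R : clear implicits.
HB.instance Definition _ R := Measure.on (@leb2 R).
HB.instance Definition _ R := @Measure_isSigmaFinite.Build _ _ _ (leb2 R)
  (sigma_finite_product _ _).

(** [leb3 R] with its structure of sigma-finite measure, which Fubini's theorem asks for *)
Definition mu3 (R : realType) : set (M3 R) -> \bar R := (leb2 R \x @lebesgue_measure R)%E.
Arguments mu3 R : clear implicits.
HB.instance Definition _ R := Measure.on (@mu3 R).
HB.instance Definition _ R := @Measure_isSigmaFinite.Build _ _ _ (mu3 R)
  (sigma_finite_product _ _).

Definition affine1 (R : realType) (a b : R) : measurableTypeR R -> measurableTypeR R :=
  fun x => a * x + b.

Definition affine3 (R : realType) (a : R) (b : R3 R) : M3 R -> M3 R :=
  fun x => a *: (x : R3 R) + b.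

Lemma measurable_affine1 (R : realType) (a b : R) : measurable_fun setT (affine1 a b).
Proof. by apply: measurable_funD => //; exact: measurable_funM. Qed.

(** By uniqueness of Lebesgue measure, it suffices to compare intervals. *)
Lemma lebesgue_measure_affine (R : realType) (a b : R) : a != 0 ->
  forall A, measurable A ->
  (@lebesgue_measure R A = `|a|%:E *
     @lebesgue_measure R (affine1 a b @^-1` A))%E.
Proof.
move=> a0 A mA.
have mf := measurable_affine1 a b.
rewrite [LHS](@lebesgue_measure_unique R (mscale (NngNum (normr_ge0 a))
  (pushforward (@lebesgue_measure R) (affine1 a b))) _ A mA)//.
move=> _ [[c d] _ <-] /=; rewrite /mscale/= /pushforward.
have [ap|an] := ltP 0 a.
  rewrite (_ : _ @^-1` _ = `](c - b) / a, (d - b) / a]%classic); last first.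
    apply/seteqP; split => x /=; rewrite !in_itv/= ltr_pdivrMr// ler_pdivlMr// mulrC;
      by rewrite ltrBlDr lerBrDr.
  rewrite !lebesgue_measure_itv/= !lte_fin ltr_pM2r ?invr_gt0// ltrD2r.
  case: ifPn => _; rewrite ?mule0//.
  by rewrite -!EFinB -EFinM gtr0_norm//; congr EFin; field.
have {an} an : a < 0 by rewrite lt_neqAle a0.
rewrite (_ : _ @^-1` _ = `[(d - b) / a, (c - b) / a[%classic); last first.
  apply/seteqP; split => x /=; rewrite !in_itv/= ler_ndivrMr// ltr_ndivlMr//;
    by rewrite [x * a]mulrC ltrBlDr lerBrDr andbC.
rewrite !lebesgue_measure_itv/= !lte_fin ltr_nM2r ?invr_lt0// ltrD2r.
case: ifPn => _; rewrite ?mule0//.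
by rewrite -!EFinB -EFinM ltr0_norm//; congr EFin; field.
Qed.

(** By uniqueness of the product measure, it suffices to compare rectangles.  This makes
   the change of variables in one dimension pass to the space, one factor at a time. *)
Lemma product_measure_change d1 d2 (T1 : measurableType d1) (T2 : measurableType d2)
    (R : realType) (m1 : {sigma_finite_measure set T1 -> \bar R})
    (m2 : {sigma_finite_measure set T2 -> \bar R}) (f1 : T1 -> T1) (f2 : T2 -> T2)
    (k1 k2 : R) : 0 <= k1 -> 0 <= k2 ->
  measurable_fun setT f1 -> measurable_fun setT f2 ->
  (forall A, measurable A -> m1 A = k1%:E * m1 (f1 @^-1` A))%E ->
  (forall A, measurable A -> m2 A = k2%:E * m2 (f2 @^-1` A))%E ->
  forall X, measurable X ->
  ((m1 \x m2) X = (k1 * k2)%:E * (m1 \x m2) ((fun z => (f1 z.1, f2 z.2)) @^-1` X))%E.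
Proof.
move=> k10 k20 mf1 mf2 h1 h2 X mX.
have mF : measurable_fun setT (fun z : T1 * T2 => (f1 z.1, f2 z.2)).
  by apply: measurable_fun_pair; apply: measurableT_comp.
rewrite (@product_measure_unique _ _ _ _ _ m1 m2
  (mscale (NngNum (mulr_ge0 k10 k20)) (pushforward (m1 \x m2)%E
    (fun z : T1 * T2 => (f1 z.1, f2 z.2)))))//.
move=> A B mA mB.
have mA' : measurable (f1 @^-1` A) by rewrite -[X in measurable X]setTI; exact: mf1.
have mB' : measurable (f2 @^-1` B) by rewrite -[X in measurable X]setTI; exact: mf2.
transitivity ((k1 * k2)%:E * (m1 \x m2) ((f1 @^-1` A) `*` (f2 @^-1` B)))%E.
  by [].
rewrite product_measure1E// (h1 A mA) (h2 B mB).
by rewrite EFinM muleACA.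
Qed.

Section leb3_affine.
Context {R : realType}.
Implicit Types (a : R) (b : R3 R).

Lemma measurable_affine3 a b :
  measurable_fun [set: M3 R] (affine3 a b).
Proof.
by repeat (apply: measurable_fun_pair); apply: measurable_funD => //;
  apply: measurable_funM => //; repeat apply: measurableT_comp => //.
Qed.

Lemma mu3_affine a b : a != 0 -> forall X, measurable X ->
  (mu3 R X = (`|a| ^+ 3)%:E * mu3 R ((affine3 a b) @^-1` X))%E.
Proof.
move=> a0 X mX.
have m1 (c : R) := measurable_affine1 a c.
have mm : measurable_fun setT (fun z : measurableTypeR R * measurableTypeR R =>
   (affine1 a b.1.1 z.1, affine1 a b.1.2 z.2)).
  by apply: measurable_fun_pair; exact: (measurableT_comp (m1 _)).
have := @product_measure_change _ _ _ _ R (leb2 R) (@lebesgue_measure R) _ _ _ _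
  (mulr_ge0 (normr_ge0 a) (normr_ge0 a)) (normr_ge0 a) mm (m1 b.2)
  (product_measure_change (normr_ge0 a) (normr_ge0 a) (m1 b.1.1) (m1 b.1.2)
    (lebesgue_measure_affine b.1.1 a0) (lebesgue_measure_affine b.1.2 a0))
  (lebesgue_measure_affine b.2 a0) X mX.
by rewrite -!expr2 -exprSr.
Qed.

Lemma ge0_integral_affine3 a b (f : M3 R -> \bar R) : a != 0 ->
  measurable_fun setT f -> (forall x, 0 <= f x)%E ->
  (\int[mu3 R]_x f x = (`|a| ^+ 3)%:E * \int[mu3 R]_x f (affine3 a b x))%E.
Proof.
move=> a0 mf f0.
have ma := measurable_affine3 a b.
pose k := NngNum (exprn_ge0 3 (normr_ge0 a)).
pose nu : {measure set (M3 R) -> \bar R} :=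
  measure_function_pushforward__canonical__measure_function_Measure (mu3 R) ma.
rewrite (@eq_measure_integral _ _ _ _ (mscale k nu)); last first.
  by move=> A mA _; exact: (mu3_affine b a0 mA).
rewrite (@ge0_integral_mscale _ _ _ nu setT measurableT k f mf (fun x _ => f0 x)).
have -> : (\int[nu]_x f x = \int[mu3 R]_x f (affine3 a b x))%E; last by [].
exact: (@ge0_integral_pushforward _ _ _ _ _ _ ma (mu3 R) setT f measurableT mf (fun x _ => f0 x)).
Qed.

End leb3_affine.

(** * Borel sets of the product and open sets *)

Section measurability3.
Context {R : realType}.

(** The measurable structure is that of a product of Borel lines; open sets are measurable
   because the topology has a countable base of boxes. *)
Lemma open_measurable3 (U : set (R3 R)) : open U -> measurable (U : set (M3 R)).
Proof.
move=> oU.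
pose box (q : rat * rat * rat * nat) : set (M3 R) :=
  ((ball (ratr q.1.1.1 : R) (q.2.+1%:R^-1) `*` ball (ratr q.1.1.2 : R) (q.2.+1%:R^-1))
     `*` ball (ratr q.1.2 : R) (q.2.+1%:R^-1)).
pose F q := if `[< box q `<=` U >] then box q else set0.
have -> : (U : set (M3 R)) = \bigcup_q F q.
  apply/seteqP; split=> [x Ux|x [q _]]; last first.
    by rewrite /F; case: asboolP => // bU; exact: bU.
  have /nbhs_ballP[e e0 eU] : nbhs x U by exact: open_nbhs_nbhs.
  have [n ne] : exists n : nat, n.+1%:R^-1 < e / 2.
    have : \forall n \near \oo, (n.+1%:R^-1 : R) < e / 2.
      by apply: (cvgr_lt 0) => //; [exact: cvg_harmonic|exact: divr_gt0].
    by case=> n _ /(_ n (leqnn n)); exists n.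
  have d0 : 0 < (n.+1%:R^-1 : R) by rewrite invr_gt0.
  have rat_near (y : R) : exists q : rat, `|ratr q - y| < n.+1%:R^-1.
    have /rat_in_itvoo[q] : y < y + n.+1%:R^-1 by rewrite ltrDl.
    rewrite in_itv/= => /andP[h1 h2]; exists q.
    by rewrite ger0_norm ?subr_ge0 ?(ltW h1)// ltrBlDl.
  have [q1 h1] := rat_near x.1.1; have [q2 h2] := rat_near x.1.2.
  have [q3 h3] := rat_near x.2.
  exists (q1, q2, q3, n) => //; rewrite /F asboolT.
    by split; [split|]; rewrite /box /= -ball_normE.
  move=> y [[]]; rewrite /= -!ball_normE /= => k1 k2 k3; apply: eU.
  have tri (a b c : R) : `|a - b| < n.+1%:R^-1 -> `|a - c| < n.+1%:R^-1 ->
      `|b - c| < e.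
    move=> ab ac; rewrite (splitr e); apply: le_lt_trans (ltrD (lt_trans ab ne) (lt_trans ac ne)).
    by rewrite (le_trans (ler_distD a _ _))// [`|b - a|]distrC.
  by split; [split|]; rewrite -ball_normE /=; [exact: tri h1 k1|exact: tri h2 k2|exact: tri h3 k3].
apply: countable_bigcupT_measurable => [|q]; first exact: countableP.
rewrite /F; case: ifP => // _; apply: measurableX; [apply: measurableX|];
  exact: measurable_ball.
Qed.

Lemma continuous_measurable_fun3 (f : R3 R -> R) : continuous f ->
  measurable_fun [set: M3 R] f.
Proof.
move=> /continuousP cf; apply: (measurability _ (RGenOpens.measurableE R)).
move=> _ [_ [a [b ->] <-]]; rewrite setTI; apply: open_measurable3.
exact/cf/interval_open.
Qed.

End measurability3.

(** * An integrable weight *)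

Section weight3.
Context {R : realType}.

Definition wt (x : R) : R := (oneDsqr x)^-1.
(** A tensor product of one-dimensional integrable functions, so that its integral can be
   computed; it decays slowly enough to be dominated by a power of the Euclidean weight [jb]. *)
Definition wt3 (x : R3 R) : R := wt x.1.1 * wt x.1.2 * wt x.2.

Lemma wt_gt0 x : 0 < wt x.
Proof. by rewrite /wt invr_gt0 (lt_le_trans ltr01)// oneDsqr_ge1. Qed.

Lemma wt3_gt0 x : 0 < wt3 x.
Proof. by rewrite !mulr_gt0// wt_gt0. Qed.

Lemma measurable_wt : measurable_fun [set: measurableTypeR R] wt.
Proof.
have cw : continuous (wt : R -> R) by exact: continuous_oneDsqrV.
exact: (continuous_measurable_fun cw).
Qed.

Lemma integral_wt : (\int[@lebesgue_measure R]_x (wt x)%:E = pi%:E)%E.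
Proof.
rewrite (@ge0_symfun_integralT _ wt).
- rewrite (_ : [set x | _] = `[0, +oo[%classic) ?integral0y_oneDsqr; last first.
    by apply/seteqP; split => x/=; rewrite in_itv/= andbT.
  by rewrite -EFinM; congr EFin; field.
- by move=> x; exact/ltW/wt_gt0.
- exact: continuous_oneDsqrV.
- by move=> x; rewrite /wt /oneDsqr/= sqrrN.
Qed.

(** Tonelli's theorem, applied twice *)
Lemma integral_tensor3 (w : R -> R) (c : R) : (forall t, 0 <= w t) ->
  measurable_fun [set: measurableTypeR R] w ->
  (\int[@lebesgue_measure R]_t (w t)%:E = c%:E)%E ->
  (\int[leb3 R]_x (w x.1.1 * w x.1.2 * w x.2)%:E = (c ^+ 3)%:E)%E.
Proof.
move=> w0 mw wc.
have c0 : 0 <= c by rewrite -lee_fin -wc integral_ge0// => t _; rewrite lee_fin.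
have mwE : measurable_fun [set: measurableTypeR R] (EFin \o w) by exact/measurable_EFinP.
have mw2 : measurable_fun setT (fun x : measurableTypeR R * measurableTypeR R => w x.1 * w x.2).
  by apply: measurable_funM; apply: (measurableT_comp mw).
rewrite -[X in integral X]/(mu3 R : set _ -> _) (@fubini_tonelli1 _ _ _ _ _ (leb2 R) (@lebesgue_measure R)); last 2 first.
- apply/measurable_EFinP; apply: measurable_funM; last by apply: (measurableT_comp mw).
  exact: (measurableT_comp mw2).
- by move=> x; rewrite lee_fin !mulr_ge0.
rewrite /fubini_F.
under eq_integral => x _.
  rewrite /=.
  under eq_integral => y _ do rewrite EFinM.
  rewrite ge0_integralZl ?lee_fin ?mulr_ge0//; last by move=> ? _; rewrite lee_fin.
  rewrite wc.
  over.
rewrite ge0_integralZr//; last 2 first.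
- exact/measurable_EFinP.
- by move=> x _; rewrite lee_fin mulr_ge0.
rewrite (@fubini_tonelli1 _ _ _ _ _ (@lebesgue_measure R) (@lebesgue_measure R)); last 2 first.
- exact/measurable_EFinP.
- by move=> x; rewrite lee_fin mulr_ge0.
rewrite /fubini_F.
under eq_integral => x _.
  rewrite /=.
  under eq_integral => y _ do rewrite EFinM.
  rewrite ge0_integralZl ?lee_fin//; last by move=> ? _; rewrite lee_fin.
  rewrite wc.
  over.
rewrite ge0_integralZr ?lee_fin//; last by move=> ? _; rewrite lee_fin.
by rewrite wc -!EFinM !exprS expr0 mulr1 mulrA.
Qed.

Lemma measurable_wt3 : measurable_fun [set: M3 R] wt3.
Proof.
apply: measurable_funM; first apply: measurable_funM.
- by apply: (measurableT_comp measurable_wt); exact: measurableT_comp.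
- by apply: (measurableT_comp measurable_wt); exact: measurableT_comp.
- by apply: (measurableT_comp measurable_wt).
Qed.

Lemma integral_wt3_lty : (\int[leb3 R]_x (wt3 x)%:E < +oo)%E.
Proof.
rewrite /wt3 (@integral_tensor3 wt pi) ?ltry//; last exact: integral_wt.
- by move=> t; exact/ltW/wt_gt0.
- exact: measurable_wt.
Qed.

Lemma integrable_wt3 : (leb3 R).-integrable setT (EFin \o wt3).
Proof.
apply/integrableP; split; first by apply/measurable_EFinP; exact: measurable_wt3.
under eq_integral => x _ do rewrite /= ger0_norm ?(ltW (wt3_gt0 x))//.
exact: integral_wt3_lty.
Qed.

End weight3.

(** * Coordinates *)

Section coordinates.
Context {R : realType}.
Implicit Types (x y : R3 R) (i j : 'I_3).

(** The coordinates with an index, for sums over directions *)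
Definition co i x : R := if val i == 0%N then x.1.1 else if val i == 1%N then x.1.2 else x.2.

Lemma coD i x y : co i (x + y) = co i x + co i y.
Proof. by rewrite /co; case: ifP => // _; case: ifP. Qed.

Lemma coZ i (a : R) x : co i (a *: x) = a * co i x.
Proof. by rewrite /co; case: ifP => // _; case: ifP. Qed.

Lemma co0 i : co i 0 = 0.
Proof. by rewrite /co; case: ifP => // _; case: ifP. Qed.

Lemma sum3 (V : zmodType) (F : 'I_3 -> V) :
  \sum_(i < 3) F i = F 0 + F 1 + F 2%:R.
Proof.
rewrite !big_ord_recl big_ord0 addr0 addrA.
by congr (_ + _ + _); congr F; apply/val_inj.
Qed.

Lemma dot3_co x y : dot3 x y = \sum_(i < 3) co i x * co i y.
Proof. by rewrite sum3. Qed.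

Lemma co_basis3 i j : co i (basis3 j) = (i == j)%:R.
Proof. by case: i j => [[|[|[|//]]] hi] [[|[|[|//]]] hj]. Qed.

Lemma co_ext x y : (forall i, co i x = co i y) -> x = y.
Proof.
move=> h; case: x y h => [[x1 x2] x3] [[y1 y2] y3] h.
by congr (_, _, _); [exact: (h 0)|exact: (h 1)|exact: (h 2%:R)].
Qed.
 
End coordinates.

(** * The Euclidean norm *)

Section norms.
Context {R : realType}.
Implicit Types (x y : R3 R) (i j : 'I_3).

Lemma dot3_ge0 x : 0 <= dot3 x x.
Proof. by rewrite !addr_ge0// -expr2 sqr_ge0. Qed.

Lemma enorm_ge0 x : 0 <= enorm x.
Proof. exact: sqrtr_ge0. Qed.

Lemma enorm_sqr x : enorm x ^+ 2 = dot3 x x.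
Proof. by rewrite sqr_sqrtr// dot3_ge0. Qed.

Lemma co_le_enorm i x : `|co i x| <= enorm x.
Proof.
rewrite -ler_sqr ?nnegrE ?enorm_ge0// enorm_sqr real_normK ?num_real//.
rewrite /co /dot3 -!expr2.
by case: ifP => _; [|case: ifP => _]; have := sqr_ge0 x.1.1; have := sqr_ge0 x.1.2;
  have := sqr_ge0 x.2; lra.
Qed.

Lemma enorm_le_sum x : enorm x <= \sum_(i < 3) `|co i x|.
Proof.
rewrite -ler_sqr ?nnegrE ?enorm_ge0//; last by apply: sumr_ge0.
rewrite enorm_sqr dot3_co !sum3.
rewrite -[co 0 x * _]expr2 -[co 1 x * _]expr2 -[co 2%:R x * _]expr2.
rewrite -(real_normK (num_real (co 0 x))) -(real_normK (num_real (co 1 x))).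
rewrite -(real_normK (num_real (co 2%:R x))).
have := normr_ge0 (co 0 x); have := normr_ge0 (co 1 x); have := normr_ge0 (co 2%:R x).
move: `|co 0 x| `|co 1 x| `|co 2%:R x| => a b c; nra.
Qed.

Lemma enormZ (a : R) x : enorm (a *: x) = `|a| * enorm x.
Proof.
rewrite /enorm -sqrtr_sqr -sqrtrM ?sqr_ge0//; congr Num.sqrt.
by rewrite /dot3 /=; rewrite /GRing.scale/=; ring.
Qed.

Lemma enorm_triangle x y : enorm (x + y) <= enorm x + enorm y.
Proof.
rewrite -ler_sqr ?nnegrE ?addr_ge0 ?enorm_ge0// sqrrD !enorm_sqr.
have -> : dot3 (x + y) (x + y) = dot3 x x + dot3 x y *+ 2 + dot3 y y.
  by rewrite /dot3 /=; ring.
rewrite lerD2r lerD2l ler_pMn2r//.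
apply: (le_trans (ler_norm _)).
rewrite -ler_sqr ?nnegrE ?mulr_ge0 ?enorm_ge0// real_normK ?num_real//.
rewrite exprMn !enorm_sqr /dot3.
have := sqr_ge0 (x.1.1 * y.1.2 - x.1.2 * y.1.1).
have := sqr_ge0 (x.1.1 * y.2 - x.2 * y.1.1).
have := sqr_ge0 (x.1.2 * y.2 - x.2 * y.1.2).
lra.
Qed.

(** The weight of the Schwartz seminorms *)
Definition jb x : R := 1 + enorm x.

Lemma jb_ge1 x : 1 <= jb x.
Proof. by rewrite lerDl enorm_ge0. Qed.

Lemma jb_gt0 x : 0 < jb x.
Proof. exact: lt_le_trans (jb_ge1 x). Qed.

Lemma jbX_gt0 n x : 0 < jb x ^+ n.
Proof. by rewrite exprn_gt0// jb_gt0. Qed.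

Lemma jbX_ge1 n x : 1 <= jb x ^+ n.
Proof. by rewrite exprn_ege1// jb_ge1. Qed.

Lemma co_le_jb i x : `|co i x| <= jb x.
Proof. by rewrite (le_trans (co_le_enorm i x))// lerDr. Qed.

(** Each coordinate contributes [1 + t ^ 2 <= jb x ^+ 2]; this is where the exponent 6, which
   recurs below as the price of integrability, comes from. *)
Lemma jb_le_wt3 x : 1 <= jb x ^+ 6 * wt3 x.
Proof.
have h i : jb x ^+ 2 * wt (co i x) >= 1.
  rewrite /wt -/(_ / _) ler_pdivlMr ?(lt_le_trans ltr01) ?oneDsqr_ge1// mul1r.
  rewrite /oneDsqr -(real_normK (num_real (co i x))).
  have := co_le_enorm i x; have := normr_ge0 (co i x); have := enorm_ge0 x.
  by rewrite /jb; move: `|co i x| => a; nra.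
rewrite /wt3 (_ : _ * _ = (jb x ^+ 2 * wt x.1.1) * (jb x ^+ 2 * wt x.1.2) * (jb x ^+ 2 * wt x.2)); last by ring.
have h0 := h 0; have h1 := h 1; have h2 := h 2%:R.
by apply: mulr_ege1 => //; apply: mulr_ege1.
Qed.

(** Peetre's inequality in the case needed for Taylor remainders *)
Lemma jb_shift x y : enorm y <= 1 -> jb x <= 2 * jb (x + y).
Proof.
move=> y1; have := enorm_triangle (x + y) (- y); rewrite addrK.
rewrite -[- y]scaleN1r enormZ normrN1 mul1r /jb => h.
have := enorm_ge0 (x + y); lra.
Qed.

Lemma co_le_norm i x : `|co i x| <= `|x|.
Proof.
rewrite /co; case: ifP => _; [|case: ifP => _].
- by rewrite !prod_normE !le_max lexx.
- by rewrite !prod_normE !le_max lexx orbT.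
- by rewrite prod_normE le_max lexx orbT.
Qed.

Lemma enorm_le_norm x : enorm x <= 3 * `|x|.
Proof.
apply: (le_trans (enorm_le_sum x)); rewrite sum3.
by have := co_le_norm 0 x; have := co_le_norm 1 x; have := co_le_norm 2%:R x; lra.
Qed.

End norms.

(** * Partial derivatives of real functions *)

Section differentiability.
Context {R : realType}.
Implicit Types (x y : R3 R) (i j : 'I_3) (f g : R3 R -> R).

(** The candidate differential of a function with prescribed partial derivatives *)
Definition lform (g : 'I_3 -> R) : R3 R -> R := fun h => \sum_(i < 3) co i h * g i.

Lemma lform_linear (g : 'I_3 -> R) : linear (lform g).
Proof.
move=> a x y; rewrite /lform !sum3 !coD !coZ /GRing.scale/=; ring.
Qed.
HB.instance Definition _ (g : 'I_3 -> R) :=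
  @GRing.isLinear.Build R (R3 R) R *:%R (lform g) (lform_linear g).

Lemma co_continuous i : continuous (co i : R3 R -> R).
Proof.
have c11 : continuous (fun x : R * R * R => x.1.1).
  by move=> x; apply: (@continuous_comp (R * R * R)%type (R * R)%type R
    (fun z => z.1) (fun z => z.1) x); apply: cvg_fst.
have c12 : continuous (fun x : R * R * R => x.1.2).
  by move=> x; apply: (@continuous_comp (R * R * R)%type (R * R)%type R
    (fun z => z.1) (fun z => z.2) x); [apply: cvg_fst|apply: cvg_snd].
have c2 : continuous (fun x : R * R * R => x.2) by move=> x; apply: cvg_snd.
by case: i => [[|[|[|//]]] hi]; [exact: c11|exact: c12|exact: c2].
Qed.

Lemma lform_continuous (g : 'I_3 -> R) : continuous (lform g).
Proof.
have -> : lform g = fun h => co 0 h * g 0 + co 1 h * g 1 + co 2%:R h * g 2%:R.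
  by apply/funext => h; rewrite /lform sum3.
move=> x; apply: cvgD; [apply: cvgD|]; (apply: cvgM; [exact: co_continuous|exact: cvg_cst]).
Qed.

Lemma lform_basis (g : 'I_3 -> R) i : lform g (basis3 i) = g i.
Proof.
rewrite /lform (bigD1 i)//= co_basis3 eqxx mul1r big1 ?addr0// => j ji.
by rewrite co_basis3 (negbTE ji) mul0r.
Qed.

(** A quadratic remainder gives the differential and with it all partial derivatives.  The
   norm here is the sup norm of the product. *)
Lemma differentiable_quadratic f x (g : 'I_3 -> R) (K : R) :
  (forall h, `|h| <= 1 -> `|f (h + x) - f x - \sum_(i < 3) co i h * g i| <= K * `|h| ^+ 2) ->
  differentiable f x /\ forall i, 'D_(basis3 i) f x = g i.
Proof.
move=> hK.
pose V : normedModType R := (R * R * R)%type; pose W : normedModType R := R.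
have fE : (f : V -> W) \o shift (x : V) = cst (f x : W) + (lform g : V -> W) +o_ (0 : V) id.
  apply/eqaddoP => _ /posnumP[e]; have [K0|K0] := leP K 0; near=> h; rewrite !fctE/=.
    have h1 : `|h| <= 1 by near: h; apply: (@nbhs0_le _ V).
    rewrite opprD addrA; apply: (le_trans (hK h h1)).
    by rewrite (@le_trans _ _ 0)// ?mulr_ge0// mulr_le0_ge0// sqr_ge0.
  have h1 : `|h| <= 1.
    by near: h; apply: (@nbhs0_le _ V).
  rewrite opprD addrA; apply: (le_trans (hK h h1)).
  rewrite expr2 mulrA ler_wpM2r//.
  rewrite mulrC -ler_pdivlMr//; near: h; apply: (@nbhs0_le _ V).
  exact: divr_gt0.
have dE := @diff_unique R V W f (lform g) x (@lform_continuous g) fE.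
have df : differentiable f x.
  by apply/diff_locallyP; rewrite dE; split => //; exact: lform_continuous.
by split => // i; rewrite deriveE// dE; exact: lform_basis.
Unshelve. all: by end_near. Qed.

Definition rpd i f : R3 R -> R := fun x => 'D_(basis3 i) f x.
Definition rpds (b : seq 'I_3) f : R3 R -> R := foldr rpd f b.
Definition rsmooth f : Prop := forall b x, differentiable (rpds b f) x.
Definition diff3 f : Prop := forall x, differentiable f x.

Lemma rpds_rcons b i f : rpds (rcons b i) f = rpds b (rpd i f).
Proof. by rewrite /rpds foldr_rcons. Qed.

Lemma diff3_cst (c : R) : diff3 (fun=> c).
Proof. by move=> x; exact: differentiable_cst. Qed.

Lemma rpd_cst i (c : R) : rpd i (fun=> c) = fun=> 0.
Proof. by apply/funext => x; rewrite /rpd -[fun=> c]/(cst c) derive_cst. Qed.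

Lemma co_diff j x :
  differentiable (co j) x /\ forall i, 'D_(basis3 i) (co j) x = (j == i)%:R.
Proof.
apply: (@differentiable_quadratic _ _ _ 0) => h _.
rewrite coD addrK mul0r normr_le0 subr_eq0 (bigD1 j)//= eqxx mulr1 big1 ?addr0//.
by move=> k /negbTE; rewrite eq_sym => ->; rewrite mulr0.
Qed.

Lemma diff3_co i : diff3 (co i).
Proof. by move=> x; have [] := co_diff i x. Qed.

Lemma rpd_co i j : rpd i (co j) = fun=> (j == i)%:R.
Proof. by apply/funext => x; rewrite /rpd (co_diff j x).2. Qed.

Lemma diff3D f g : diff3 f -> diff3 g -> diff3 (fun x => f x + g x).
Proof. by move=> df dg x; exact: (differentiableD (df x) (dg x)). Qed.

Lemma rpdD i f g : diff3 f -> diff3 g ->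
  rpd i (fun x => f x + g x) = fun x => rpd i f x + rpd i g x.
Proof.
move=> df dg; apply/funext => x.
have := deriveD (diff_derivable (v := basis3 i) (df x)) (diff_derivable (dg x)).
by [].
Qed.

Lemma diff3M f g : diff3 f -> diff3 g -> diff3 (fun x => f x * g x).
Proof. by move=> df dg x; exact: (differentiableM (df x) (dg x)). Qed.

Lemma rpdM i f g : diff3 f -> diff3 g ->
  rpd i (fun x => f x * g x) = fun x => f x * rpd i g x + rpd i f x * g x.
Proof.
move=> df dg; apply/funext => x; rewrite [rpd i f x * _]mulrC.
have := deriveM (diff_derivable (v := basis3 i) (df x)) (diff_derivable (dg x)).
by [].
Qed.

Lemma diff3Z (c : R) f : diff3 f -> diff3 (fun x => c * f x).
Proof. by move=> df; exact: (diff3M (@diff3_cst c) df). Qed.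

Lemma rpdZ i (c : R) f : diff3 f -> rpd i (fun x => c * f x) = fun x => c * rpd i f x.
Proof.
move=> df; rewrite (rpdM i (@diff3_cst c) df).
by rewrite rpd_cst; apply/funext => x; rewrite mul0r addr0.
Qed.

Lemma diff3_comp (F dF : R -> R) f : (forall x, is_derive (f x) 1 F (dF (f x))) -> diff3 f ->
  diff3 (fun x => F (f x)).
Proof.
move=> dFf df x; apply: (@differentiable_comp _ _ _ _ f F) => //.
by apply/derivable1_diffP; exact: ex_derive.
Qed.

Lemma rpd_comp i (F dF : R -> R) f : (forall x, is_derive (f x) 1 F (dF (f x))) -> diff3 f ->
  rpd i (fun x => F (f x)) = fun x => dF (f x) * rpd i f x.
Proof.
move=> dFf df; apply/funext => x; rewrite /rpd.
have dF1 : differentiable F (f x) by apply/derivable1_diffP; exact: ex_derive.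
rewrite deriveE; last exact: (@differentiable_comp _ _ _ _ f F).
rewrite (@diff_comp _ _ _ _ f F)//= diff1E// deriveE//.
by rewrite derive1E derive_val mulrC.
Qed.

Lemma diff3_dil (a : R) f : diff3 f -> diff3 (fun x => f (a *: x)).
Proof.
move=> df x; apply: (@differentiable_comp _ _ _ _ ( *:%R a) f) => //.
Qed.

Lemma rpd_dil i (a : R) f : diff3 f ->
  rpd i (fun x => f (a *: x)) = fun x => a * rpd i f (a *: x).
Proof.
move=> df; apply/funext => x; rewrite /rpd.
rewrite deriveE; last exact: diff3_dil.
have -> : (fun x => f (a *: x)) = f \o ( *:%R a) by [].
rewrite diff_comp//= deriveE// diff_val -[a *: basis3 i]/(a *: (basis3 i : R3 R)).
by rewrite linearZ.
Qed.

End differentiability.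

(** * Smooth functions of polynomial growth and real Schwartz functions *)

Section function_classes.
Context {R : realType}.
Implicit Types (x y : R3 R) (i j : 'I_3) (f g : R3 R -> R) (A B : (R3 R -> R) -> Prop).

Lemma rsmooth_rpd i f : rsmooth f -> rsmooth (rpd i f).
Proof. by move=> sf b x; rewrite -rpds_rcons. Qed.

Lemma rsmooth_diff3 f : rsmooth f -> diff3 f.
Proof. by move=> sf x; exact: (sf [::]). Qed.

Lemma rpds_closed A : (forall f i, A f -> A (rpd i f)) -> forall b f, A f -> A (rpds b f).
Proof. by move=> cA; elim=> //= i b IH f Af; apply: cA; exact: IH. Qed.

(** Smoothness and the classes below are proved by coinduction: it is enough to find a class of
   differentiable functions that is stable under partial differentiation. *)
Lemma rsmooth_coind A : (forall f, A f -> diff3 f) -> (forall f i, A f -> A (rpd i f)) ->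
  forall f, A f -> rsmooth f.
Proof. by move=> dA cA f Af b; apply: dA; exact: rpds_closed. Qed.

Lemma rpdsD b f g : rsmooth f -> rsmooth g ->
  rpds b (fun x => f x + g x) = fun x => rpds b f x + rpds b g x.
Proof.
elim/last_ind: b f g => // b i IH f g sf sg.
rewrite !rpds_rcons rpdD; [|exact: rsmooth_diff3..].
by rewrite IH//; exact: rsmooth_rpd.
Qed.

Lemma rpdsZ b (c : R) f : rsmooth f -> rpds b (fun x => c * f x) = fun x => c * rpds b f x.
Proof.
elim/last_ind: b f => // b i IH f sf.
rewrite !rpds_rcons rpdZ; last exact: rsmooth_diff3.
by rewrite IH//; exact: rsmooth_rpd.
Qed.

Definition polybd f : Prop := exists n M, forall x, `|f x| <= M * jb x ^+ n.
(** The multipliers of the Schwartz space *)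
Definition slow f : Prop := rsmooth f /\ forall b, polybd (rpds b f).
Definition rapid f : Prop := forall n, exists M, forall x, jb x ^+ n * `|f x| <= M.
(** The real counterpart of [schwartz]: a complex function is Schwartz if and only if its real
   and imaginary parts are in this class, see [schwartzP]. *)
Definition rschwartz f : Prop := rsmooth f /\ forall b, rapid (rpds b f).

Lemma slow_coind A : (forall f, A f -> diff3 f) -> (forall f i, A f -> A (rpd i f)) ->
  (forall f, A f -> polybd f) -> forall f, A f -> slow f.
Proof.
move=> dA cA pA f Af; split; first exact: (rsmooth_coind dA cA).
by move=> b; apply: pA; exact: rpds_closed.
Qed.

Lemma rschwartz_coind A : (forall f, A f -> diff3 f) -> (forall f i, A f -> A (rpd i f)) ->
  (forall f, A f -> rapid f) -> forall f, A f -> rschwartz f.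
Proof.
move=> dA cA pA f Af; split; first exact: (rsmooth_coind dA cA).
by move=> b; apply: pA; exact: rpds_closed.
Qed.

Lemma slow_rpd i f : slow f -> slow (rpd i f).
Proof.
by move=> [sf pf]; split; [exact: rsmooth_rpd|move=> b; rewrite -rpds_rcons].
Qed.

Lemma rschwartz_rpd i f : rschwartz f -> rschwartz (rpd i f).
Proof.
by move=> [sf pf]; split; [exact: rsmooth_rpd|move=> b; rewrite -rpds_rcons].
Qed.

Lemma slow_diff3 f : slow f -> diff3 f. Proof. by move=> [/rsmooth_diff3]. Qed.
Lemma rschwartz_diff3 f : rschwartz f -> diff3 f. Proof. by move=> [/rsmooth_diff3]. Qed.
Lemma slow_polybd f : slow f -> polybd f. Proof. by move=> [_ /(_ [::])]. Qed.
Lemma rschwartz_rapid f : rschwartz f -> rapid f. Proof. by move=> [_ /(_ [::])]. Qed.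

Lemma rapid_bounded f : rapid f -> exists2 M, 0 <= M & forall x, `|f x| <= M.
Proof.
move=> /(_ 0%N)[M hM]; exists M => [|x].
  by apply: le_trans (hM 0); rewrite mul1r.
by have := hM x; rewrite mul1r.
Qed.

Lemma rapid_polybd f : rapid f -> polybd f.
Proof.
move=> /rapid_bounded[M _ hM]; exists 0%N, M => x; by rewrite expr0 mulr1.
Qed.

Lemma rschwartz_slow f : rschwartz f -> slow f.
Proof. by move=> [sf rf]; split => // b; exact: rapid_polybd. Qed.

Lemma polybd_ge0 f : polybd f -> exists n, exists2 M, 0 <= M & forall x, `|f x| <= M * jb x ^+ n.
Proof.
move=> [n [M hM]]; exists n, `|M| => // x; apply: (le_trans (hM x)).
by rewrite ler_wpM2r ?ler_norm// ltW// jbX_gt0.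
Qed.

Lemma polybdD f g : polybd f -> polybd g -> polybd (fun x => f x + g x).
Proof.
move=> /polybd_ge0[n [M M0 hM]] /polybd_ge0[m [N N0 hN]]; exists (n + m)%N, (M + N) => x.
rewrite mulrDl; apply: (le_trans (ler_normD _ _)); apply: lerD.
  apply: (le_trans (hM x)); rewrite ler_wpM2l// exprD ler_peMr ?jbX_ge1//.
  by rewrite ltW// jbX_gt0.
apply: (le_trans (hN x)); rewrite ler_wpM2l// exprD ler_peMl ?jbX_ge1//.
by rewrite ltW// jbX_gt0.
Qed.

Lemma polybdM f g : polybd f -> polybd g -> polybd (fun x => f x * g x).
Proof.
move=> /polybd_ge0[n [M M0 hM]] /polybd_ge0[m [N N0 hN]]; exists (n + m)%N, (M * N) => x.
by rewrite normrM exprD mulrACA ler_pM.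
Qed.

Lemma rapidM f g : rapid f -> polybd g -> rapid (fun x => f x * g x).
Proof.
move=> rf /polybd_ge0[n [M M0 hM]] m; have [N hN] := rf (m + n)%N; exists (N * M) => x.
rewrite normrM.
have h : jb x ^+ (m + n) * `|f x| * M <= N * M by rewrite ler_wpM2r.
apply: le_trans h; rewrite exprD.
have -> : jb x ^+ m * jb x ^+ n * `|f x| * M = (jb x ^+ m * `|f x|) * (M * jb x ^+ n) by ring.
by rewrite mulrA ler_wpM2l// mulr_ge0// ltW// jbX_gt0.
Qed.

Lemma rapidD f g : rapid f -> rapid g -> rapid (fun x => f x + g x).
Proof.
move=> rf rg n; have [M hM] := rf n; have [N hN] := rg n; exists (M + N) => x.
apply: le_trans (lerD (hM x) (hN x)); rewrite -mulrDr ler_wpM2l ?ler_normD//.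
by rewrite ltW// jbX_gt0.
Qed.

(** If the derivatives of some functions are polynomials in these functions, the algebra that they
   generate is stable under differentiation.  This turns the coinductions into a check on generators. *)
Inductive gen B : (R3 R -> R) -> Prop :=
| gen_base f : B f -> gen B f
| genD f g : gen B f -> gen B g -> gen B (fun x => f x + g x)
| genM f g : gen B f -> gen B g -> gen B (fun x => f x * g x).

Lemma gen_diff3 B : (forall f, B f -> diff3 f) -> forall f, gen B f -> diff3 f.
Proof.
by move=> dB f; elim => {f} [f /dB//|f g _ df _ dg|f g _ df _ dg];
  [exact: diff3D|exact: diff3M].
Qed.

Lemma gen_rpd B : (forall f, B f -> diff3 f /\ forall i, gen B (rpd i f)) ->
  forall f i, gen B f -> gen B (rpd i f).
Proof.
move=> hB.
have dB : forall f, gen B f -> diff3 f by apply: gen_diff3 => f /hB[].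
move=> f i; elim => {f} [f /hB[_ +]|f g Bf IHf Bg IHg|f g Bf IHf Bg IHg]; first exact.
- by rewrite rpdD; [exact: genD|exact: dB..].
- rewrite rpdM; [|exact: dB..].
  by apply: genD; exact: genM.
Qed.

Lemma gen_rsmooth B : (forall f, B f -> diff3 f /\ forall i, gen B (rpd i f)) ->
  forall f, gen B f -> rsmooth f.
Proof.
move=> hB; apply: rsmooth_coind; last by move=> f i; exact: gen_rpd.
by apply: gen_diff3 => f /hB[].
Qed.

Lemma gen_rsmooth_id f : gen rsmooth f -> rsmooth f.
Proof.
apply: gen_rsmooth => g sg; split; first exact: rsmooth_diff3.
by move=> i; exact/gen_base/rsmooth_rpd.
Qed.

Lemma rsmoothM f g : rsmooth f -> rsmooth g -> rsmooth (fun x => f x * g x).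
Proof. by move=> sf sg; apply: gen_rsmooth_id; apply: genM; exact: gen_base. Qed.

Lemma gen_slow B : (forall f, B f -> [/\ diff3 f, forall i, gen B (rpd i f) & polybd f]) ->
  forall f, gen B f -> slow f.
Proof.
move=> hB; apply: slow_coind.
- by apply: gen_diff3 => f /hB[].
- by move=> f i; apply: gen_rpd => {}f /hB[].
- by move=> f; elim => {f} [f /hB[]//|f g _ pf _ pg|f g _ pf _ pg];
    [exact: polybdD|exact: polybdM].
Qed.

Lemma gen_slow_id f : gen slow f -> slow f.
Proof.
apply: gen_slow => g sg; split; [exact: slow_diff3|move=> i|exact: slow_polybd].
exact/gen_base/slow_rpd.
Qed.

Lemma slowD f g : slow f -> slow g -> slow (fun x => f x + g x).
Proof. by move=> sf sg; apply: gen_slow_id; apply: genD; exact: gen_base. Qed.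

Lemma slowM f g : slow f -> slow g -> slow (fun x => f x * g x).
Proof. by move=> sf sg; apply: gen_slow_id; apply: genM; exact: gen_base. Qed.

Lemma slow_cst (c : R) : slow (fun=> c).
Proof.
apply: (@slow_coind (fun f => exists c, f = fun=> c)); last by exists c.
- by move=> _ [d ->]; exact: diff3_cst.
- by move=> _ i [d ->]; rewrite rpd_cst; exists 0.
- by move=> _ [d ->]; exists 0%N, `|d| => x; rewrite mulr1.
Qed.

Lemma slow_co i : slow (co i).
Proof.
apply: (@gen_slow (fun f => slow f \/ f = co i)); last by apply: gen_base; right.
move=> f [sf|->]; split.
- exact: slow_diff3.
- by move=> j; apply: gen_base; left; exact: slow_rpd.
- exact: slow_polybd.
- exact: diff3_co.
- by move=> j; rewrite rpd_co; apply: gen_base; left; exact: slow_cst.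
- by exists 1%N, 1 => x; rewrite mul1r expr1 co_le_jb.
Qed.

Lemma slowZ (c : R) f : slow f -> slow (fun x => c * f x).
Proof. by apply: slowM; exact: slow_cst. Qed.

Lemma slowX f n : slow f -> slow (fun x => f x ^+ n).
Proof.
move=> sf; elim: n => [|n IH]; first exact: slow_cst.
rewrite (_ : (fun x => _) = fun x => f x * f x ^+ n); first exact: slowM.
by apply/funext => x; rewrite exprS.
Qed.

(** The radial variable of all symbols *)
Definition rsq x : R := dot3 x x.

Lemma rsqE x : rsq x = \sum_(i < 3) co i x * co i x.
Proof. exact: dot3_co. Qed.

Lemma slow_rsq : slow rsq.
Proof.
rewrite (_ : rsq = fun x => co 0 x * co 0 x + co 1 x * co 1 x + co 2%:R x * co 2%:R x).
  by apply: slowD; [apply: slowD|]; apply: slowM; exact: slow_co.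
by apply/funext => x; rewrite rsqE sum3.
Qed.

Lemma rpd_rsq i : rpd i rsq = fun x => 2 * co i x.
Proof.
rewrite (_ : rsq = fun x => (co 0 x * co 0 x + co 1 x * co 1 x) + co 2%:R x * co 2%:R x); last first.
  by apply/funext => x; rewrite rsqE sum3.
have dd j : diff3 (fun x => co j x * co j x) by apply: diff3M; exact: diff3_co.
rewrite rpdD ?rpdD ?rpdM; do ?exact: diff3_co; do ?exact: dd; last by apply: diff3D; exact: dd.
rewrite !rpd_co; apply/funext => x.
by case: i => [[|[|[|//]]] hi]; rewrite /= ?(mulr0, mul0r, mulr1, mul1r, addr0, add0r) mulr2n mulrDl !mul1r;
  congr (_ + _).
Qed.

Lemma slow_exp f : slow f -> (forall x, f x <= 0) -> slow (fun x => expR (f x)).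
Proof.
move=> sf f0; apply: (@gen_slow (fun g => slow g \/ g = fun x => expR (f x))); last first.
  by apply: gen_base; right.
move=> g [sg|->]; split.
- exact: slow_diff3.
- by move=> j; apply: gen_base; left; exact: slow_rpd.
- exact: slow_polybd.
- by apply: (@diff3_comp _ expR expR) => //; exact: slow_diff3.
- move=> j; rewrite (@rpd_comp _ _ expR expR) //; last exact: slow_diff3.
  by apply: genM; apply: gen_base; [right|left; exact: slow_rpd].
- by exists 0%N, 1 => x; rewrite mul1r ger0_norm ?expR_ge0// expR_le1.
Qed.

Lemma slow_inv f (c : R) : 0 < c -> slow f -> (forall x, c <= f x) -> slow (fun x => (f x)^-1).
Proof.
move=> c0 sf fc; apply: (@gen_slow (fun g => slow g \/ g = fun x => (f x)^-1)); last first.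
  by apply: gen_base; right.
have f0 x : 0 < f x by exact: lt_le_trans (fc x).
have dinv x : is_derive (f x) 1 (fun r : R => r^-1) (- 1 * ((f x)^-1 * (f x)^-1)).
  have fx0 : f x != 0 by rewrite gt_eqF.
  have := @is_deriveV R id (f x) 1 1 fx0 (is_derive_id _ _).
  by rewrite /= => h; apply: is_derive_eq h _; rewrite /GRing.scale/= mulr1 mulN1r -invfM expr2.
move=> g [sg|->]; split.
- exact: slow_diff3.
- by move=> j; apply: gen_base; left; exact: slow_rpd.
- exact: slow_polybd.
- by apply: (@diff3_comp _ (fun r : R => r^-1) (fun r : R => - 1 * (r^-1 * r^-1))) => //; exact: slow_diff3.
- move=> j; rewrite (@rpd_comp _ _ (fun r : R => r^-1) (fun r : R => - 1 * (r^-1 * r^-1))) //; last exact: slow_diff3.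
  apply: genM; last by apply: gen_base; left; exact: slow_rpd.
  apply: genM; first by apply: gen_base; left; exact: slow_cst.
  by apply: genM; apply: gen_base; right.
- by exists 0%N, c^-1 => x; rewrite expr0 mulr1 ger0_norm ?lef_pV2 ?posrE// invr_ge0 ltW.
Qed.

(** By the product rule, this span is stable under differentiation. *)
Inductive mulspan : (R3 R -> R) -> Prop :=
| mulspanM f g : rschwartz f -> slow g -> mulspan (fun x => f x * g x)
| mulspanD f g : mulspan f -> mulspan g -> mulspan (fun x => f x + g x).

Lemma rschwartzM f g : rschwartz f -> slow g -> rschwartz (fun x => f x * g x).
Proof.
have dm h : mulspan h -> diff3 h.
  elim => {h} [h k sh sk|h k _ dh _ dk]; last exact: diff3D.
  by apply: diff3M; [exact: rschwartz_diff3|exact: slow_diff3].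
move=> sf sg; apply: (@rschwartz_coind mulspan) => //; last exact: mulspanM.
- move=> h i; elim => {h} [h k sh sk|h k mh IHh mk IHk].
    rewrite rpdM; [|exact: rschwartz_diff3|exact: slow_diff3].
    by apply: mulspanD; apply: mulspanM => //; [exact: slow_rpd|exact: rschwartz_rpd].
  by rewrite rpdD; [exact: mulspanD|exact: dm..].
- move=> h; elim => {h} [h k sh sk|h k _ dh _ dk]; last exact: rapidD.
  by apply: rapidM; [exact: rschwartz_rapid|exact: slow_polybd].
Qed.

Lemma rschwartzZ (c : R) f : rschwartz f -> rschwartz (fun x => c * f x).
Proof.
move=> sf; have := rschwartzM sf (slow_cst c); suff -> : (fun x => f x * c) = (fun x => c * f x) by [].
by apply/funext => x; rewrite mulrC.
Qed.

Lemma rschwartzD f g : rschwartz f -> rschwartz g -> rschwartz (fun x => f x + g x).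
Proof.
move=> sf sg; apply: (@rschwartz_coind (fun h => exists f g,
  [/\ rschwartz f, rschwartz g & h = fun x => f x + g x])); last by exists f, g.
- by move=> _ [h [k [sh sk ->]]]; apply: diff3D; exact: rschwartz_diff3.
- move=> _ i [h [k [sh sk ->]]]; rewrite rpdD; [|exact: rschwartz_diff3..].
  by exists (rpd i h), (rpd i k); split => //; exact: rschwartz_rpd.
- by move=> _ [h [k [sh sk ->]]]; apply: rapidD; exact: rschwartz_rapid.
Qed.

Lemma rschwartz_co i f : rschwartz f -> rschwartz (fun x => co i x * f x).
Proof.
move=> sf; have := rschwartzM sf (slow_co i); suff -> : (fun x => f x * co i x) = (fun x => co i x * f x) by [].
by apply/funext => x; rewrite mulrC.
Qed.

Lemma rschwartz0 : rschwartz (fun=> 0).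
Proof.
apply: (@rschwartz_coind (fun h => h = fun=> 0)) => //.
- by move=> _ ->; exact: diff3_cst.
- by move=> _ i ->; rewrite rpd_cst.
- by move=> _ -> n; exists 0 => x; rewrite normr0 mulr0.
Qed.

Lemma rschwartz_dil (a : R) f : a != 0 -> rschwartz f -> rschwartz (fun x => f (a *: x)).
Proof.
move=> a0 sf; apply: (@rschwartz_coind (fun h => exists c g,
  rschwartz g /\ h = fun x => c * g (a *: x))).
- move=> _ [c [g [sg ->]]]; apply: diff3Z; apply: diff3_dil; exact: rschwartz_diff3.
- move=> _ i [c [g [sg ->]]]; exists (c * a), (rpd i g); split; first exact: rschwartz_rpd.
  rewrite rpdZ; last by apply: diff3_dil; exact: rschwartz_diff3.
  by rewrite rpd_dil; [apply/funext => x; rewrite mulrA|exact: rschwartz_diff3].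
- move=> _ [c [g [sg ->]]] n.
  have [M hM] := rschwartz_rapid sg n.
  exists (Num.max 1 `|a|^-1 ^+ n * (M * `|c|)) => x; rewrite normrM.
  have h : jb x ^+ n <= Num.max 1 `|a|^-1 ^+ n * jb (a *: x) ^+ n.
    rewrite -exprMn lerXn2r ?nnegrE ?mulr_ge0 ?(ltW (jb_gt0 _))// ?le_max ?ler01//.
    rewrite /jb enormZ mulrDr mulr1 lerD ?le_max ?lexx//.
    rewrite mulrA ler_peMl ?enorm_ge0// -ler_pdivrMr ?normr_gt0// mul1r.
    by rewrite le_max lexx orbT.
  have := hM (a *: x).
  move: (h) => {h}; set P := jb x ^+ n; set Q := jb (a *: x) ^+ n; set m := Num.max _ _ ^+ n.
  move=> hP hQ.
  have m0 : 0 <= m by rewrite exprn_ge0// le_max ler01.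
  rewrite mulrCA mulrA [m * _]mulrA [`|c| * _]mulrC mulrAC ler_wpM2r//.
  apply: (le_trans (ler_wpM2r (normr_ge0 _) hP)).
  by rewrite -mulrA ler_wpM2l.
- exists 1, f; split => //; apply/funext => x; by rewrite mul1r.
Qed.

(** From [1 + z <= expR z] at [z = y / (n + 1)] *)
Lemma expR_dominates n : exists2 C : R, 0 < C & forall y : R, 0 <= y -> (1 + y) ^+ n * expR (- y) <= C.
Proof.
exists (n.+1%:R ^+ n.+1) => [|y y0]; first by rewrite exprn_gt0.
have y1 : 1 <= 1 + y by rewrite lerDl.
apply: (@le_trans _ _ ((1 + y) ^+ n.+1 * expR (- y))).
  by rewrite ler_wpM2r ?expR_ge0// ler_weXn2l.
rewrite expRN ler_pdivrMr ?expR_gt0//.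
have -> : expR y = expR (y / n.+1%:R) ^+ n.+1 by rewrite -expRM_natr divfK.
rewrite -exprMn lerXn2r ?nnegrE ?mulr_ge0 ?expR_ge0 ?addr_ge0//.
apply: (@le_trans _ _ (n.+1%:R * (1 + y / n.+1%:R))); last first.
  by rewrite ler_wpM2l// expR_ge1Dx.
by rewrite mulrDr mulr1 mulrC divfK// lerD2r ler1n.
Qed.

Definition gauss x : R := expR (- (rsq x / 2)).

Lemma rpd_gauss i : rpd i gauss = fun x => - co i x * gauss x.
Proof.
have sl : slow (fun x => - 2^-1 * rsq x) by apply: slowZ; exact: slow_rsq.
have -> : gauss = fun x => expR (- 2^-1 * rsq x).
  by apply/funext => x; rewrite /gauss; congr expR; rewrite mulNr mulrC.
rewrite (@rpd_comp _ _ expR expR)//; last exact: slow_diff3.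
rewrite rpdZ; last by apply: slow_diff3; exact: slow_rsq.
rewrite rpd_rsq; apply/funext => x; rewrite mulrC.
by congr (_ * _); field.
Qed.

Lemma slow_gauss : slow gauss.
Proof.
rewrite (_ : gauss = fun x => expR (- 2^-1 * rsq x)); last first.
  by apply/funext => x; rewrite /gauss; congr expR; rewrite mulNr mulrC.
apply: slow_exp; first by apply: slowZ; exact: slow_rsq.
by move=> x; rewrite mulNr oppr_le0 mulr_ge0// dot3_ge0.
Qed.

Lemma rschwartz_gauss : rschwartz gauss.
Proof.
apply: (@rschwartz_coind (fun h => exists p, slow p /\ h = fun x => gauss x * p x)).
- by move=> _ [p [sp ->]]; apply: diff3M; apply: slow_diff3 => //; exact: slow_gauss.
- move=> _ i [p [sp ->]]; exists (fun x => rpd i p x + (- 1 * co i x) * p x); split.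
    apply: slowD; first exact: slow_rpd.
    by apply: slowM => //; apply: slowZ; exact: slow_co.
  rewrite rpdM; [|by apply: slow_diff3 => //; exact: slow_gauss..].
  by rewrite rpd_gauss; apply/funext => x; ring.
- move=> _ [p [sp ->]]; apply: rapidM; last exact: slow_polybd.
  move=> n; have [C C0 hC] := expR_dominates n; exists (2 ^+ n * C) => x.
  rewrite ger0_norm ?expR_ge0// /gauss.
  have r0 : 0 <= rsq x / 2 by rewrite divr_ge0// dot3_ge0.
  apply: (@le_trans _ _ (2 ^+ n * ((1 + rsq x / 2) ^+ n * expR (- (rsq x / 2))))).
    rewrite mulrA ler_wpM2r ?expR_ge0// -exprMn lerXn2r ?nnegrE ?(ltW (jb_gt0 _))//.
      by rewrite mulr_ge0// addr_ge0.
    rewrite /jb /rsq -enorm_sqr; have := sqr_ge0 (enorm x - 1); have := enorm_ge0 x.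
    by move: (enorm x) => e; nra.
  by rewrite ler_wpM2l// hC.
- exists (fun=> 1); split; [exact: slow_cst|by apply/funext => x; rewrite mulr1].
Qed.

(** One index bounds both the order of the derivatives and the decay, as in the continuity
   condition of tempered distributions. *)
Definition rSB n f (M : R) : Prop :=
  forall b x, (size b <= n)%N -> jb x ^+ n * `|rpds b f x| <= M.

Lemma rSB_ge0 n f M : rSB n f M -> 0 <= M.
Proof.
move=> /(_ [::] 0 (leq0n _)); apply: le_trans.
by rewrite mulr_ge0// ltW// jbX_gt0.
Qed.

Lemma rSB_le m n f M : (m <= n)%N -> rSB n f M -> rSB m f M.
Proof.
move=> mn h b x bm; apply: le_trans (h b x (leq_trans bm mn)).
by rewrite ler_wpM2r// ler_weXn2l// jb_ge1.
Qed.

Lemma rSB_leM n f M N : M <= N -> rSB n f M -> rSB n f N.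
Proof. by move=> MN h b x bn; apply: le_trans MN; exact: h. Qed.

Lemma rSB_rpd n i f M : rSB n.+1 f M -> rSB n (rpd i f) M.
Proof.
move=> h b x bn; rewrite -rpds_rcons.
apply: le_trans (h (rcons b i) x _); last by rewrite size_rcons.
by rewrite ler_wpM2r// ler_weXn2l// jb_ge1.
Qed.

Lemma rSB_Z n (c : R) f M : rsmooth f -> rSB n f M -> rSB n (fun x => c * f x) (`|c| * M).
Proof.
move=> sf h b x bn; rewrite rpdsZ// normrM mulrCA ler_wpM2l//; exact: h.
Qed.

(** The product rule produces at most [size b] terms in which the coordinate is differentiated. *)
Lemma rSB_co n i f M : rsmooth f -> rSB n.+1 f M ->
  rSB n (fun x => co i x * f x) (n.+1%:R * M).
Proof.
move=> sf h; have M0 := rSB_ge0 h.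
suff main b g : rsmooth g -> (forall b' x, (size b' <= size b)%N -> jb x ^+ n.+1 * `|rpds b' g x| <= M) ->
    forall x, jb x ^+ n * `|rpds b (fun x => co i x * g x) x| <= (size b).+1%:R * M.
  move=> b x bn; apply: (@le_trans _ _ ((size b).+1%:R * M)).
    apply: main => // b' y b'b; apply: h; exact: leq_trans b'b (leqW bn).
  by rewrite ler_wpM2r// ler_nat ltnS.
elim/last_ind: b g => [|b j IH] g sg hg x.
  rewrite mul1r; apply: le_trans (hg [::] x (leqnn _)); rewrite /= normrM exprSr.
  rewrite -mulrA ler_wpM2l ?(ltW (jbX_gt0 _ _))// ler_wpM2r//; exact: co_le_jb.
rewrite rpds_rcons rpdM; [|exact: diff3_co|exact: rsmooth_diff3].
have -> : (fun x => co i x * rpd j g x + rpd j (co i) x * g x) =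
          (fun x => co i x * rpd j g x + (i == j)%:R * g x).
  by apply/funext => y; rewrite rpd_co.
have sj := rsmooth_rpd j sg.
have scj : rsmooth (fun x => co i x * rpd j g x).
  by apply: rsmoothM => //; exact: (slow_co i).1.
have sdg : rsmooth (fun x => (i == j)%:R * g x).
  by apply: rsmoothM => //; exact: (slow_cst _).1.
rewrite rpdsD// rpdsZ// size_rcons.
apply: (@le_trans _ _ (jb x ^+ n * `|rpds b (fun x => co i x * rpd j g x) x| + jb x ^+ n * `|rpds b g x|)).
  rewrite -mulrDr ler_wpM2l ?(ltW (jbX_gt0 _ _))//.
  apply: (le_trans (ler_normD _ _)); rewrite lerD2l normrM.
  by case: (i == j); rewrite ?normr0 ?normr1 ?mul0r ?mul1r.
rewrite -[(size b).+2%:R]natr1 mulrDl mul1r; apply: lerD.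
  apply: IH => // b' y b'b; rewrite -rpds_rcons; apply: hg.
  by rewrite !size_rcons.
apply: le_trans (hg b x _); last by rewrite size_rcons.
by rewrite ler_wpM2r// exprSr ler_peMr ?jb_ge1// ltW// jbX_gt0.
Qed.

Lemma rschwartz_rSB f n : rschwartz f -> exists M, rSB n f M.
Proof.
suff main k : forall f, rschwartz f ->
    exists2 M, 0 <= M & forall b x, (size b <= k)%N -> jb x ^+ n * `|rpds b f x| <= M.
  by move=> sf; have [M _ hM] := main n f sf; exists M.
elim: k => [|k IH] {}f sf.
  have [M hM] := rschwartz_rapid sf n; exists M => [|b x].
    by apply: le_trans (hM 0); rewrite mulr_ge0// ltW// jbX_gt0.
  by rewrite leqn0 size_eq0 => /eqP ->; exact: hM.
have [M M0 hM] := IH f sf.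
have /choice[N hN] : forall i, exists M, 0 <= M /\ forall b x, (size b <= k)%N -> jb x ^+ n * `|rpds b (rpd i f) x| <= M.
  by move=> i; have [N N0 hN] := IH _ (rschwartz_rpd i sf); exists N.
exists (M + \sum_i N i) => [|b x].
  by rewrite addr_ge0// sumr_ge0// => i _; have [] := hN i.
case/lastP: b => [_|b i].
  apply: (le_trans (hM [::] x (leq0n _))).
  by rewrite lerDl sumr_ge0// => i _; have [] := hN i.
rewrite size_rcons ltnS => bk; rewrite rpds_rcons.
apply: (le_trans ((hN i).2 b x bk)); rewrite (bigD1 i)//= addrCA lerDl addr_ge0//.
by rewrite sumr_ge0// => j _; have [] := hN j.
Qed.

End function_classes.

(** * Integrals over the space *)

Section real_integrals.
Context {R : realType}.
Implicit Types (x y : R3 R) (i j : 'I_3) (f g h : R3 R -> R).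

Definition intbl f : Prop := (leb3 R).-integrable setT (EFin \o f).
(** Integrals of real functions over the space; with [intbl] they hide the extended reals. *)
Definition intR f : R := (\int[leb3 R]_x f x)%R.

Lemma diff3_measurable f : diff3 f -> measurable_fun [set: M3 R] f.
Proof.
move=> df; apply: continuous_measurable_fun3 => x; exact/differentiable_continuous.
Qed.

Lemma intbl_le f g : measurable_fun [set: M3 R] f -> (forall x, `|f x| <= g x) -> intbl g -> intbl f.
Proof.
move=> mf fg; apply: le_integrable => //; first exact/measurable_EFinP.
move=> x _; rewrite /= lee_fin [`|g x|]ger0_norm//; exact: le_trans (fg x).
Qed.

Lemma intblZ (c : R) f : intbl f -> intbl (fun x => c * f x).
Proof. by move=> /(integrableZl measurableT c). Qed.

Lemma intblD f g : intbl f -> intbl g -> intbl (fun x => f x + g x).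
Proof. by move=> If Ig; have := integrableD measurableT If Ig. Qed.

Lemma intRZ (c : R) f : intbl f -> intR (fun x => c * f x) = c * intR f.
Proof. by move=> If; exact: RintegralZl. Qed.

Lemma intRD f g : intbl f -> intbl g -> intR (fun x => f x + g x) = intR f + intR g.
Proof. by move=> If Ig; exact: RintegralD. Qed.

Lemma intRB f g : intbl f -> intbl g -> intR (fun x => f x - g x) = intR f - intR g.
Proof. by move=> If Ig; exact: RintegralB. Qed.

Lemma intbl_norm f : intbl f -> intbl (fun x => `|f x|).
Proof. by move=> If; have := integrable_norm If. Qed.

Lemma intblB f g : intbl f -> intbl g -> intbl (fun x => f x - g x).
Proof. by move=> If Ig; have := integrableB measurableT If Ig. Qed.

Lemma eq_intbl f g : f =1 g -> intbl f -> intbl g.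
Proof. by move=> /funext ->. Qed.

Lemma eq_intR f g : f =1 g -> intR f = intR g.
Proof. by move=> fg; congr intR; exact/funext. Qed.

Lemma intR_le f g : intbl f -> intbl g -> (forall x, f x <= g x) -> intR f <= intR g.
Proof. by move=> If Ig fg; apply: le_Rintegral => // x _; exact: fg. Qed.

Lemma normr_intR f : intbl f -> `|intR f| <= intR (fun x => `|f x|).
Proof. by move=> If; exact: le_normr_Rintegral. Qed.

Definition wtI : R := intR wt3.

Lemma wtI_ge0 : 0 <= wtI.
Proof. by apply: Rintegral_ge0 => x _; exact/ltW/wt3_gt0. Qed.

(** How a Schwartz seminorm becomes an integrable bound *)
Lemma jb6_wt3 f M x : jb x ^+ 6 * `|f x| <= M -> `|f x| <= M * wt3 x.
Proof.
move=> h; apply: (@le_trans _ _ ((jb x ^+ 6 * wt3 x) * `|f x|)).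
  by rewrite ler_peMl// jb_le_wt3.
by rewrite mulrAC ler_wpM2r// ltW// wt3_gt0.
Qed.

Lemma intbl_wt f M : measurable_fun [set: M3 R] f -> (forall x, `|f x| <= M * wt3 x) -> intbl f.
Proof. by move=> mf fM; apply: (intbl_le mf fM); apply: intblZ; exact: integrable_wt3. Qed.

Lemma intR_wt f M : measurable_fun [set: M3 R] f -> (forall x, `|f x| <= M * wt3 x) ->
  `|intR f| <= M * wtI.
Proof.
move=> mf fM; have If := intbl_wt mf fM.
apply: (le_trans (normr_intR If)); rewrite -intRZ; last exact: integrable_wt3.
apply: intR_le => //; first exact: integrable_norm.
by apply: intblZ; exact: integrable_wt3.
Qed.

Lemma rapid_intbl f : measurable_fun [set: M3 R] f -> rapid f -> intbl f.
Proof.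
by move=> mf /(_ 6%N)[M hM]; apply: (intbl_wt mf) => x; apply: jb6_wt3; exact: hM.
Qed.

Lemma rschwartz_intbl f : rschwartz f -> intbl f.
Proof.
move=> sf; apply: rapid_intbl; last exact: rschwartz_rapid.
by apply: diff3_measurable; exact: rschwartz_diff3.
Qed.

(** The case [a = 1] is translation invariance, [a = -1] is reflection. *)
Lemma integral_affine_fin f (a : R) (b : R3 R) : a != 0 -> intbl f ->
  intbl (fun x => f (a *: x + b)) /\ intR f = `|a| ^+ 3 * intR (fun x => f (a *: x + b)).
Proof.
move=> a0 If.
have a3 : 0 < `|a| ^+ 3 by rewrite exprn_gt0// normr_gt0.
have mf : measurable_fun [set: M3 R] (EFin \o f) by exact: (measurable_int _ If).
have ma := measurable_affine3 a b.
have mfa : measurable_fun [set: M3 R] (fun x : M3 R => (f (affine3 a b x))%:E).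
  exact: (measurableT_comp mf ma).
have Ifa : intbl (fun x => f (a *: x + b)).
  apply/integrableP; split; first exact: mfa.
  move/integrableP : If => [_].
  rewrite [X in (X < _)%E -> _](@ge0_integral_affine3 R a b (fun x => `|(f x)%:E|%E))//; last first.
    exact: (measurableT_comp _ mf).
  move=> lty; rewrite ltey; apply/eqP => eqy.
  by move: lty; rewrite -[affine3 a b]/(fun x => a *: x + b) eqy gt0_muley ?lte_fin// ltxx.
split => //.
have E : (\int[leb3 R]_x (f x)%:E = (`|a| ^+ 3)%:E * \int[leb3 R]_x (f (a *: (x : R3 R) + b))%:E)%E.
  rewrite integralE [in RHS]integralE.
  rewrite (@ge0_integral_affine3 R a b (fun x => (EFin \o f)^\+ x)%E)//; last exact: measurable_funepos.
  rewrite (@ge0_integral_affine3 R a b (fun x => (EFin \o f)^\- x)%E)//; last exact: measurable_funeneg.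
  rewrite [in RHS]muleBr//; last exact: (integrable_add_def measurableT Ifa).
  have -> : (\int[leb3 R]_x (fun x => (f (a *: (x : R3 R) + b))%:E)^\+%E x =
             \int[mu3 R]_x (EFin \o f)^\+%E (affine3 a b x))%E.
    by apply: eq_integral => x _; rewrite !funeposE.
  have -> : (\int[leb3 R]_x (fun x => (f (a *: (x : R3 R) + b))%:E)^\-%E x =
             \int[mu3 R]_x (EFin \o f)^\-%E (affine3 a b x))%E.
    by apply: eq_integral => x _; rewrite !funenegE.
  by [].
rewrite /intR /Rintegral E fineM//.
exact: integrable_fin_num.
Qed.

End real_integrals.

(** * Trigonometric transforms *)

Section trig_transform.
Context {R : realType}.
Implicit Types (x y : R3 R) (i j : 'I_3) (f g h : R3 R -> R).

Lemma is_derive_lipschitz (F dF : R -> R) (a b K : R) : a <= b ->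
  (forall x : R, is_derive x 1 F (dF x)) ->
  (forall x : R, a <= x <= b -> `|dF x| <= K) -> `|F b - F a| <= K * (b - a).
Proof.
move=> ab dF1 dFK.
have cF : {within `[a, b], continuous F}.
  apply: continuous_subspaceT => r; apply: differentiable_continuous.
  by apply/derivable1_diffP; exact: ex_derive.
have [c cab ->] := MVT_segment ab (fun (r : R) _ => dF1 r) cF.
by rewrite normrM [`|b - a|]ger0_norm ?subr_ge0// ler_wpM2r ?subr_ge0// dFK.
Qed.

Lemma sin_lipschitz (a d : R) : `|sin (a + d) - sin a| <= `|d|.
Proof.
have main (u v : R) : u <= v -> `|sin v - sin u| <= v - u.
  move=> uv; rewrite -[leRHS]mul1r.
  by apply: (@is_derive_lipschitz sin cos) => // x _; exact: cos_max.
have [d0|d0] := leP 0 d.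
  by have := main a (a + d); rewrite lerDl d0 addrAC subrr add0r [`|d|]ger0_norm//; apply.
have := main (a + d) a; rewrite gerDl (ltW d0) opprD addrA subrr add0r distrC.
by rewrite [`|d|]ltr0_norm//; apply.
Qed.

(** From the mean value theorem, twice *)
Lemma cos_taylor (a d : R) : `|cos (a + d) - cos a + d * sin a| <= d ^+ 2.
Proof.
pose F (t : R) := cos (a + t * d) + t * d * sin a.
pose dF (t : R) := d * (sin a - sin (a + t * d)).
have dF1 (t : R) : is_derive t 1 F (dF t).
  apply: is_derive_eq.
  by rewrite /GRing.scale/= /dF; ring.
have := @is_derive_lipschitz F dF 0 1 (d ^+ 2) ler01 dF1.
rewrite subr0 mulr1 /F mul1r mul0r mul0r addr0 addr0 addrAC; apply => t /andP[t0 t1].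
rewrite /dF normrM distrC (le_trans (ler_wpM2l (normr_ge0 _) (sin_lipschitz _ _)))//.
rewrite normrM mulrCA -expr2 real_normK ?num_real// ger0_norm//.
by rewrite ler_piMl// sqr_ge0.
Qed.

Lemma dot3_le x y : `|dot3 x y| <= enorm x * enorm y.
Proof.
rewrite -ler_sqr ?nnegrE ?mulr_ge0 ?enorm_ge0// real_normK ?num_real//.
rewrite exprMn !enorm_sqr /dot3.
have := sqr_ge0 (x.1.1 * y.1.2 - x.1.2 * y.1.1).
have := sqr_ge0 (x.1.1 * y.2 - x.2 * y.1.1).
have := sqr_ge0 (x.1.2 * y.2 - x.2 * y.1.2).
lra.
Qed.

Lemma dot3Dl x y z : dot3 (x + y) z = dot3 x z + dot3 y z :> R.
Proof. by rewrite /dot3 /=; ring. Qed.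

Lemma dot3C x y : dot3 x y = dot3 y x.
Proof. by rewrite /dot3; ring. Qed.

Lemma dot3Zl (a : R) x y : dot3 (a *: x) y = a * dot3 x y.
Proof. by rewrite /dot3 /= /GRing.scale/=; ring. Qed.

Definition wave (th : R) x : R3 R -> R := fun xi => cos (dot3 x xi + th).

Lemma wave_le1 th x xi : `|wave th x xi| <= 1.
Proof. exact: cos_max. Qed.

Lemma slow_dot3 (c : R) x : slow (fun xi => dot3 x xi + c).
Proof.
have -> : (fun xi => dot3 x xi + c) =
    (fun xi => (co 0 x * co 0 xi + co 1 x * co 1 xi + co 2%:R x * co 2%:R xi) + c).
  by apply/funext => xi; rewrite dot3_co sum3.
apply: slowD; last exact: slow_cst.
by apply: slowD; [apply: slowD|]; apply: slowZ; exact: slow_co.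
Qed.

Lemma rpd_dot3 i (c : R) x : rpd i (fun xi => dot3 x xi + c) = fun=> co i x.
Proof.
have -> : (fun xi => dot3 x xi + c) =
    (fun xi => (co 0 x * co 0 xi + co 1 x * co 1 xi + co 2%:R x * co 2%:R xi) + c).
  by apply/funext => xi; rewrite dot3_co sum3.
have dd j : diff3 (fun xi => co j x * co j xi) by apply: diff3Z; exact: diff3_co.
rewrite !rpdD ?rpdZ; do ?exact: diff3_co; do ?exact: dd; do ?exact: diff3_cst; last 2 first.
- by apply: diff3D; exact: dd.
- by apply: diff3D; [apply: diff3D|]; exact: dd.
rewrite !rpd_co rpd_cst; apply/funext => xi.
by case: i => [[|[|[|//]]] hi]; rewrite /= ?(mulr0, mulr1, addr0, add0r).
Qed.

Lemma rpd_wave i th x : rpd i (wave th x) = fun xi => co i x * wave (th + pi / 2) x xi.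
Proof.
rewrite /wave (@rpd_comp _ i cos (fun r => - sin r) (fun xi => dot3 x xi + th)
  (fun xi => is_derive_cos _) (slow_diff3 (slow_dot3 th x))).
rewrite rpd_dot3; apply/funext => xi.
by rewrite addrA cosDpihalf mulrC.
Qed.

Lemma slow_wave th x : slow (wave th x).
Proof.
apply: (@gen_slow _ (fun f => slow f \/ exists th, f = wave th x)); last by apply: gen_base; right; exists th.
move=> f [sf|[t ->]]; split.
- exact: slow_diff3.
- by move=> i; apply: gen_base; left; exact: slow_rpd.
- exact: slow_polybd.
- exact: (@diff3_comp _ cos (fun r => - sin r) (fun xi => dot3 x xi + t)
    (fun xi => is_derive_cos _) (slow_diff3 (slow_dot3 t x))).
- move=> i; rewrite rpd_wave; apply: genM; apply: gen_base; last by right; exists (t + pi / 2).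
  by left; exact: slow_cst.
- by exists 0%N, 1 => xi; rewrite expr0 mulr1 wave_le1.
Qed.

Lemma wave_taylor th x y xi :
  `|wave th (y + x) xi - wave th x xi - dot3 y xi * wave (th + pi / 2) x xi| <= (enorm y * enorm xi) ^+ 2.
Proof.
rewrite /wave dot3Dl [dot3 x xi + (th + _)]addrA cosDpihalf mulrN opprK.
rewrite (_ : dot3 y xi + _ + th = dot3 x xi + th + dot3 y xi); last by ring.
apply: (le_trans (cos_taylor _ _)).
rewrite -(real_normK (num_real (dot3 y xi))) lerXn2r ?nnegrE ?mulr_ge0 ?enorm_ge0//.
exact: dot3_le.
Qed.

(** For [th = 0] this is the cosine transform, for [th = - pi / 2] the sine transform.  Keeping the
   phase makes differentiation a single rule instead of an alternation of two. *)
Definition tr (th : R) f : R3 R -> R := fun x => intR (fun xi => wave th x xi * f xi).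

Lemma wave_rschwartz th x f : rschwartz f -> rschwartz (fun xi => wave th x xi * f xi).
Proof.
move=> sf; have := rschwartzM sf (slow_wave th x).
suff -> : (fun xi => f xi * wave th x xi) = (fun xi => wave th x xi * f xi) by [].
by apply/funext => xi; rewrite mulrC.
Qed.

Lemma tr_bound th f M x : rschwartz f -> rSB 6 f M -> `|tr th f x| <= M * wtI.
Proof.
move=> sf hM; apply: intR_wt.
  by apply: diff3_measurable; apply: rschwartz_diff3; exact: wave_rschwartz.
move=> xi; rewrite normrM.
apply: (@le_trans _ _ `|f xi|); first by rewrite ler_piMl// wave_le1.
by apply: jb6_wt3; exact: (hM [::] xi).
Qed.

(** The Taylor formula of the wave is uniform in the frequency up to the factor
   [enorm xi ^+ 2], which a Schwartz function absorbs. *)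
Lemma tr_diff th f x : rschwartz f ->
  differentiable (tr th f) x /\
  forall i, 'D_(basis3 i) (tr th f) x = tr (th + pi / 2) (fun xi => co i xi * f xi) x.
Proof.
move=> sf; have [M hM] := rschwartz_rSB 8 sf.
apply: (@differentiable_quadratic _ _ _ _ (9 * (M * wtI))) => y _.
pose e xi := (wave th (y + x) xi - wave th x xi - dot3 y xi * wave (th + pi / 2) x xi) * f xi.
have sD xi' t := rschwartz_intbl (wave_rschwartz t xi' sf).
have sC i := rschwartz_intbl (wave_rschwartz (th + pi / 2) x (rschwartz_co i sf)).
have sCy i : intbl (fun xi => co i y * (wave (th + pi / 2) x xi * (co i xi * f xi))).
  by apply: intblZ; exact: sC.
have -> : tr th f (y + x) - tr th f x
    - \sum_(i < 3) co i y * tr (th + pi / 2) (fun xi => co i xi * f xi) x = intR e.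
  rewrite sum3 /tr -!intRZ; do ?exact: sC.
  rewrite -intRB; do ?exact: sD.
  rewrite -!intRD; do ?exact: sCy; last by apply: intblD; exact: sCy.
  rewrite -intRB; first last.
  - by apply: intblD; [apply: intblD|]; exact: sCy.
  - exact: (integrableB measurableT (sD _ _) (sD _ _)).
  apply: eq_intR => xi; rewrite /e dot3_co sum3; ring.
have mE : measurable_fun [set: M3 R] e.
  apply: measurable_funM; last by apply: diff3_measurable; exact: rschwartz_diff3.
  apply: measurable_funB; first apply: measurable_funB.
  - by apply: diff3_measurable; exact/slow_diff3/slow_wave.
  - by apply: diff3_measurable; exact/slow_diff3/slow_wave.
  - apply: measurable_funM; last by apply: diff3_measurable; exact/slow_diff3/slow_wave.
    have := slow_dot3 0 y => /slow_diff3/diff3_measurable.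
    by under eq_fun do rewrite addr0.
have w0 := wtI_ge0 (R := R); have M0 := rSB_ge0 hM.
apply: (@le_trans _ _ (enorm y ^+ 2 * M * wtI)); last first.
  have -> : 9 * (M * wtI) * `|y| ^+ 2 = (3 * `|y|) ^+ 2 * M * wtI by ring.
  rewrite ler_wpM2r// ler_wpM2r// lerXn2r ?nnegrE ?enorm_ge0 ?mulr_ge0//.
  exact: enorm_le_norm.
apply: intR_wt => // xi; apply: jb6_wt3; rewrite /e normrM.
apply: (@le_trans _ _ (enorm y ^+ 2 * (jb xi ^+ 8 * `|f xi|))); last first.
  by rewrite ler_wpM2l ?sqr_ge0//; exact: (hM [::] xi).
rewrite mulrA mulrA ler_wpM2r//.
apply: (le_trans (ler_wpM2l (ltW (jbX_gt0 6 xi)) (wave_taylor th x y xi))).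
rewrite exprMn mulrCA ler_wpM2l ?sqr_ge0// -[8%N]/(6 + 2)%N exprD.
rewrite ler_wpM2l ?(ltW (jbX_gt0 _ _))// lerXn2r ?nnegrE ?enorm_ge0 ?(ltW (jb_gt0 _))//.
by rewrite /jb lerDr.
Qed.

End trig_transform.

(** * Transforms of Schwartz functions are Schwartz *)

Section transform_of_derivatives.
Context {R : realType}.
Implicit Types (x y : R3 R) (i j : 'I_3) (f g h : R3 R -> R).

Lemma is_derive_line i f x (s : R) : diff3 f ->
  is_derive s 1 (fun t : R => f (x + t *: basis3 i)) (rpd i f (x + s *: basis3 i)).
Proof.
move=> df.
pose l := fun t : R => x + t *: (basis3 i : R3 R).
have d1 : differentiable (fun t : R => t *: (basis3 i : R3 R)) s.
  by apply: (@differentiableZl R R (R3 R) id _ s).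
have d2 : differentiable (fun=> x : R3 R) s by apply: (@differentiable_cst R R (R3 R) x s).
have dl : differentiable l s by exact: (differentiableD d2 d1).
have dc : differentiable (f \o l) s by apply: differentiable_comp.
apply: DeriveDef; first exact: (diff_derivable dc).
rewrite deriveE// (@diff_comp _ _ _ _ l f)//= /rpd deriveE//; congr ('d f _ _).
have did : differentiable (id : R -> R) s by [].
have dZ := @diffZl R R (R3 R) id (basis3 i) s did.
have dC := @diff_cst R R (R3 R) x s.
have E1 := congr1 (fun g : (R : normedModType R) -> (R3 R : normedModType R) => g 1) (diffD d2 d1).
have E2 := congr1 (fun g : (R : normedModType R) -> (R3 R : normedModType R) => g 1) dZ.
have E3 := congr1 (fun g : (R : normedModType R) -> (R3 R : normedModType R) => g 1) dC.
have E4 : 'd id s 1 = 1 :> R by rewrite diff_val.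
apply: (etrans E1).
pose A : R3 R := 'd (fun=> x : R3 R) s (1 : R).
pose B : R3 R := 'd (fun t : R => t *: (basis3 i : R3 R)) s (1 : R).
have A0 : A = 0 by exact: E3.
have BE : B = basis3 i by apply: (etrans E2); rewrite E4 scale1r.
suff : A + B = basis3 i by [].
by rewrite A0 BE add0r.
Qed.

(** The Taylor formula along a coordinate axis, from a bound of the second derivative *)
Lemma taylor_line i f x (t K : R) : rsmooth f -> 0 <= t ->
  (forall s, 0 <= s <= t -> `|rpd i (rpd i f) (x + s *: basis3 i)| <= K) ->
  `|f (x + t *: basis3 i) - f x - t * rpd i f x| <= t ^+ 2 * K.
Proof.
move=> sf t0 hK.
pose q g s := g (x + s *: (basis3 i : R3 R)) : R.
have q0 g : q g 0 = g x by rewrite /q scale0r addr0.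
have K0 : 0 <= K by rewrite (le_trans _ (hK 0 _))// lexx.
pose F (s : R) := q f s - s * rpd i f x.
pose dF (s : R) := q (rpd i f) s - rpd i f x.
have dF1 (s : R) : is_derive s 1 F (dF s).
  have h1 := is_derive_line i x s (rsmooth_diff3 sf).
  by apply: is_derive_eq; rewrite /dF /q /GRing.scale/=; ring.
have dFK (s : R) : 0 <= s <= t -> `|dF s| <= t * K.
  move=> /andP[s0 st]; rewrite /dF -(q0 (rpd i f)).
  apply: (@le_trans _ _ (K * (s - 0))).
    have dq (r : R) : is_derive r 1 (q (rpd i f)) (q (rpd i (rpd i f)) r).
      exact: (is_derive_line i x r (rsmooth_diff3 (rsmooth_rpd i sf))).
    apply: (is_derive_lipschitz s0 dq) => r /andP[r0 rs].
    by apply: hK; rewrite r0 (le_trans rs).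
  by rewrite subr0 mulrC ler_wpM2r.
have := is_derive_lipschitz t0 dF1 dFK.
rewrite /F q0 mul0r !subr0 [t * K * t]mulrAC -expr2.
by rewrite addrAC.
Qed.

Lemma enorm_basis3 i : enorm (basis3 i : R3 R) = 1.
Proof.
rewrite /enorm dot3_co (bigD1 i)//= co_basis3 eqxx mul1r big1 ?addr0 ?sqrtr1//.
by move=> j ji; rewrite co_basis3 (negbTE ji) mul0r.
Qed.

Lemma intR_shift f (b : R3 R) : intbl f -> intbl (fun x => f (x + b)) /\ intR (fun x => f (x + b)) = intR f.
Proof.
move=> If; have [] := integral_affine_fin b (oner_neq0 R) If.
rewrite normr1 expr1n mul1r.
by have -> : (fun x => f (1 *: x + b)) = (fun x => f (x + b)) by apply/funext => x; rewrite scale1r.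
Qed.

Lemma eq0_of_small (a C : R) : (forall t, 0 < t <= 1 -> `|a| <= t * C) -> a = 0.
Proof.
move=> h; have [//|n0] := eqVneq a 0.
have a0 : 0 < `|a| by rewrite normr_gt0.
have C0 : 0 < C.
  by have := h 1; rewrite ltr01 lexx mul1r => /(_ isT); exact: lt_le_trans.
pose t : R := `|a| / (`|a| + 2 * C).
have d0 : 0 < `|a| + 2 * C by rewrite ltr_pwDl// mulr_ge0// ltW.
have : 0 < t <= 1 by rewrite divr_gt0//= ler_pdivrMr// mul1r lerDl mulr_ge0// ltW.
move=> /h; rewrite /t mulrAC ler_pdivlMr// mulrDr => k.
have := mulr_gt0 a0 a0; have := mulr_gt0 a0 C0; lra.
Qed.

(** By translation invariance the integral of a difference quotient vanishes, and the quotients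
   converge with an error that is integrable uniformly. *)
Lemma intR_rpd i f : rschwartz f -> intR (rpd i f) = 0.
Proof.
move=> sf; have sd := rschwartz_rpd i sf.
have [M hM] := rschwartz_rapid (rschwartz_rpd i sd) 6.
have w0 := wtI_ge0 (R := R).
have M0 : 0 <= M by apply: le_trans (hM 0); rewrite mulr_ge0// ltW// jbX_gt0.
have main (t : R) : 0 < t <= 1 -> `|intR (rpd i f)| <= t * (64 * M * wtI).
  move=> /andP[t0 t1].
  have [Is Es] := intR_shift (t *: basis3 i) (rschwartz_intbl sf).
  have If := rschwartz_intbl sf; have Id := rschwartz_intbl sd.
  have Isf : intbl (fun x => f (x + t *: basis3 i) - f x) by exact: (intblB Is If).
  have Itd := intblZ t Id.
  pose e x := f (x + t *: basis3 i) - f x - t * rpd i f x.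
  have Ie : intR e = - (t * intR (rpd i f)).
    by rewrite /e intRB// intRB// Es subrr sub0r intRZ.
  have : `|intR e| <= t ^+ 2 * (64 * M) * wtI.
    apply: intR_wt.
      by have := intblB Isf Itd => /measurable_int/measurable_EFinP.
    move=> x; rewrite -mulrA; apply: taylor_line; [exact: sf.1|exact: ltW|].
    move=> s /andP[s0 st].
    apply: (@jb6_wt3 _ (fun=> rpd i (rpd i f) (x + s *: basis3 i))).
    have xs : jb x <= 2 * jb (x + s *: basis3 i).
      by apply: jb_shift; rewrite enormZ enorm_basis3 mulr1 ger0_norm// (le_trans st).
    apply: (@le_trans _ _ (64 * (jb (x + s *: basis3 i) ^+ 6 * `|rpd i (rpd i f) (x + s *: basis3 i)|))).
      rewrite mulrA ler_wpM2r//.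
      have -> : 64 = 2 ^+ 6 :> R by rewrite -natrX.
      by rewrite -exprMn lerXn2r ?nnegrE ?mulr_ge0 ?(ltW (jb_gt0 _)).
    by rewrite ler_wpM2l//; exact: hM.
  rewrite Ie normrN normrM ger0_norm ?(ltW t0)// expr2 -!mulrA ler_pM2l//.
exact: (eq0_of_small main).
Qed.

(** Integration by parts: the integral of the derivative of the product with a wave vanishes. *)
Lemma tr_rpd th i f x : rschwartz f ->
  tr th (rpd i f) x = - (co i x * tr (th + pi / 2) f x).
Proof.
move=> sf.
have := intR_rpd i (wave_rschwartz th x sf).
rewrite rpdM; [|exact/slow_diff3/slow_wave|exact: rschwartz_diff3].
have sw t := rschwartz_intbl (wave_rschwartz t x sf).
rewrite intRD; first last.
- rewrite (_ : (fun y => _) = fun y => co i x * (wave (th + pi / 2) x y * f y)).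
    exact: intblZ.
  by apply/funext => y; rewrite rpd_wave mulrA.
- exact: (rschwartz_intbl (wave_rschwartz th x (rschwartz_rpd i sf))).
move=> /eqP; rewrite addr_eq0 => /eqP; rewrite /tr => ->; congr (- _).
rewrite -intRZ//; apply: eq_intR => y; by rewrite rpd_wave mulrA.
Qed.

Lemma rpd_tr th i f : rschwartz f -> rpd i (tr th f) = tr (th + pi / 2) (fun xi => co i xi * f xi).
Proof. by move=> sf; apply/funext => x; rewrite /rpd (tr_diff th x sf).2. Qed.

Lemma tr_diff3 th f : rschwartz f -> diff3 (tr th f).
Proof. by move=> sf x; have [] := tr_diff th x sf. Qed.

Lemma tr_rsmooth th f : rschwartz f -> rsmooth (tr th f).
Proof.
move=> sf; apply: (@rsmooth_coind _ (fun g => exists th f, rschwartz f /\ g = tr th f)).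
- by move=> _ [t [g [sg ->]]]; exact: tr_diff3.
- move=> _ i [t [g [sg ->]]]; rewrite rpd_tr//.
  by exists (t + pi / 2), (fun xi => co i xi * g xi); split => //; exact: rschwartz_co.
- by exists th, f.
Qed.

(** Each derivative shifts the phase and multiplies the function by a coordinate, at the cost of one
   unit of the seminorm. *)
Lemma rpds_tr n m : exists2 C, 1 <= C & forall b, (size b <= n)%N -> forall th f M,
  rschwartz f -> rSB (m + n) f M ->
  exists th' g, [/\ rschwartz g, rSB m g (C * M) & rpds b (tr th f) = tr th' g].
Proof.
elim: n => [|n [C C1 IH]].
  exists 1 => // b; rewrite leqn0 size_eq0 => /eqP -> th f M sf hf.
  by exists th, f; rewrite mul1r addn0 in hf *; split.
exists (C * (m + n).+1%:R).
  by rewrite mulr_ege1// ler1n.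
move=> b; case/lastP: b => [_|b i].
  move=> th f M sf hf; exists th, f; split => //.
  apply: (@rSB_leM _ m f M).
    rewrite ler_peMl ?(rSB_ge0 hf)// mulr_ege1// ler1n//.
  by apply: rSB_le hf; rewrite leq_addr.
rewrite size_rcons ltnS => bn th f M sf hf.
rewrite rpds_rcons rpd_tr// -mulrA; apply: IH => //; first exact: rschwartz_co.
by apply: rSB_co; [exact: sf.1|rewrite -addnS].
Qed.

(** Coordinates are converted into derivatives of [f] one by one with [tr_rpd]. *)
Lemma pow_tr n th f M i x : rschwartz f -> rSB (n + 6) f M -> `|co i x| ^+ n * `|tr th f x| <= M * wtI.
Proof.
elim: n th f => [|n IH] th f sf hf; first by rewrite mul1r; exact: tr_bound.
have := tr_rpd (th - pi / 2) i x sf; rewrite subrK => E.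
rewrite exprSr -mulrA.
have -> : `|co i x| * `|tr th f x| = `|tr (th - pi / 2) (rpd i f) x|.
  by rewrite E normrN normrM.
apply: IH; first exact: rschwartz_rpd.
exact: rSB_rpd.
Qed.

Lemma jbX_le n x : jb x ^+ n <= 4 ^+ n * (1 + \sum_(i < 3) `|co i x| ^+ n).
Proof.
set m := Num.max (Num.max 1 `|co 0 x|) (Num.max `|co 1 x| `|co 2%:R x|).
have m0 : 0 <= m by rewrite !le_max ler01.
have jm : jb x <= 4 * m.
  have := enorm_le_sum x; rewrite sum3 /jb.
  have : 1 <= m by rewrite !le_max lexx.
  have : `|co 0 x| <= m by rewrite !le_max lexx orbT.
  have : `|co 1 x| <= m by rewrite !le_max lexx !orbT.
  have : `|co 2%:R x| <= m by rewrite !le_max lexx !orbT.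
  lra.
apply: (@le_trans _ _ ((4 * m) ^+ n)).
  by rewrite lerXn2r ?nnegrE ?mulr_ge0 ?(ltW (jb_gt0 _)).
rewrite exprMn ler_wpM2l ?exprn_ge0// sum3.
have a0 := exprn_ge0 n (normr_ge0 (co 0 x)).
have a1 := exprn_ge0 n (normr_ge0 (co 1 x)).
have a2 := exprn_ge0 n (normr_ge0 (co 2%:R x)).
have mx (u v : R) : Num.max u v = u \/ Num.max u v = v.
  by rewrite maxEle; case: ifP => _; [right|left].
rewrite /m; have [->|->] := mx (Num.max 1 `|co 0 x|) (Num.max `|co 1 x| `|co 2%:R x|).
  by have [->|->] := mx 1 `|co 0 x|; rewrite ?expr1n; lra.
by have [->|->] := mx `|co 1 x| `|co 2%:R x|; lra.
Qed.

(** Of the index [n + 6 + n], one [n] pays for the derivatives of the transform, the other for its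
   decay, and 6 for the convergence of the integral. *)
Lemma tr_rSB n : exists2 C, 0 <= C & forall th f M, rschwartz f -> rSB (n + 6 + n) f M ->
  rSB n (tr th f) (C * M).
Proof.
have [C C1 hC] := rpds_tr n (n + 6).
exists (4 ^+ n * (4 * (C * wtI))).
  by rewrite mulr_ge0 ?exprn_ge0// mulr_ge0// mulr_ge0 ?wtI_ge0// (le_trans ler01).
move=> th f M sf hf b x bn; have [th' [g [sg hg ->]]] := hC b bn th f M sf hf.
apply: (le_trans (ler_wpM2r (normr_ge0 _) (jbX_le n x))).
have -> : 4 ^+ n * (4 * (C * wtI)) * M = 4 ^+ n * (4 * (C * M * wtI)) by ring.
rewrite -[leLHS]mulrA ler_wpM2l ?exprn_ge0// sum3 !mulrDl mul1r.
have h i : `|co i x| ^+ n * `|tr th' g x| <= C * M * wtI by exact: pow_tr.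
have h0 : `|tr th' g x| <= C * M * wtI.
  by apply: tr_bound => //; apply: rSB_le hg; rewrite leq_addl.
have := h 0; have := h 1; have := h 2%:R; move: h0.
lra.
Qed.

Lemma tr_rschwartz th f : rschwartz f -> rschwartz (tr th f).
Proof.
move=> sf; split; first exact: tr_rsmooth.
move=> b n; pose k := maxn n (size b).
have [C _ hC] := tr_rSB k; have [M hM] := rschwartz_rSB (k + 6 + k) sf.
exists (C * M) => x; apply: le_trans (hC th f M sf hM b x (leq_maxr _ _)).
by rewrite ler_wpM2r// ler_weXn2l ?jb_ge1// leq_maxl.
Qed.

End transform_of_derivatives.

(** * The transform of the Gaussian *)

Section gaussian.
Context {R : realType}.
Implicit Types (x y : R3 R) (i j : 'I_3) (f g h : R3 R -> R).

Lemma co_decomp x :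
  x = 0 + co 0 x *: basis3 0 + co 1 x *: basis3 1 + co 2%:R x *: basis3 2%:R.
Proof.
apply: co_ext => i; rewrite !coD !coZ co0 !co_basis3.
by case: i => [[|[|[|//]]] hi]; rewrite /= ?(mulr0, mulr1, addr0, add0r); congr co; apply/val_inj.
Qed.

(** Move to the origin along the coordinate axes. *)
Lemma gradient0_cst f x : diff3 f -> (forall i y, rpd i f y = 0) -> f x = f 0.
Proof.
move=> df f0.
have step i y (t : R) : f (y + t *: basis3 i) = f y.
  rewrite -[in RHS](addr0 y) -[in RHS](scale0r (basis3 i)).
  apply: (@is_derive_0_is_cst R (fun s => f (y + s *: basis3 i))) => s.
  by apply: is_derive_eq (is_derive_line i y s df) _.
by rewrite (co_decomp x) !step.
Qed.

Lemma wave_pi th x y : wave (th + pi / 2 + pi / 2) x y = - wave th x y.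
Proof.
rewrite /wave (_ : dot3 x y + (th + pi / 2 + pi / 2) = dot3 x y + th + pi); last by lra.
exact: cosDpi.
Qed.

Definition gaussI : R := intR gauss.

(** Both the Gaussian and its transform solve [rpd i h = - co i * h].  Hence the quotient of the
   transform by the Gaussian has no gradient, and its value is found at the origin. *)
Lemma tr_gauss th x : tr th gauss x = cos th * gaussI * gauss x.
Proof.
have sg := @rschwartz_gauss R.
pose E (y : R3 R) := expR (2^-1 * rsq y).
have srs : slow (fun y : R3 R => 2^-1 * rsq y) by apply: slowZ; exact: slow_rsq.
have dE : diff3 E by apply: (@diff3_comp _ expR expR) => //; exact: slow_diff3.
have dT := tr_diff3 th sg.
have pE i y : rpd i E y = co i y * E y.
  rewrite (@rpd_comp _ _ expR expR)//; last exact: slow_diff3.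
  rewrite rpdZ; last by apply: slow_diff3; exact: slow_rsq.
  by rewrite rpd_rsq mulrC; congr (_ * _); field.
have pT i y : rpd i (tr th gauss) y = - (co i y * tr th gauss y).
  rewrite rpd_tr//.
  have -> : (fun xi => co i xi * gauss xi) = (fun xi : R3 R => -1 * rpd i gauss xi).
    by apply/funext => z; rewrite rpd_gauss mulN1r mulNr opprK.
  have sgi := rschwartz_rpd i sg.
  rewrite /tr (_ : intR _ = - tr (th + pi / 2) (rpd i gauss) y); last first.
    rewrite /tr -[RHS]mulN1r -intRZ; last exact/rschwartz_intbl/wave_rschwartz.
    by apply: eq_intR => z; rewrite mulrCA.
  rewrite tr_rpd// opprK -mulrN; congr (_ * _).
  rewrite /tr -[RHS]mulN1r -intRZ; last exact/rschwartz_intbl/wave_rschwartz.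
  by apply: eq_intR => z; rewrite wave_pi mulNr mulN1r.
have cst y : tr th gauss y * E y = tr th gauss 0 * E 0.
  apply: (@gradient0_cst (fun y => tr th gauss y * E y)); first exact: diff3M.
  by move=> i z; rewrite rpdM// pE pT; ring.
have E0 : E 0 = 1 by rewrite /E /rsq /dot3 /= !mulr0 !addr0 mulr0 expR0.
have T0 : tr th gauss 0 = cos th * gaussI.
  rewrite /tr /gaussI -intRZ; last exact: rschwartz_intbl.
  by apply: eq_intR => z; rewrite /wave /dot3 /= !mul0r !add0r.
have := cst x; rewrite E0 mulr1 T0 => <-.
rewrite -mulrA (_ : E x * gauss x = 1) ?mulr1//.
by rewrite /E /gauss [2^-1 * _]mulrC expRxMexpNx_1.
Qed.

Lemma integral_gauss_fun3 :
  (\int[leb3 R]_x (gauss_fun x.1.1 * gauss_fun x.1.2 * gauss_fun x.2)%:E = (Num.sqrt pi ^+ 3)%:E)%E.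
Proof.
apply: integral_tensor3; [exact: gauss_fun_ge0|exact: measurable_gauss_fun|].
exact: integralT_gauss.
Qed.

(** The one-dimensional Gaussian integral and a dilation by the square root of 2 *)
Lemma gaussI_sqr : gaussI ^+ 2 = (2 * pi) ^+ 3.
Proof.
have s20 : Num.sqrt 2 != 0 :> R by rewrite sqrtr_eq0 -ltNge.
have [_ E] := integral_affine_fin 0 s20 (rschwartz_intbl (@rschwartz_gauss R)).
rewrite /gaussI E.
have -> : intR (fun x => gauss (Num.sqrt 2 *: x + 0)) = Num.sqrt pi ^+ 3.
  rewrite /intR /Rintegral -[RHS]/(fine (Num.sqrt pi ^+ 3)%:E) -integral_gauss_fun3.
  congr fine; apply: eq_integral => x _; congr EFin.
  rewrite addr0 /gauss /rsq -enorm_sqr enormZ exprMn real_normK ?num_real//.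
  rewrite sqr_sqrtr// enorm_sqr mulrAC mulfV ?mul1r//.
  by rewrite /gauss_fun /dot3 -!expRD; congr expR; rewrite !expr2; ring.
rewrite ger0_norm ?sqrtr_ge0// exprMn -!exprM mulnC !exprM !sqr_sqrtr ?pi_ge0//.
by rewrite -exprMn.
Qed.

Lemma gaussI_gt0 : 0 < gaussI.
Proof.
have g0 : 0 <= gaussI by apply: Rintegral_ge0 => x _; exact: expR_ge0.
rewrite lt_neqAle g0 andbT eq_sym; apply/eqP => E0.
have := gaussI_sqr; rewrite E0 expr0n/= => /esym/eqP.
by rewrite expf_eq0/= mulf_eq0 pnatr_eq0/= gt_eqF// pi_gt0.
Qed.

End gaussian.

(** * Exchange of integrals *)

Section fubini3.
Context {R : realType}.

(** Fubini's theorem for real functions with a dominating function for the inner integrals *)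
Lemma intR_swap (F : R3 R -> R3 R -> R) (A : R3 R -> R) :
  measurable_fun [set: M3 R * M3 R] (fun z => F z.1 z.2) ->
  (forall x, intbl (F x)) -> (forall y, intbl (F ^~ y)) ->
  intbl A -> (forall x, intR (fun y => `|F x y|) <= A x) ->
  [/\ intbl (fun x => intR (F x)), intbl (fun y => intR (F ^~ y)) &
    intR (fun x => intR (F x)) = intR (fun y => intR (F ^~ y))].
Proof.
move=> mF Fx Fy IA FA.
pose G (z : M3 R * M3 R) := (F z.1 z.2)%:E.
have mG : measurable_fun setT G by exact/measurable_EFinP.
have fx x : (\int[mu3 R]_y G (x, y) = (intR (F x))%:E)%E.
  rewrite /intR /Rintegral fineK//; exact: integrable_fin_num (Fx x).
have fy y : (\int[mu3 R]_x G (x, y) = (intR (F ^~ y))%:E)%E.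
  rewrite /intR /Rintegral fineK//; exact: integrable_fin_num (Fy y).
have IG : (mu3 R \x mu3 R)%E.-integrable setT G.
  apply/integrable12ltyP => //.
  have /integrableP[_] := IA; apply: le_lt_trans.
  apply: ge0_le_integral => //.
  - by move=> x _; apply: integral_ge0.
  - apply: (@measurable_fun_fubini_tonelli_F _ _ _ _ _ (mu3 R) (fun z => `|G z|%E)) => //.
    exact: measurableT_comp.
  - by apply: measurableT_comp => //; exact: measurable_int IA.
  - move=> x _; apply: (@le_trans _ _ (A x)%:E); last by rewrite lee_fin ler_norm.
    apply: le_trans (_ : ((intR (fun y => `|F x y|))%:E <= _)%E); last by rewrite lee_fin FA.
    have IFx : intbl (fun y => `|F x y|) by exact: intbl_norm (Fx x).
    rewrite /intR /Rintegral fineK//; exact: integrable_fin_num IFx.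
have E1 := integral12_prod_meas1 IG; have E2 := integral21_prod_meas1 IG.
have EF : fubini_F (mu3 R) G = EFin \o (fun x => intR (F x)) by apply/funext => x; exact: fx.
have EG : fubini_G (mu3 R) G = EFin \o (fun y => intR (F ^~ y)) by apply/funext => y; exact: fy.
split.
- by have := integrable_fubini_F IG; rewrite EF.
- have lt : (\int[mu3 R]_y \int[mu3 R]_x `|G (x, y)| < +oo)%E.
    by apply/integrable21ltyP.
  apply/integrableP; split.
    by have := measurable_fubini_G IG; rewrite EG.
  apply: le_lt_trans lt; apply: ge0_le_integral => //.
  - by have := measurable_fubini_G IG; rewrite EG => h; exact: measurableT_comp.
  - apply: (@measurable_fun_fubini_tonelli_G _ _ _ _ _ (mu3 R) (fun z => `|G z|%E)) => //.
    exact: measurableT_comp.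
  - move=> y _; apply: (@le_trans _ _ (`| \int[mu3 R]_x G (x, y) |)%E); first by rewrite fy.
    apply: le_abse_integral => //; exact: (measurable_int _ (Fy y)).
- rewrite /intR /Rintegral; congr fine.
  transitivity (\int[mu3 R]_x fubini_F (mu3 R) G x)%E.
    by apply: eq_integral => x _; rewrite EF.
  by rewrite E1 -E2; apply: eq_integral => x _; rewrite EG.
Qed.

End fubini3.

(** * The inversion formula *)

Section inversion.
Context {R : realType}.
Implicit Types (x y : R3 R) (i j : 'I_3) (f g h : R3 R -> R).

Lemma rschwartz_lipschitz f : rschwartz f ->
  exists2 L, 0 <= L & forall x y, `|f (x + y) - f x| <= L * \sum_(i < 3) `|co i y|.
Proof.
move=> sf.
have /choice[B hB] : forall i, exists L, 0 <= L /\ forall x, `|rpd i f x| <= L.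
  move=> i; have [M M0 hM] := rapid_bounded (rschwartz_rapid (rschwartz_rpd i sf)).
  by exists M.
pose L := \sum_i B i.
have B0 i : 0 <= B i by have [] := hB i.
have L0 : 0 <= L by rewrite sumr_ge0.
have BL i : B i <= L by rewrite /L (bigD1 i)//= lerDl sumr_ge0.
have step0 i y (t : R) : 0 <= t -> `|f (y + t *: basis3 i) - f y| <= L * t.
  move=> t0.
  have dq (s : R) := is_derive_line i y s (rschwartz_diff3 sf).
  have dqL (s : R) : 0 <= s <= t -> `|rpd i f (y + s *: basis3 i)| <= L.
    by move=> _; apply: le_trans (BL i); have [] := hB i.
  by have := is_derive_lipschitz t0 dq dqL; rewrite scale0r addr0 subr0.
have step i y (t : R) : `|f (y + t *: basis3 i) - f y| <= L * `|t|.
  have [t0|t0] := leP 0 t; first by rewrite [`|t|]ger0_norm//; exact: step0.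
  have := step0 i (y + t *: basis3 i) (- t).
  by rewrite scaleNr addrK distrC [`|t|]ltr0_norm//; apply; rewrite oppr_ge0 ltW.
exists L => // x y.
rewrite {1}(co_decomp y) add0r !addrA sum3.
set x1 := x + co 0 y *: basis3 0; set x2 := x1 + co 1 y *: basis3 1.
have h0 := step 0 x (co 0 y); have h1 := step 1 x1 (co 1 y); have h2 := step 2%:R x2 (co 2%:R y).
have -> : f (x2 + co 2%:R y *: basis3 2%:R) - f x =
  (f (x2 + co 2%:R y *: basis3 2%:R) - f x2) + (f x2 - f x1) + (f x1 - f x) by ring.
have tri (a b c : R) : `|a + b + c| <= `|a| + `|b| + `|c|.
  by rewrite (le_trans (ler_normD _ _))// lerD2r ler_normD.
by apply: (le_trans (tri _ _ _)); lra.
Qed.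

(** The dilated Gaussian has a dilated Gaussian transform, which concentrates at the origin. *)
Lemma intR_gauss_wave (e : R) th z : 0 < e ->
  intR (fun xi => gauss (e *: xi) * wave th z xi) =
  e ^- 3 * (cos th * gaussI * gauss (e^-1 *: z)).
Proof.
move=> e0; have en : e != 0 by rewrite gt_eqF.
rewrite -(tr_gauss th (e^-1 *: z)) /tr.
have [_ ->] := integral_affine_fin 0 en (rschwartz_intbl (wave_rschwartz th (e^-1 *: z) (@rschwartz_gauss R))).
rewrite ger0_norm ?(ltW e0)// mulrA mulVf ?expf_neq0// mul1r.
apply: eq_intR => xi; rewrite addr0 mulrC; congr (_ * _).
by rewrite /wave dot3Zl (dot3C z (e *: xi)) dot3Zl (dot3C xi z) mulrA mulVf// mul1r.
Qed.

Lemma gaussN x : gauss (- x) = gauss x.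
Proof. by rewrite /gauss /rsq /dot3 /= !mulrNN. Qed.

(** Approximation of the identity, with a rate because [f] is Lipschitz *)
Lemma gauss_approx f w : rschwartz f -> exists C, forall e : R, 0 < e <= 1 ->
  intbl (fun y => f y * gauss (e^-1 *: (y - w))) /\
  `|e ^- 3 * intR (fun y => f y * gauss (e^-1 *: (y - w))) - f w * gaussI| <= e * C.
Proof.
move=> sf; have [L L0 hL] := rschwartz_lipschitz sf.
have sg := @rschwartz_gauss R.
have sabs i : intbl (fun z : R3 R => `|co i z| * gauss z).
  have h : intbl (fun z : R3 R => `|co i z * gauss z|).
    exact: (intbl_norm (rschwartz_intbl (rschwartz_co i sg))).
  apply: eq_intbl h => z.
  by rewrite normrM [`|gauss z|]ger0_norm// expR_ge0.
exists (L * intR (fun z : R3 R => `|co 0 z| * gauss z + `|co 1 z| * gauss z + `|co 2%:R z| * gauss z)).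
move=> e /andP[e0 e1]; have en : e != 0 by rewrite gt_eqF.
have en' : e^-1 != 0 by rewrite invr_eq0.
have s1 : intbl (fun y => f y * gauss (e^-1 *: (y - w))).
  apply: (@intbl_le _ _ (fun y => `|f y|)).
  - apply: measurable_funM; first by apply: diff3_measurable; exact: rschwartz_diff3.
    have mg : measurable_fun [set: M3 R] gauss.
      by apply: diff3_measurable; exact: rschwartz_diff3.
    have := measurableT_comp mg (measurable_affine3 e^-1 (- (e^-1 *: w))).
    by apply: eq_measurable_fun => y _ /=; rewrite /affine3 scalerBr.
  - move=> y; rewrite normrM ler_piMr// ger0_norm ?expR_ge0//.
    by rewrite expR_le1 oppr_le0 divr_ge0// dot3_ge0.
  - exact: (intbl_norm (rschwartz_intbl sf)).
split => //.
have [s2 ->] := integral_affine_fin w en s1.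
rewrite [`|e|]ger0_norm ?(ltW e0)// mulrA mulVf ?expf_neq0// mul1r.
have E z : f (e *: z + w) * gauss (e^-1 *: (e *: z + w - w)) = f (e *: z + w) * gauss z.
  by rewrite addrK scalerA mulVf// scale1r.
have s3 : intbl (fun z => f (e *: z + w) * gauss z).
  exact: eq_intbl E s2.
have s4 : intbl (fun z => f w * gauss z) by apply: intblZ; exact: rschwartz_intbl.
rewrite (eq_intR E) -intRZ; last exact: rschwartz_intbl.
rewrite -intRB//.
have s5 : intbl (fun z => f (e *: z + w) * gauss z - f w * gauss z) by exact: (intblB s3 s4).
apply: (le_trans (normr_intR s5)).
have s6 : intbl (fun z : R3 R => `|co 0 z| * gauss z + `|co 1 z| * gauss z + `|co 2%:R z| * gauss z).
  by apply: intblD => //; apply: intblD.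
rewrite -intRZ// -intRZ; last exact: intblZ.
apply: intR_le; first exact: (integrable_norm s5).
  by do 2 apply: intblZ.
move=> z; rewrite -mulrBl normrM [`|gauss z|]ger0_norm ?expR_ge0//.
rewrite -!mulrDl !mulrA ler_wpM2r ?expR_ge0//.
rewrite [e *: z + w]addrC; apply: (le_trans (hL _ _)).
by rewrite sum3 !coZ !normrM [`|e|]ger0_norm ?(ltW e0)// -!mulrDr mulrCA mulrA.
Qed.

Lemma cosM_half (a b : R) : cos a * cos b = 2^-1 * (cos (a - b) + cos (a + b)).
Proof. by rewrite cosB cosD; field. Qed.

(** Fubini's theorem and the formula for a product of cosines turn multiplication by [m] into a
   convolution with the transforms of [m]. *)
Lemma tr_mul_tr (al be : R) m f x : rschwartz m -> rschwartz f ->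
  tr al (fun xi => m xi * tr be f xi) x =
  2^-1 * intR (fun y => f y * (tr (al - be) m (x - y) + tr (al + be) m (x + y))).
Proof.
move=> sm sf.
have If := rschwartz_intbl sf; have Im := rschwartz_intbl sm.
have Iaf := intbl_norm If; have Iam := intbl_norm Im.
have mwf := diff3_measurable (rschwartz_diff3 sf).
have mwm := diff3_measurable (rschwartz_diff3 sm).
pose F (xi y : R3 R) := m xi * (wave al x xi * (wave be xi y * f y)).
have Fb xi y : `|F xi y| <= `|m xi| * `|f y|.
  rewrite /F normrM ler_wpM2l//.
  rewrite !normrM -[leRHS]mul1r; apply: ler_pM => //; first exact: wave_le1.
  by rewrite ler_piMl// wave_le1.
have mF : measurable_fun [set: M3 R * M3 R] (fun z => F z.1 z.2).
  apply: measurable_funM; first by apply: (measurableT_comp mwm).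
  apply: measurable_funM.
    by apply: (measurableT_comp (diff3_measurable (slow_diff3 (slow_wave al x)))).
  apply: measurable_funM; last by apply: (measurableT_comp mwf).
  apply: (measurableT_comp (continuous_measurable_fun (@continuous_cos R))).
  apply: measurable_funD => //; rewrite /dot3.
  by apply: measurable_funD; [apply: measurable_funD|]; apply: measurable_funM;
    repeat apply: measurableT_comp => //.
have Fx xi : intbl (F xi).
  apply: (@intbl_le _ _ (fun y => `|m xi| * `|f y|)) => //; last exact: intblZ.
  exact: (measurable_fun_pair2 xi mF).
have Fy y : intbl (F ^~ y).
  apply: (@intbl_le _ _ (fun xi => `|f y| * `|m xi|)); last exact: intblZ.
    exact: (measurable_fun_pair1 y mF).
  by move=> xi; rewrite mulrC; exact: Fb.
have IA : intbl (fun xi => intR (fun y => `|f y|) * `|m xi|) by exact: intblZ.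
have FA xi : intR (fun y => `|F xi y|) <= intR (fun y => `|f y|) * `|m xi|.
  rewrite mulrC -intRZ//; apply: intR_le => //; [exact: intbl_norm|exact: intblZ].
have [_ I2 swp] := intR_swap mF Fx Fy IA FA.
have -> : tr al (fun xi => m xi * tr be f xi) x = intR (fun xi => intR (F xi)).
  apply: eq_intR => xi; rewrite /F /tr mulrA -intRZ; last exact/rschwartz_intbl/wave_rschwartz.
  by apply: eq_intR => y; ring.
have FE y : intR (F ^~ y) = 2^-1 * (f y * (tr (al - be) m (x - y) + tr (al + be) m (x + y))).
  have sgw t z := rschwartz_intbl (wave_rschwartz t z sm).
  rewrite /tr -intRD// mulrA -intRZ; last exact: intblD.
  apply: eq_intR => xi; rewrite /F.
  have -> : wave al x xi * (wave be xi y * f y) = f y * (cos (dot3 x xi + al) * cos (dot3 xi y + be)).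
    by rewrite /wave; ring.
  rewrite cosM_half.
  have -> : dot3 x xi + al - (dot3 xi y + be) = dot3 (x - y) xi + (al - be).
    by rewrite dot3Dl (_ : dot3 (- y) xi = - dot3 xi y); [ring|rewrite /dot3 /=; ring].
  have -> : dot3 x xi + al + (dot3 xi y + be) = dot3 (x + y) xi + (al + be).
    by rewrite dot3Dl (dot3C xi y); ring.
  by rewrite -/(wave (al - be) (x - y) xi) -/(wave (al + be) (x + y) xi); ring.
rewrite swp -intRZ; first exact: eq_intR.
apply: eq_intbl (intblZ 2 I2) => y.
by rewrite FE mulrA mulfV ?mul1r.
Qed.

(** Insert the factor [gauss (e *: xi)] in the outer integral.  As e tends to 0 the integral
   converges to the left-hand side; by [tr_mul_tr] it is a convolution with concentrating Gaussians,
   which converges to the right-hand side. *)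
Lemma tr_tr (al be : R) f x : rschwartz f ->
  tr al (tr be f) x = (2 * pi) ^+ 3 / 2 * (cos (al - be) * f x + cos (al + be) * f (- x)).
Proof.
move=> sf; have st := tr_rschwartz be sf; have sg := @rschwartz_gauss R.
have [C1 hC1] := gauss_approx x sf.
have [C2 hC2] := gauss_approx (- x) sf.
have [M hM] := rschwartz_rapid st 8.
have M0 : 0 <= M by apply: le_trans (hM 0); rewrite mulr_ge0// ltW// jbX_gt0.
pose J e := intR (fun xi => gauss (e *: xi) * (wave al x xi * tr be f xi)).
have sw := wave_rschwartz al x st.
have mg : measurable_fun [set: M3 R] gauss by apply: diff3_measurable; exact: rschwartz_diff3.
have sge e : 0 < e -> rschwartz (fun xi : R3 R => gauss (e *: xi)).
  by move=> e0; apply: rschwartz_dil => //; rewrite gt_eqF.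
have g1 e (xi : R3 R) : 0 <= gauss (e *: xi) <= 1.
  by rewrite expR_ge0/= expR_le1 oppr_le0 divr_ge0// dot3_ge0.
have J1 e : 0 < e <= 1 -> `|J e - tr al (tr be f) x| <= e * (M * wtI).
  move=> /andP[e0 e1].
  have sJ : rschwartz (fun xi => gauss (e *: xi) * (wave al x xi * tr be f xi)).
    by apply: rschwartzM; [exact: sge|exact: rschwartz_slow].
  rewrite /J /tr -intRB; [|exact: rschwartz_intbl..].
  rewrite [leRHS]mulrA; apply: intR_wt.
    apply: measurable_funB; apply: diff3_measurable; exact: rschwartz_diff3.
  move=> xi; apply: (@jb6_wt3 _ (fun xi => gauss (e *: xi) * (wave al x xi * tr be f xi) - wave al x xi * tr be f xi)).
  rewrite -[X in _ - X]mul1r -mulrBl normrM.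
  apply: (@le_trans _ _ (jb xi ^+ 6 * ((e * jb xi ^+ 2) * `|tr be f xi|))); last first.
    rewrite (_ : jb xi ^+ 6 * _ = e * (jb xi ^+ 8 * `|tr be f xi|)); last by ring.
    by rewrite ler_wpM2l ?(ltW e0).
  rewrite ler_wpM2l ?(ltW (jbX_gt0 _ _))//; apply: ler_pM => //; last first.
    by rewrite normrM ler_piMl// wave_le1.
  have /andP[ga gb] := g1 e xi.
  rewrite distrC ger0_norm ?subr_ge0//.
  apply: (@le_trans _ _ (rsq (e *: xi) / 2)).
    by rewrite lerBlDl -lerBlDr /gauss; exact: expR_ge1Dx.
  rewrite /rsq -enorm_sqr enormZ ger0_norm ?(ltW e0)//.
  have := enorm_ge0 xi; rewrite /jb; move: (enorm xi) => r r0.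
  have : e ^+ 2 <= e by rewrite expr2 ler_piMl// ltW.
  have : 0 <= r ^+ 2 by exact: sqr_ge0.
  rewrite exprMn; move: (e ^+ 2) => d r2 de.
  have : d * r ^+ 2 <= e * r ^+ 2 by rewrite ler_wpM2r.
  have := mulr_ge0 (ltW e0) r0; have := mulr_ge0 (ltW e0) r2; nra.
have J2 e : 0 < e <= 1 -> J e = e ^- 3 * gaussI / 2 *
    (cos (al - be) * intR (fun y => f y * gauss (e^-1 *: (y - x))) +
     cos (al + be) * intR (fun y => f y * gauss (e^-1 *: (y - - x)))).
  move=> e01; have /andP[e0 e1] := e01.
  have -> : J e = tr al (fun xi => gauss (e *: xi) * tr be f xi) x.
    by apply: eq_intR => xi; rewrite mulrCA.
  rewrite tr_mul_tr//; last exact: sge.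
  have [s1 _] := hC1 e e01; have [s2 _] := hC2 e e01.
  have ge t z : tr t (fun xi => gauss (e *: xi)) z = e ^- 3 * (cos t * gaussI * gauss (e^-1 *: z)).
    rewrite -intR_gauss_wave//; apply: eq_intR => xi; by rewrite mulrC.
  rewrite -[in RHS]intRZ// -[in RHS]intRZ// -[in RHS]intRD; [|exact: intblZ..].
  have ge2 y : f y * (tr (al - be) (fun xi => gauss (e *: xi)) (x - y) +
      tr (al + be) (fun xi => gauss (e *: xi)) (x + y)) = e ^- 3 * gaussI *
     (cos (al - be) * (f y * gauss (e^-1 *: (y - x))) + cos (al + be) * (f y * gauss (e^-1 *: (y - - x)))).
    rewrite !ge -[x - y]opprB scalerN gaussN opprK [x + y]addrC.
    by ring.
  rewrite (eq_intR ge2) intRZ; first by rewrite mulrA mulrC; field; rewrite gt_eqF.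
  by apply: intblD; exact: intblZ.
have e3 : gaussI * gaussI = (2 * pi) ^+ 3 :> R by rewrite -expr2 gaussI_sqr.
set T := tr al (tr be f) x.
apply: subr0_eq.
pose K := M * wtI + gaussI / 2 * (`|cos (al - be)| * C1 + `|cos (al + be)| * C2).
apply: (@eq0_of_small _ _ K) => e e01.
have [_ h1] := hC1 e e01; have [_ h2] := hC2 e e01.
have hJ := J1 e e01; rewrite (J2 e e01) -/T in hJ.
set I1 := intR _ in h1 hJ; set I2 := intR _ in h2 hJ.
have g0 := ltW (gaussI_gt0 (R := R)).
have -> : T - (2 * pi) ^+ 3 / 2 * (cos (al - be) * f x + cos (al + be) * f (- x)) =
  - (e ^- 3 * gaussI / 2 * (cos (al - be) * I1 + cos (al + be) * I2) - T)
  + gaussI / 2 * (cos (al - be) * (e ^- 3 * I1 - f x * gaussI) + cos (al + be) * (e ^- 3 * I2 - f (- x) * gaussI)).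
  by rewrite -e3; field; rewrite gt_eqF//; case/andP: e01.
rewrite /K [leRHS]mulrDr; apply: (le_trans (ler_normD _ _)); rewrite normrN; apply: lerD => //.
rewrite normrM [`|gaussI / 2|]ger0_norm ?divr_ge0// [leRHS]mulrCA ler_wpM2l ?divr_ge0// [leRHS]mulrDr.
apply: (le_trans (ler_normD _ _)); rewrite !normrM.
by apply: lerD; rewrite [leRHS]mulrCA ler_wpM2l.
Qed.

End inversion.

Local Open Scope complex_scope.

(** * Complex Schwartz functions and the Fourier transform *)

Section complex_functions.
Context {R : realType}.
Implicit Types (x y : R3 R) (i j : 'I_3) (f g h psi : R3 R -> R[i]) (T : pre_distribution R).

Definition re f : R3 R -> R := fun x => complex.Re (f x).
Definition im f : R3 R -> R := fun x => complex.Im (f x).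

Lemma re_pds b f : re (pds b f) = rpds b (re f).
Proof. by elim: b => //= i b IH; apply/funext => x; rewrite /rpd -IH. Qed.

Lemma im_pds b f : im (pds b f) = rpds b (im f).
Proof. by elim: b => //= i b IH; apply/funext => x; rewrite /rpd -IH. Qed.

Lemma complex_ext f g : re f =1 re g -> im f =1 im g -> f = g.
Proof.
move=> h1 h2; apply/funext => x; have := h1 x; have := h2 x; rewrite /re /im.
by case: (f x) (g x) => [a b] [c d] /= -> ->.
Qed.

Lemma cmod_ge0 (z : R[i]) : 0 <= cmod z. Proof. exact: sqrtr_ge0. Qed.

Lemma Re_le_cmod (z : R[i]) : `|complex.Re z| <= cmod z.
Proof. by rewrite /cmod -sqrtr_sqr ler_wsqrtr// lerDl sqr_ge0. Qed.

Lemma Im_le_cmod (z : R[i]) : `|complex.Im z| <= cmod z.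
Proof. by rewrite /cmod -sqrtr_sqr ler_wsqrtr// lerDr sqr_ge0. Qed.

Lemma cmod_le (z : R[i]) : cmod z <= `|complex.Re z| + `|complex.Im z|.
Proof.
rewrite /cmod -[leRHS]ger0_norm ?addr_ge0// -sqrtr_sqr ler_wsqrtr// sqrrD !real_normK ?num_real//.
by rewrite lerD2r lerDl mulrn_wge0// mulr_ge0.
Qed.

Lemma cmodE (z : R[i]) : (cmod z)%:C = `|z|.
Proof. by rewrite normc_def. Qed.

Lemma cmod_triangle (z w : R[i]) : cmod (z + w) <= cmod z + cmod w.
Proof. by rewrite -lecR rmorphD/= !cmodE ler_normD. Qed.

Lemma cmodM (z w : R[i]) : cmod (z * w) = cmod z * cmod w.
Proof.
have : (cmod (z * w))%:C = (cmod z * cmod w)%:C by rewrite rmorphM/= !cmodE normrM.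
by case.
Qed.

Lemma schwartzP f : schwartz f <-> rschwartz (re f) /\ rschwartz (im f).
Proof.
split=> [[sf rf]|[[s1 r1] [s2 r2]]].
  split; split.
  - by move=> b x; rewrite -re_pds; exact: (sf b x).1.
  - move=> b n; have [M hM] := rf n b; exists M => x; apply: le_trans (hM x).
    by rewrite ler_wpM2l ?(ltW (jbX_gt0 _ _))// -re_pds Re_le_cmod.
  - by move=> b x; rewrite -im_pds; exact: (sf b x).2.
  - move=> b n; have [M hM] := rf n b; exists M => x; apply: le_trans (hM x).
    by rewrite ler_wpM2l ?(ltW (jbX_gt0 _ _))// -im_pds Im_le_cmod.
split=> [b x|n b].
  split; [have := s1 b x; rewrite -re_pds|have := s2 b x; rewrite -im_pds]; exact.
have [M hM] := r1 b n; have [N hN] := r2 b n; exists (M + N) => x.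
apply: le_trans (lerD (hM x) (hN x)).
by rewrite -mulrDr ler_wpM2l ?(ltW (jbX_gt0 n x))// -re_pds -im_pds cmod_le.
Qed.

(** Bounds for the two parts are equivalent to bounds for the modulus up to a factor, see
   [cSB_cmod]; they are easier to transport. *)
Definition cSB n f M : Prop := rSB n (re f) M /\ rSB n (im f) M.

Lemma cSB_cmod n f M b x : cSB n f M -> (size b <= n)%N ->
  (1 + enorm x) ^+ n * cmod (pds b f x) <= 2 * M.
Proof.
move=> [h1 h2] bn; have := lerD (h1 b x bn) (h2 b x bn).
rewrite -mulrDr mulr2n mulrDl !mul1r; apply: le_trans.
by rewrite ler_wpM2l ?(ltW (jbX_gt0 n x))// -re_pds -im_pds cmod_le.
Qed.

(** The phase that turns the cosine into the sine *)
Definition sph : R := - (pi / 2).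

Lemma fourier_re f : schwartz f -> re (fourier f) = fun x => tr 0 (re f) x + tr sph (im f) x.
Proof.
move=> /schwartzP[s1 s2]; apply/funext => x; rewrite /re /fourier /cint /=.
rewrite /tr -intRD; [|exact/rschwartz_intbl/wave_rschwartz..].
apply: eq_intR => y; rewrite /wave /re /im /cexpi addr0 /sph cosBpihalf (dot3C x y).
by case: (f y) => a b /=; rewrite cosN sinN; ring.
Qed.

Lemma fourier_im f : schwartz f -> im (fourier f) = fun x => tr 0 (im f) x - tr sph (re f) x.
Proof.
move=> /schwartzP[s1 s2]; apply/funext => x; rewrite /im /fourier /cint /=.
rewrite /tr -intRB; [|exact/rschwartz_intbl/wave_rschwartz..].
apply: eq_intR => y; rewrite /wave /re /im /cexpi addr0 /sph cosBpihalf (dot3C x y).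
by case: (f y) => a b /=; rewrite cosN sinN; ring.
Qed.

Definition cpi : R := (2 * pi) ^- 3.

Lemma inv_fourier_re f : schwartz f ->
  re (inv_fourier f) = fun x => cpi * (tr 0 (re f) x - tr sph (im f) x).
Proof.
move=> /schwartzP[s1 s2]; apply/funext => x; rewrite /re /inv_fourier /cint /= mul0r subr0.
congr (_ * _); rewrite /tr -intRB; [|exact/rschwartz_intbl/wave_rschwartz..].
apply: eq_intR => y; rewrite /wave /re /im /cexpi addr0 /sph cosBpihalf.
by case: (f y) => a b /=; ring.
Qed.

Lemma inv_fourier_im f : schwartz f ->
  im (inv_fourier f) = fun x => cpi * (tr 0 (im f) x + tr sph (re f) x).
Proof.
move=> /schwartzP[s1 s2]; apply/funext => x; rewrite /im /inv_fourier /cint /= mul0r addr0.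
congr (_ * _); rewrite /tr -intRD; [|exact/rschwartz_intbl/wave_rschwartz..].
apply: eq_intR => y; rewrite /wave /re /im /cexpi addr0 /sph cosBpihalf.
by case: (f y) => a b /=; ring.
Qed.

Lemma rschwartzB (f g : R3 R -> R) : rschwartz f -> rschwartz g -> rschwartz (fun x => f x - g x).
Proof.
move=> sf sg; have := rschwartzD sf (rschwartzZ (-1) sg).
suff -> : (fun x => f x + -1 * g x) = (fun x => f x - g x) by [].
by apply/funext => x; rewrite mulN1r.
Qed.

Lemma schwartz_fourier f : schwartz f -> schwartz (fourier f).
Proof.
move=> sf; have /schwartzP[s1 s2] := sf; apply/schwartzP.
rewrite fourier_re// fourier_im//.
by split; [apply: rschwartzD|apply: rschwartzB]; exact: tr_rschwartz.
Qed.

Lemma schwartz_inv_fourier f : schwartz f -> schwartz (inv_fourier f).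
Proof.
move=> sf; have /schwartzP[s1 s2] := sf; apply/schwartzP.
rewrite inv_fourier_re// inv_fourier_im//.
by split; apply: rschwartzZ; [apply: rschwartzB|apply: rschwartzD]; exact: tr_rschwartz.
Qed.

Lemma rpdsB b (f g : R3 R -> R) : rsmooth f -> rsmooth g ->
  rpds b (fun x => f x - g x) = fun x => rpds b f x - rpds b g x.
Proof.
move=> sf sg; have sg1 : rsmooth (fun x => -1 * g x).
  by apply: rsmoothM => //; exact: (slow_cst _).1.
rewrite (_ : (fun x => f x - g x) = (fun x => f x + -1 * g x)); last first.
  by apply/funext => x; rewrite mulN1r.
by rewrite rpdsD// rpdsZ//; apply/funext => x; rewrite mulN1r.
Qed.

Lemma rSBD n (f g : R3 R -> R) M N : rsmooth f -> rsmooth g -> rSB n f M -> rSB n g N ->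
  rSB n (fun x => f x + g x) (M + N).
Proof.
move=> sf sg hf hg b x bn; rewrite rpdsD//.
apply: le_trans (lerD (hf b x bn) (hg b x bn)).
by rewrite -mulrDr ler_wpM2l ?ler_normD// ltW// jbX_gt0.
Qed.

Lemma rSBB n (f g : R3 R -> R) M N : rsmooth f -> rsmooth g -> rSB n f M -> rSB n g N ->
  rSB n (fun x => f x - g x) (M + N).
Proof.
move=> sf sg hf hg b x bn; rewrite rpdsB//.
apply: le_trans (lerD (hf b x bn) (hg b x bn)).
by rewrite -mulrDr ler_wpM2l ?ler_normB// ltW// jbX_gt0.
Qed.

Lemma fourier_cSB n : exists2 C, 0 <= C & forall f M, schwartz f -> cSB (n + 6 + n) f M ->
  cSB n (fourier f) (C * M).
Proof.
have [C C0 hC] := tr_rSB (R := R) n; exists (2 * C) => [|f M sf [h1 h2]]; first by rewrite mulr_ge0.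
have /schwartzP[s1 s2] := sf.
rewrite /cSB fourier_re// fourier_im// -mulrA [2 * _]mulr_natl mulr2n.
split; [apply: rSBD|apply: rSBB]; try exact: tr_rsmooth; exact: hC.
Qed.

Lemma trD t (f a : R3 R -> R) x : rschwartz f -> rschwartz a ->
  tr t (fun x => f x + a x) x = tr t f x + tr t a x.
Proof.
move=> sa sb; rewrite /tr -intRD; [|exact/rschwartz_intbl/wave_rschwartz..].
by apply: eq_intR => y; rewrite mulrDr.
Qed.

(** The four compositions of sine and cosine transforms, by [tr_tr]: the terms in [f (- x)] cancel. *)
Lemma fourierK f : schwartz f -> inv_fourier (fourier f) = f.
Proof.
move=> sf; have /schwartzP[s1 s2] := sf.
have sF := schwartz_fourier sf.
have trB t (a b : R3 R -> R) x : rschwartz a -> rschwartz b ->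
    tr t (fun x => a x - b x) x = tr t a x - tr t b x.
  move=> sa sb; rewrite /tr -intRB; [|exact/rschwartz_intbl/wave_rschwartz..].
  by apply: eq_intR => y; rewrite mulrBr.
have cpiK : cpi * ((2 * pi) ^+ 3 / 2) = 1 / 2.
  rewrite /cpi mulrA mulVf// expf_neq0// mulf_neq0 ?pnatr_eq0//.
  by rewrite gt_eqF// pi_gt0.
have c1 : cos (0 - 0 : R) = 1 by rewrite subr0 cos0.
have c2 : cos (0 + 0 : R) = 1 by rewrite addr0 cos0.
have c3 : cos (sph - sph) = 1 by rewrite subrr cos0.
have c4 : cos (sph + sph) = -1.
  by rewrite /sph -opprD -splitr cosN cospi.
have c5 : cos (0 - sph) = 0 by rewrite /sph sub0r opprK cos_pihalf.
have c6 : cos (0 + sph) = 0 by rewrite /sph add0r cosN cos_pihalf.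
have c7 : cos (sph - 0) = 0 by rewrite subr0 /sph cosN cos_pihalf.
have c8 : cos (sph + 0) = 0 by rewrite addr0 /sph cosN cos_pihalf.
apply: complex_ext => x.
  rewrite inv_fourier_re// fourier_re// fourier_im// trD ?trB; do ?exact: tr_rschwartz.
  rewrite !tr_tr// c1 c2 c3 c4 c5 c6 c7 c8.
  rewrite [X in cpi * X](_ : _ = (2 * pi) ^+ 3 / 2 * (2 * re f x)); last by ring.
  by rewrite mulrA cpiK; field.
rewrite inv_fourier_im// fourier_re// fourier_im// trB ?trD; do ?exact: tr_rschwartz.
rewrite !tr_tr// c1 c2 c3 c4 c5 c6 c7 c8.
rewrite [X in cpi * X](_ : _ = (2 * pi) ^+ 3 / 2 * (2 * im f x)); last by ring.
by rewrite mulrA cpiK; field.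
Qed.

Definition rmul (m : R3 R -> R) f : R3 R -> R[i] := fun xi => (m xi)%:C * f xi.

Lemma re_rmul m f : re (rmul m f) = fun x => m x * re f x.
Proof. by apply/funext => x; rewrite /re /rmul /=; case: (f x) => a b /=; rewrite mul0r subr0. Qed.

Lemma im_rmul m f : im (rmul m f) = fun x => m x * im f x.
Proof. by apply/funext => x; rewrite /im /rmul /=; case: (f x) => a b /=; rewrite mul0r addr0. Qed.

Lemma schwartz_rmul m f : rschwartz m -> schwartz f -> schwartz (rmul m f).
Proof.
move=> sm /schwartzP[s1 s2]; apply/schwartzP; rewrite re_rmul im_rmul.
by split; apply: rschwartzM => //; exact: rschwartz_slow.
Qed.

Lemma schwartz_rmul_slow m f : slow m -> schwartz f -> schwartz (rmul m f).
Proof.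
move=> sm /schwartzP[s1 s2]; apply/schwartzP; rewrite re_rmul im_rmul.
split; [have := rschwartzM s1 sm|have := rschwartzM s2 sm].
  by rewrite (_ : (fun x => re f x * m x) = fun x => m x * re f x)//; apply/funext => x; rewrite mulrC.
by rewrite (_ : (fun x => im f x * m x) = fun x => m x * im f x)//; apply/funext => x; rewrite mulrC.
Qed.

Lemma fmultE m T psi : fmult m T psi = T (fourier (rmul m (inv_fourier psi))).
Proof. by []. Qed.

(** Symbols multiply: by inversion, the outer transform of the second factor is undone. *)
Lemma fmult_fmult m1 m2 T psi : rschwartz m1 -> schwartz psi ->
  fmult m2 T (fourier (rmul m1 (inv_fourier psi))) = fmult (fun xi => m2 xi * m1 xi) T psi.
Proof.
move=> s1 sp; rewrite !fmultE fourierK; last by apply: schwartz_rmul => //; exact: schwartz_inv_fourier.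
congr (T (fourier _)); apply/funext => x; rewrite /rmul mulrA; congr (_ * _).
by rewrite -rmorphM.
Qed.

Lemma pd_re i f : re (pd i f) = rpd i (re f). Proof. exact: (re_pds [:: i]). Qed.
Lemma pd_im i f : im (pd i f) = rpd i (im f). Proof. exact: (im_pds [:: i]). Qed.

Lemma trZ t (c : R) (a : R3 R -> R) x : rschwartz a -> tr t (fun x => c * a x) x = c * tr t a x.
Proof.
move=> sa; rewrite /tr -intRZ; last exact/rschwartz_intbl/wave_rschwartz.
by apply: eq_intR => y; rewrite mulrCA.
Qed.

Lemma tr_pi t (a : R3 R -> R) x : rschwartz a -> tr (t + pi) a x = - tr t a x.
Proof.
move=> sa; rewrite /tr -[RHS]mulN1r -intRZ; last exact/rschwartz_intbl/wave_rschwartz.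
by apply: eq_intR => y; rewrite /wave addrA cosDpi; ring.
Qed.

Lemma pd_fourier i f : schwartz f ->
  pd i (fourier f) = fourier (fun xi => - 'i * (co i xi)%:C * f xi).
Proof.
move=> sf; have /schwartzP[s1 s2] := sf.
set g := fun xi => - 'i * _ * _.
have gre : re g = fun x => co i x * im f x.
  by apply/funext => x; rewrite /re /im /g /=; case: (f x) => a b /=; ring.
have gim : im g = fun x => -1 * (co i x * re f x).
  by apply/funext => x; rewrite /re /im /g /=; case: (f x) => a b /=; ring.
have sg : schwartz g.
  by apply/schwartzP; rewrite gre gim; split; [|apply: rschwartzZ]; exact: rschwartz_co.
have sr := rschwartz_co i s1; have si := rschwartz_co i s2.
have e1 : 0 + pi / 2 = sph + pi :> R by rewrite /sph; lra.
have e2 : sph + pi / 2 = 0 :> R by rewrite /sph; lra.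
have dt t a : rschwartz a -> diff3 (tr t a) by exact: tr_diff3.
apply: complex_ext => x.
  rewrite pd_re !fourier_re// rpdD; [|exact: dt..].
  rewrite !rpd_tr// e1 e2 gre gim tr_pi// trZ//; ring.
rewrite pd_im !fourier_im//.
have -> : (fun x => tr 0 (im f) x - tr sph (re f) x) = (fun x => tr 0 (im f) x + -1 * tr sph (re f) x).
  by apply/funext => y; rewrite mulN1r.
rewrite rpdD; [|exact: dt|by apply: diff3Z; exact: dt].
rewrite rpdZ; last exact: dt.
rewrite !rpd_tr// e1 e2 gre gim tr_pi// trZ//; ring.
Qed.

End complex_functions.

(** * Convolution and Young's inequality *)

Section convolution.
Context {R : realType}.
Implicit Types (x y : R3 R) (f g h k q : R3 R -> R) (p : R).

Definition conv g k : R3 R -> R := fun y => intR (fun x => g x * k (y - x)).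

(** The bound makes convolution with a function in L^p converge at every point, and not only
   almost everywhere. *)
Definition kern k : Prop :=
  [/\ measurable_fun [set: M3 R] k, (exists K, forall x, `|k x| <= K) & intbl k].

Definition inLp p g : Prop := measurable_fun [set: M3 R] g /\ intbl (fun x => `|g x| `^ p).

Lemma rschwartz_kern k : rschwartz k -> kern k.
Proof.
move=> sk; split; [exact: (diff3_measurable (rschwartz_diff3 sk))| |exact: rschwartz_intbl].
by have [K _ hK] := rapid_bounded (rschwartz_rapid sk); exists K.
Qed.

Lemma measurable_conv_kernel k : measurable_fun [set: M3 R] k ->
  measurable_fun [set: M3 R * M3 R] (fun z => k ((z.2 : R3 R) - z.1)).
Proof.
move=> mk.
have m1 : measurable_fun [set: M3 R * M3 R] (fun z => z.1 : M3 R) by exact: measurable_fst.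
have m2 : measurable_fun [set: M3 R * M3 R] (fun z => z.2 : M3 R) by exact: measurable_snd.
have m11 : measurable_fun [set: M3 R] (fun z => z.1.1 : measurableTypeR R).
  by apply: (measurableT_comp measurable_fst measurable_fst).
have m12 : measurable_fun [set: M3 R] (fun z => z.1.2 : measurableTypeR R).
  by apply: (measurableT_comp measurable_snd measurable_fst).
have m13 : measurable_fun [set: M3 R] (fun z => z.2 : measurableTypeR R) by exact: measurable_snd.
have m22 : measurable_fun [set: M3 R * M3 R] (fun z =>
    (z.2.1.1 - z.1.1.1, z.2.1.2 - z.1.1.2) : measurableTypeR R * measurableTypeR R).
  apply: measurable_fun_pair; apply: measurable_funB.
  - exact: (measurableT_comp m11 m2).
  - exact: (measurableT_comp m11 m1).
  - exact: (measurableT_comp m12 m2).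
  - exact: (measurableT_comp m12 m1).
have m23 : measurable_fun [set: M3 R * M3 R] (fun z => z.2.2 - z.1.2 : measurableTypeR R).
  apply: measurable_funB; [exact: (measurableT_comp m13 m2)|exact: (measurableT_comp m13 m1)].
have ms := measurable_fun_pair m22 m23.
exact: (measurableT_comp mk ms).
Qed.

Lemma measurable_conv_kernel' k : measurable_fun [set: M3 R] k ->
  measurable_fun [set: M3 R * M3 R] (fun z => k ((z.1 : R3 R) - z.2)).
Proof.
move=> mk; have ms : measurable_fun [set: M3 R * M3 R] (fun z => (z.2, z.1)).
  by apply: measurable_fun_pair; [exact: measurable_snd|exact: measurable_fst].
exact: (measurableT_comp (measurable_conv_kernel mk) ms).
Qed.

Lemma intR_reflect k y : intbl k ->
  intbl (fun x => k (y - x)) /\ intR (fun x => k (y - x)) = intR k.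
Proof.
move=> Ik; have n1 : -1 != 0 :> R by rewrite oppr_eq0 oner_eq0.
have [] := integral_affine_fin y n1 Ik.
rewrite normrN1 expr1n mul1r.
have -> : (fun x => k (-1 *: x + y)) = (fun x => k (y - x)).
  by apply/funext => x; rewrite scaleN1r addrC.
by move=> ? ->.
Qed.

Lemma intR_translate k x : intbl k ->
  intbl (fun y => k (y - x)) /\ intR (fun y => k (y - x)) = intR k.
Proof. by move=> Ik; have := intR_shift (- x) Ik. Qed.

Lemma le_powR1 p (a : R) : 1 <= p -> 0 <= a -> a <= 1 + a `^ p.
Proof.
move=> p1 a0; have [a1|a1] := leP a 1; first by rewrite (le_trans a1)// lerDl powR_ge0.
by rewrite (le_trans (le1r_powR (ltW a1) p1))// lerDr.
Qed.

(** From [a <= 1 + a `^ p]: the kernel is bounded and integrable, so it pairs with either term. *)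
Lemma conv_section p g k y : 1 <= p -> inLp p g -> kern k ->
  intbl (fun x => g x * k (y - x)) /\
  forall K, (forall x, `|k x| <= K) ->
    intR (fun x => `|g x * k (y - x)|) <= intR (fun x => `|k x|) + K * intR (fun x => `|g x| `^ p).
Proof.
move=> p1 [mg Ig] [mk [K0 hK0] Ik].
have [Iky _] := intR_reflect y Ik.
have [Iaky Eaky] := intR_reflect y (intbl_norm Ik).
have bnd K x : (forall x, `|k x| <= K) -> `|g x * k (y - x)| <= `|k (y - x)| + K * `|g x| `^ p.
  move=> hK; rewrite normrM.
  apply: (@le_trans _ _ ((1 + `|g x| `^ p) * `|k (y - x)|)).
    by rewrite ler_wpM2r// le_powR1.
  by rewrite mulrDl mul1r lerD2l mulrC ler_wpM2r// powR_ge0.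
have IM K : intbl (fun x => `|k (y - x)| + K * `|g x| `^ p).
  by apply: intblD => //; exact: intblZ.
have I1 : intbl (fun x => g x * k (y - x)).
  apply: (@intbl_le _ _ (fun x => `|k (y - x)| + K0 * `|g x| `^ p)) => //.
    apply: measurable_funM => //.
    exact: (measurable_fun_pair1 y (measurable_conv_kernel mk)).
  by move=> x; exact: bnd.
split => // K hK; rewrite -Eaky -intRZ// -intRD//; last exact: intblZ.
by apply: intR_le => //; [exact: intbl_norm|move=> x; exact: bnd].
Qed.

(** Fubini's theorem: the adjoint of a convolution is the convolution with the reflected kernel. *)
Lemma conv_pair p g k q : 1 <= p -> inLp p g -> kern k -> rschwartz q ->
  [/\ intbl (fun y => q y * conv g k y),
      intbl (fun x => g x * intR (fun y => k (y - x) * q y)) &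
      intR (fun x => g x * intR (fun y => k (y - x) * q y)) = intR (fun y => q y * conv g k y)].
Proof.
move=> p1 Lg Kk sq; have [mg Ig] := Lg; have [mk [K hK] Ik] := Kk.
have K0 : 0 <= K by apply: le_trans (hK 0).
pose F (y x : R3 R) := q y * (g x * k (y - x)).
have mq := diff3_measurable (rschwartz_diff3 sq); have Iq := rschwartz_intbl sq.
have mF : measurable_fun [set: M3 R * M3 R] (fun z => F z.1 z.2).
  apply: measurable_funM; first by apply: (measurableT_comp mq).
  apply: measurable_funM; first by apply: (measurableT_comp mg).
  exact: measurable_conv_kernel'.
have Fy y : intbl (F y) by apply: intblZ; have [] := conv_section y p1 Lg Kk.
have Ikq x : intbl (fun y => k (y - x) * q y).
  apply: (@intbl_le _ _ (fun y => K * `|q y|)).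
  - apply: measurable_funM => //.
    exact: (measurable_fun_pair2 x (measurable_conv_kernel mk)).
  - by move=> y; rewrite normrM ler_wpM2r.
  - by apply: intblZ; exact: intbl_norm.
have FE x : F ^~ x =1 (fun y => g x * (k (y - x) * q y)) by move=> y; rewrite /F; ring.
have Fx x : intbl (F ^~ x).
  by apply: (eq_intbl (fun y => esym (FE x y))); exact: intblZ.
pose C := intR (fun x => `|k x|) + K * intR (fun x => `|g x| `^ p).
have IA : intbl (fun y => C * `|q y|) by apply: intblZ; exact: intbl_norm.
have FA y : intR (fun x => `|F y x|) <= C * `|q y|.
  have [Is hs] := conv_section y p1 Lg Kk.
  rewrite (@eq_intR _ _ (fun x => `|q y| * `|g x * k (y - x)|)); last by move=> x; rewrite normrM.
  by rewrite intRZ; [rewrite mulrC ler_wpM2r// hs|exact: intbl_norm].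
have [I1 I2 E] := intR_swap mF Fy Fx IA FA.
have E1 y : intR (F y) = q y * conv g k y.
  by rewrite /conv -intRZ//; have [] := conv_section y p1 Lg Kk.
have E2 x : intR (F ^~ x) = g x * intR (fun y => k (y - x) * q y).
  by rewrite (eq_intR (FE x)) intRZ.
split; [exact: eq_intbl E1 I1|exact: eq_intbl E2 I2|].
by rewrite -(eq_intR E2) -E; exact: eq_intR.
Qed.

(** By Fubini's theorem the convolution times a Gaussian is integrable, hence measurable. *)
Lemma measurable_conv p g k : 1 <= p -> inLp p g -> kern k -> measurable_fun [set: M3 R] (conv g k).
Proof.
move=> p1 Lg Kk; have [I1 _ _] := conv_pair p1 Lg Kk (@rschwartz_gauss R).
have -> : conv g k = fun y => (gauss y * conv g k y) * (gauss y)^-1.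
  by apply/funext => y; rewrite mulrC mulKf// gt_eqF// expR_gt0.
apply: measurable_funM; first by have := measurable_int _ I1; move/measurable_EFinP.
have sg : slow (fun x : R3 R => 2^-1 * rsq x) by apply: slowZ; exact: slow_rsq.
have -> : (fun y : R3 R => (gauss y)^-1) = (fun y => expR (2^-1 * rsq y)).
  by apply/funext => y; rewrite /gauss expRN invrK mulrC.
apply: diff3_measurable; apply: (@diff3_comp _ expR expR) => //; exact: slow_diff3.
Qed.

(** The graph of a convex power lies above its tangent at the point [l]. *)
Lemma powR_tangent p (a l : R) : 1 <= p -> 0 <= a -> 0 < l ->
  a <= p^-1 * (l / l `^ p) * a `^ p + (1 - p^-1) * l.
Proof.
move=> p1 a0 l0.
have p0 : 0 < p by exact: lt_le_trans p1.
have base (b : R) : 0 <= b -> b <= p^-1 * b `^ p + (1 - p^-1).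
  move=> b0; have [p_eq1|pn1] := eqVneq p 1.
    by rewrite p_eq1 invr1 subrr addr0 mul1r powRr1.
  have p_gt1 : 1 < p by rewrite lt_neqAle eq_sym pn1.
  have q0 : 0 < 1 - p^-1 by rewrite subr_gt0 invf_lt1.
  have q0' : 0 < (1 - p^-1)^-1 by rewrite invr_gt0.
  have := @conjugate_powR R b 1 p (1 - p^-1)^-1 b0 ler01 p0 q0'.
  rewrite mulr1 powR1 invrK mul1r mulrC; apply.
  by rewrite addrCA subrr addr0.
have -> : a = l * (a / l) by rewrite mulrCA mulfV ?mulr1// gt_eqF.
have al0 : 0 <= a / l by rewrite divr_ge0// ltW.
rewrite {2}(_ : l * (a / l) = a); last by rewrite mulrCA mulfV ?mulr1// gt_eqF.
have E : a `^ p = l `^ p * (a / l) `^ p.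
  by rewrite -powRM ?(ltW l0)// mulrCA mulfV ?mulr1// gt_eqF.
rewrite E (_ : p^-1 * (l / l `^ p) * (l `^ p * (a / l) `^ p) = l * (p^-1 * (a / l) `^ p)); last first.
  by field; rewrite !gt_eqF// powR_gt0.
by rewrite [(1 - _) * l]mulrC -mulrDr ler_wpM2l ?(ltW l0)//; exact: base.
Qed.

(** Choose [l `^ p = J / S].  If [J = 0], let [l] tend to 0. *)
Lemma powR_le_of_tangents p (I J S : R) : 1 <= p -> 0 < S -> 0 <= I -> 0 <= J ->
  (forall l, 0 < l -> I <= p^-1 * (l / l `^ p) * J + (1 - p^-1) * l * S) ->
  I `^ p <= S `^ p / S * J.
Proof.
move=> p1 S0 I0 J0 tangent; have p0 : 0 < p by exact: lt_le_trans p1.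
move: (J0); rewrite le_eqVlt => /predU1P[J_eq0|J_gt0].
  rewrite -J_eq0 mulr0 (_ : I = 0); first by rewrite powR0// gt_eqF.
  apply: (@eq0_of_small _ _ S) => t /andP[t0 _]; rewrite ger0_norm//.
  apply: (le_trans (tangent t t0)); rewrite -J_eq0 mulr0 add0r ler_wpM2r ?(ltW S0)//.
  by rewrite ler_piMl ?(ltW t0)// gerBl invr_ge0 ltW.
pose l := (J / S) `^ p^-1.
have JS : 0 < J / S by exact: divr_gt0.
have l0 : 0 < l by exact: powR_gt0.
have lp : l `^ p = J / S by rewrite -powRrM mulVf ?gt_eqF// powRr1// ltW.
have IlS : I <= l * S.
  apply: (le_trans (tangent l l0)); rewrite lp.
  rewrite (_ : p^-1 * (l / (J / S)) * J = p^-1 * (l * S)); first by lra.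
  by field; rewrite !gt_eqF.
apply: (@le_trans _ _ ((l * S) `^ p)).
  by apply: ge0_ler_powR; rewrite ?nnegrE// ?(ltW p0)// mulr_ge0// ltW.
rewrite (powRM p (ltW l0) (ltW S0)) lp le_eqVlt; apply/orP; left; apply/eqP; ring.
Qed.

Lemma intR_conv g k : measurable_fun [set: M3 R] g -> intbl g -> (forall x, 0 <= g x) ->
  kern k -> (forall x, 0 <= k x) ->
  [/\ forall y, intbl (fun x => g x * k (y - x)), intbl (conv g k) &
      intR (conv g k) = intR k * intR g].
Proof.
move=> mg Ig g0 [mk [K hK] Ik] k0.
pose F (x y : R3 R) := g x * k (y - x).
have mF : measurable_fun [set: M3 R * M3 R] (fun z => F z.1 z.2).
  apply: measurable_funM; first exact: (measurableT_comp mg measurable_fst).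
  exact: measurable_conv_kernel.
have Fx x : intbl (F x) by apply: intblZ; exact: (intR_translate x Ik).1.
have Ex x : intR (F x) = intR k * g x.
  have [It Et] := intR_translate x Ik.
  by rewrite (intRZ (g x) It) Et mulrC.
have Fy y : intbl (F ^~ y).
  apply: (@intbl_le _ _ (fun x => K * g x)); last exact: intblZ.
    exact: (measurable_fun_pair1 y mF).
  by move=> x; rewrite /F normrM (ger0_norm (g0 x)) mulrC ler_wpM2r.
have IA : intbl (fun x => intR k * g x) by exact: intblZ.
have FA x : intR (fun y => `|F x y|) <= intR k * g x.
  rewrite -Ex le_eqVlt; apply/orP; left; apply/eqP; apply: eq_intR => y.
  by rewrite ger0_norm// mulr_ge0.
have [_ IJ EJ] := intR_swap mF Fx Fy IA FA.
split; [exact: Fy|exact: IJ|].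
rewrite -(intRZ _ Ig) -(eq_intR Ex); exact: esym EJ.
Qed.

(** Integrating the tangent line bound of [powR_tangent] against the kernel replaces Hoelder's
   inequality: the point of tangency is left free, to be chosen separately at each [y]. *)
Lemma conv_tangent p g k (S l : R) y : 1 <= p -> inLp p g -> kern k -> (forall x, 0 <= k x) ->
  intR k <= S -> 0 < l ->
  conv (fun x => `|g x|) k y <=
    p^-1 * (l / l `^ p) * conv (fun x => `|g x| `^ p) k y + (1 - p^-1) * l * S.
Proof.
move=> p1 Lg Kk k0 kS l0; have [mg Ig] := Lg; have Ik : intbl k by case: Kk.
have mgp : measurable_fun [set: M3 R] (fun x => `|g x| `^ p).
  by have := measurable_int _ Ig; move/measurable_EFinP.
have La : inLp p (fun x => `|g x|).
  split; first exact: measurableT_comp.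
  by apply: eq_intbl Ig => x; rewrite normr_id.
have [Ir Er] := intR_reflect y Ik.
have [Is _] := conv_section y p1 La Kk.
have [/(_ y) If _ _] := intR_conv mgp Ig (fun x => powR_ge0 _ _) Kk k0.
apply: (@le_trans _ _ (p^-1 * (l / l `^ p) * conv (fun x => `|g x| `^ p) k y +
    (1 - p^-1) * l * intR (fun x => k (y - x)))).
  rewrite {2}/conv -(intRZ _ If) -(intRZ _ Ir) -(intRD (intblZ _ If) (intblZ _ Ir)).
  apply: intR_le; [exact: Is|by apply: intblD; exact: intblZ|].
  by move=> x; rewrite mulrA -mulrDl ler_wpM2r// powR_tangent.
rewrite lerD2l Er ler_wpM2l// mulr_ge0 ?(ltW l0)//.
by rewrite subr_ge0 invf_le1// (lt_le_trans ltr01).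
Qed.

(** With the optimal points of tangency, the p-th power of the convolution is bounded by a multiple
   of the convolution of the p-th power, whose integral is known. *)
Lemma young p g k (S : R) : 1 <= p -> inLp p g -> kern k -> (forall x, 0 <= k x) ->
  0 < S -> intR k <= S ->
  intbl (fun y => (conv (fun x => `|g x|) k y) `^ p) /\
  intR (fun y => (conv (fun x => `|g x|) k y) `^ p) <= S `^ p * intR (fun x => `|g x| `^ p).
Proof.
move=> p1 Lg Kk k0 S0 kS; have [mg Ig] := Lg.
have mgp : measurable_fun [set: M3 R] (fun x => `|g x| `^ p).
  by have := measurable_int _ Ig; move/measurable_EFinP.
have La : inLp p (fun x => `|g x|).
  split; first exact: measurableT_comp.
  by apply: eq_intbl Ig => x; rewrite normr_id.
have [_ IJ EJ] := intR_conv mgp Ig (fun x => powR_ge0 _ _) Kk k0.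
have gp0 : 0 <= intR (fun x => `|g x| `^ p).
  by apply: Rintegral_ge0 => x _; exact: powR_ge0.
have I0 y : 0 <= conv (fun x => `|g x|) k y by apply: Rintegral_ge0 => x _; rewrite mulr_ge0.
have J0 y : 0 <= conv (fun x => `|g x| `^ p) k y.
  by apply: Rintegral_ge0 => x _; rewrite mulr_ge0// powR_ge0.
have mI := measurable_conv p1 La Kk.
have IJp y := powR_le_of_tangents p1 S0 (I0 y) (J0 y)
  (fun l l0 => conv_tangent y p1 Lg Kk k0 kS l0).
move: (conv (fun x => `|g x|) k) (conv (fun x => `|g x| `^ p) k) IJ EJ I0 J0 mI IJp.
move=> I J IJ EJ I0 J0 mI IJp.
have mIp : measurable_fun [set: M3 R] (fun y => I y `^ p).
  exact: (measurableT_comp (measurable_powR p) mI).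
have IB : intbl (fun y => S `^ p / S * J y) by exact: intblZ.
have IIp : intbl (fun y => I y `^ p).
  by apply: (intbl_le mIp _ IB) => y; rewrite ger0_norm// powR_ge0.
split => //; apply: (le_trans (intR_le IIp IB IJp)).
rewrite (intRZ _ IJ) EJ -mulrA ler_wpM2l ?powR_ge0// mulrA ler_piMl//.
by rewrite mulrC ler_pdivrMr// mul1r.
Qed.

End convolution.

(** * Fourier multipliers on distributions given by functions *)

Section multiplier_bound.
Context {R : realType}.
Implicit Types (x y : R3 R) (f a b k m : R3 R -> R) (g psi : R3 R -> R[i])
  (p C : R) (S T G : pre_distribution R).

(** [kcos m] and [ksin m] are the real and imaginary parts of the inverse Fourier transform of [m]. *)
Definition kcos m : R3 R -> R := fun z => cpi * tr 0 m z.
Definition ksin m : R3 R -> R := fun z => cpi * tr sph m z.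
Definition kabs m : R3 R -> R := fun z => `|kcos m z| + `|ksin m z|.

Lemma tr_opp th m x : tr th m (- x) = tr (- th) m x.
Proof.
apply: eq_intR => y; congr (_ * _); rewrite /wave -cosN; congr cos.
by rewrite -(scaleN1r x) dot3Zl mulN1r opprD opprK.
Qed.

Lemma tr_sph_odd m x : rschwartz m -> tr (- sph) m x = - tr sph m x.
Proof. by move=> sm; rewrite -tr_pi// ; congr (tr _ _ _); rewrite /sph; lra. Qed.

Lemma rschwartz_kcos m : rschwartz m -> rschwartz (kcos m).
Proof. by move=> sm; apply: rschwartzZ; exact: tr_rschwartz. Qed.

Lemma rschwartz_ksin m : rschwartz m -> rschwartz (ksin m).
Proof. by move=> sm; apply: rschwartzZ; exact: tr_rschwartz. Qed.

Lemma kern_kcos m : rschwartz m -> kern (kcos m).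
Proof. by move=> sm; exact/rschwartz_kern/rschwartz_kcos. Qed.

Lemma kern_ksin m : rschwartz m -> kern (ksin m).
Proof. by move=> sm; exact/rschwartz_kern/rschwartz_ksin. Qed.

Lemma kern_norm k : kern k -> kern (fun x => `|k x|).
Proof.
move=> [mk [K hK] Ik]; split; [exact: measurableT_comp| |exact: intbl_norm].
by exists K => x; rewrite normr_id.
Qed.

Lemma kernD k k' : kern k -> kern k' -> kern (fun x => k x + k' x).
Proof.
move=> [mk [K hK] Ik] [mk' [K' hK'] Ik']; split; [exact: measurable_funD| |exact: intblD].
by exists (K + K') => x; apply: le_trans (ler_normD _ _) (lerD _ _).
Qed.

Lemma kern_kabs m : rschwartz m -> kern (kabs m).
Proof. by move=> sm; apply: kernD; apply: kern_norm; [exact: kern_kcos|exact: kern_ksin]. Qed.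

(** The action of a kernel on test functions, transposed to convolution *)
Definition adj k f : R3 R -> R := fun x => intR (fun y => k (y - x) * f y).

Lemma tr_mul_tr_intbl th m f x : rschwartz m -> rschwartz f ->
  intbl (fun y => f y * tr th m (x - y)) /\ intbl (fun y => f y * tr th m (x + y)).
Proof.
move=> sm sf; have st := tr_rschwartz th sm.
have [K K0 hK] := rapid_bounded (rschwartz_rapid st).
have mf := diff3_measurable (rschwartz_diff3 sf).
have dt := rschwartz_diff3 st.
have I : intbl (fun y => K * `|f y|) by apply: intblZ; exact/intbl_norm/rschwartz_intbl.
split; apply: (intbl_le _ _ I).
- apply: measurable_funM => //.
  have h := @measurable_affine3 R (-1) x.
  have := measurableT_comp (diff3_measurable dt) h.
  by congr measurable_fun; apply/funext => y; rewrite /= /affine3 scaleN1r addrC.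
- by move=> y; rewrite normrM mulrC ler_wpM2r.
- apply: measurable_funM => //.
  have h := @measurable_affine3 R 1 x.
  have := measurableT_comp (diff3_measurable dt) h.
  by congr measurable_fun; apply/funext => y; rewrite /= /affine3 scale1r addrC.
- by move=> y; rewrite normrM mulrC ler_wpM2r.
Qed.

(** In the sum the terms in [x + y] of [tr_mul_tr] cancel, because the phases differ by [pi]. *)
Lemma mult_even m f x : rschwartz m -> rschwartz f ->
  cpi * (tr 0 (fun xi => m xi * tr 0 f xi) x + tr sph (fun xi => m xi * tr sph f xi) x) =
  adj (kcos m) f x.
Proof.
move=> sm sf; rewrite !tr_mul_tr// -mulrDr.
have I t := (tr_mul_tr_intbl t x sm sf).
rewrite -intRD; last 2 first.
- apply: eq_intbl (intblD (I (0 - 0)).1 (I (0 + 0)).2) => y.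
  by rewrite -mulrDr.
- apply: eq_intbl (intblD (I (sph - sph)).1 (I (sph + sph)).2) => y.
  by rewrite -mulrDr.
rewrite (@eq_intR _ _ (fun y => 2 * (f y * tr 0 m (x - y)))); last first.
  move=> y; rewrite !subrr addr0.
  have -> : sph + sph = - (0 + pi) :> R by rewrite /sph; lra.
  rewrite -tr_opp tr_pi// tr_opp oppr0.
  by ring.
rewrite intRZ; last by have := (I 0).1.
rewrite (_ : cpi * _ = cpi * intR (fun y => f y * tr 0 m (x - y))); last by field.
rewrite -intRZ; last by have := (I 0).1.
by apply: eq_intR => y; rewrite /kcos -opprB tr_opp oppr0; ring.
Qed.

(** As in [mult_even], the terms in [x + y] cancel. *)
Lemma mult_odd m f x : rschwartz m -> rschwartz f ->
  cpi * (tr sph (fun xi => m xi * tr 0 f xi) x - tr 0 (fun xi => m xi * tr sph f xi) x) =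
  - adj (ksin m) f x.
Proof.
move=> sm sf; rewrite !tr_mul_tr// -mulrBr.
have I t := (tr_mul_tr_intbl t x sm sf).
rewrite -intRB; last 2 first.
- apply: eq_intbl (intblD (I (sph - 0)).1 (I (sph + 0)).2) => y.
  by rewrite -mulrDr.
- apply: eq_intbl (intblD (I (0 - sph)).1 (I (0 + sph)).2) => y.
  by rewrite -mulrDr.
rewrite (@eq_intR _ _ (fun y => 2 * (f y * tr sph m (x - y)))); last first.
  by move=> y; rewrite subr0 addr0 sub0r add0r tr_sph_odd//; ring.
rewrite intRZ; last by have := (I sph).1.
rewrite (_ : cpi * _ = cpi * intR (fun y => f y * tr sph m (x - y))); last by field.
rewrite -intRZ; last by have := (I sph).1.
rewrite -[RHS]mulN1r -intRZ.
  by apply: eq_intR => y; rewrite /ksin -[x - y]opprB tr_opp tr_sph_odd//; ring.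
apply: (eq_intbl _ (intblZ (- cpi) (I sph).1)) => y.
by rewrite /ksin -[x - y]opprB tr_opp tr_sph_odd//; ring.
Qed.

Lemma mult_fourier_re m psi : rschwartz m -> schwartz psi ->
  re (fourier (rmul m (inv_fourier psi))) =
  fun x => adj (kcos m) (re psi) x - adj (ksin m) (im psi) x.
Proof.
move=> sm sp; have /schwartzP[sa sb] := sp.
have si := schwartz_inv_fourier sp.
rewrite fourier_re; last exact: schwartz_rmul.
rewrite (re_rmul m (inv_fourier psi)) (im_rmul m (inv_fourier psi)).
apply/funext => x; rewrite -mult_even// -mult_odd// inv_fourier_re// inv_fourier_im//.
have st t f : rschwartz f -> rschwartz (fun xi => m xi * tr t f xi).
  by move=> sf; apply: rschwartzM => //; exact/rschwartz_slow/tr_rschwartz.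
have -> : (fun xi => m xi * (cpi * (tr 0 (re psi) xi - tr sph (im psi) xi))) =
    (fun xi => cpi * ((fun xi => m xi * tr 0 (re psi) xi) xi + (fun xi => -1 * (m xi * tr sph (im psi) xi)) xi)).
  by apply/funext => xi; ring.
have -> : (fun xi => m xi * (cpi * (tr 0 (im psi) xi + tr sph (re psi) xi))) =
    (fun xi => cpi * ((fun xi => m xi * tr 0 (im psi) xi) xi + (fun xi => m xi * tr sph (re psi) xi) xi)).
  by apply/funext => xi; ring.
rewrite !trZ; do ?[apply: rschwartzD => //; try apply: rschwartzZ; exact: st].
rewrite !trD ?trZ; do ?[exact: st|apply: rschwartzZ; exact: st].
have lin (c u v w z : R) : c * (u + -1 * v) + c * (w + z) = c * (u + z) + c * (w - v) by ring.
exact: lin.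
Qed.

Lemma mult_fourier_im m psi : rschwartz m -> schwartz psi ->
  im (fourier (rmul m (inv_fourier psi))) =
  fun x => adj (kcos m) (im psi) x + adj (ksin m) (re psi) x.
Proof.
move=> sm sp; have /schwartzP[sa sb] := sp.
have si := schwartz_inv_fourier sp.
rewrite fourier_im; last exact: schwartz_rmul.
rewrite (re_rmul m (inv_fourier psi)) (im_rmul m (inv_fourier psi)).
apply/funext => x; rewrite -[adj (ksin m) _ x]opprK -mult_even// -mult_odd// inv_fourier_re// inv_fourier_im//.
have st t f : rschwartz f -> rschwartz (fun xi => m xi * tr t f xi).
  by move=> sf; apply: rschwartzM => //; exact/rschwartz_slow/tr_rschwartz.
have -> : (fun xi => m xi * (cpi * (tr 0 (re psi) xi - tr sph (im psi) xi))) =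
    (fun xi => cpi * ((fun xi => m xi * tr 0 (re psi) xi) xi + (fun xi => -1 * (m xi * tr sph (im psi) xi)) xi)).
  by apply/funext => xi; ring.
have -> : (fun xi => m xi * (cpi * (tr 0 (im psi) xi + tr sph (re psi) xi))) =
    (fun xi => cpi * ((fun xi => m xi * tr 0 (im psi) xi) xi + (fun xi => m xi * tr sph (re psi) xi) xi)).
  by apply/funext => xi; ring.
rewrite !trZ; do ?[apply: rschwartzD => //; try apply: rschwartzZ; exact: st].
rewrite !trD ?trZ; do ?[exact: st|apply: rschwartzZ; exact: st].
have lin (c u v w z : R) : c * (u + v) - c * (w + -1 * z) = c * (u + z) - c * (w - v) by ring.
exact: lin.
Qed.

Lemma Lnorm_intR p f : 0 < p -> intbl (fun x => `|f x| `^ p) ->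
  ('N[leb3 R]_p%:E [(fun x => (f x)%:E)] = (intR (fun x => `|f x| `^ p) `^ p^-1)%:E)%E.
Proof.
move=> p0 If; rewrite Lnorm.unlock -poweR_EFin; congr (_ `^ _)%E.
rewrite /intR /Rintegral fineK; last exact: (integrable_fin_num measurableT If).
by apply: eq_integral => x _; rewrite abse_EFin poweR_EFin.
Qed.

Lemma Lnorm_lty p f : 0 < p -> measurable_fun [set: M3 R] f ->
  ('N[leb3 R]_p%:E [(fun x => (f x)%:E)] < +oo)%E -> inLp p f.
Proof.
move=> p0 mf; rewrite Lnorm.unlock => /lty_poweRy -/(_ (invr_neq0 (lt0r_neq0 p0))) oo.
split => //; apply/integrableP; split.
  apply/measurable_EFinP; apply: (measurableT_comp (measurable_powR p)).
  exact: measurableT_comp.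
apply: le_lt_trans oo; rewrite le_eqVlt; apply/orP; left; apply/eqP.
by apply: eq_integral => x _; rewrite /= ger0_norm ?powR_ge0// poweR_EFin.
Qed.

Lemma inLp_le p f a : 0 < p -> measurable_fun [set: M3 R] f -> (forall x, `|f x| <= `|a x|) ->
  inLp p a -> inLp p f.
Proof.
move=> p0 mf fa [ma Ia]; split => //; apply: (intbl_le _ _ Ia).
  apply: (measurableT_comp (measurable_powR p)).
  exact: measurableT_comp.
move=> x; rewrite ger0_norm ?powR_ge0//; apply: ge0_ler_powR => //; exact: ltW.
Qed.

Lemma norm_cross (a b c d e f : R) : `|d| <= f -> `|c| <= e -> `|b| <= f -> `|a| <= e ->
  `|a - d| + `|b + c| <= 2 * (e + f).
Proof. by move=> h1 h2 h3 h4; have := ler_normB a d; have := ler_normD b c; lra. Qed.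

(** If [g] represents [G], the convolution of [g] with the inverse Fourier transform of [m]
   represents [S].  Working with real and imaginary parts loses the factor 2 over Young's inequality. *)
Lemma dLnorm_mult p m S G C : 1 <= p -> rschwartz m -> 0 < C -> intR (kabs m) <= C ->
  (forall psi, schwartz psi -> S psi = fmult m G psi) ->
  (dLnorm p S <= (2 * C)%:E * dLnorm p G)%E.
Proof.
move=> p1 sm C0 mC SG.
have p0 : 0 < p by exact: lt_le_trans p1.
have C20 : 0 < 2 * C by rewrite mulr_gt0.
rewrite -lee_pdivrMl//; apply/ereal_infP => _ [g [mg rg] <-]; rewrite lee_pdivrMl//.
have [->|] := eqVneq ('N[leb3 R]_p%:E [(fun x => (cmod (g x))%:E)])%E +oo%E.
  by rewrite gt0_muley ?leey// lte_fin.
rewrite -ltey => goo.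
have [m1 m2] := mg.
have mc : measurable_fun [set: M3 R] (cmod \o g).
  apply: (measurableT_comp (continuous_measurable_fun (@sqrt_continuous R))).
  by apply: measurable_funD; apply: measurable_funX.
have Lc := Lnorm_lty p0 mc goo.
have L1 : inLp p (re g).
  apply: (inLp_le p0 m1 _ Lc) => x; rewrite [leRHS]ger0_norm ?cmod_ge0//; exact: Re_le_cmod.
have L2 : inLp p (im g).
  apply: (inLp_le p0 m2 _ Lc) => x; rewrite [leRHS]ger0_norm ?cmod_ge0//; exact: Im_le_cmod.
have kc := kern_kcos sm; have ks := kern_ksin sm; have ka := kern_kabs sm.
pose h : R3 R -> R[i] := fun y => (conv (re g) (kcos m) y - conv (im g) (ksin m) y) +i*
  (conv (re g) (ksin m) y + conv (im g) (kcos m) y).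
have lin1 (u v w1 w2 w3 w4 : R) : u * (w1 - w2) - v * (w3 + w4) = (u * w1 - v * w4) - (u * w2 + v * w3).
  by ring.
have lin2 (u v w1 w2 w3 w4 : R) : u * (w3 + w4) + v * (w1 - w2) = (u * w3 - v * w2) + (u * w4 + v * w1).
  by ring.
have hE1 (a1 a2 a3 a4 : R) (z : R[i]) : complex.Re (((a1 - a2) +i* (a3 + a4)) * z) =
    (complex.Re z * a1 - complex.Re z * a2) - (complex.Im z * a3 + complex.Im z * a4).
  by case: z => u v /=; ring.
have hE2 (a1 a2 a3 a4 : R) (z : R[i]) : complex.Im (((a1 - a2) +i* (a3 + a4)) * z) =
    (complex.Im z * a1 - complex.Im z * a2) + (complex.Re z * a3 + complex.Re z * a4).
  by case: z => u v /=; ring.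
have mh : cmeasurable h.
  split; [apply: measurable_funB|apply: measurable_funD]; exact: (@measurable_conv _ p).
have rh : represents h S.
  split => // psi sp; have /schwartzP[sa sb] := sp.
  have sX := schwartz_fourier (schwartz_rmul sm (schwartz_inv_fourier sp)).
  rewrite (SG _ sp) fmultE (rg _ sX).2.
  pose X := fourier (rmul m (inv_fourier psi)).
  have cong1 (a a' b b' c c' d d' : R) : a = a' -> b = b' -> c = c' -> d = d' ->
    a - b - (c + d) = a' - b' - (c' + d') by move=> -> -> -> ->.
  have cong2 (a a' b b' c c' d d' : R) : a = a' -> b = b' -> c = c' -> d = d' ->
    a - b + (c + d) = a' - b' + (c' + d') by move=> -> -> -> ->.
  have Ere x : complex.Re (g x * fourier (rmul m (inv_fourier psi)) x) =
      (re g x * adj (kcos m) (re psi) x - im g x * adj (ksin m) (re psi) x) - (re g x * adj (ksin m) (im psi) x + im g x * adj (kcos m) (im psi) x).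
    transitivity (re g x * re X x - im g x * im X x).
      by rewrite /re /im /X; case: (g x) (fourier _ x) => ? ? [? ?].
    by rewrite /X (mult_fourier_re sm sp) (mult_fourier_im sm sp); exact: lin1.
  have Eim x : complex.Im (g x * fourier (rmul m (inv_fourier psi)) x) =
      (re g x * adj (kcos m) (im psi) x - im g x * adj (ksin m) (im psi) x) + (re g x * adj (ksin m) (re psi) x + im g x * adj (kcos m) (re psi) x).
    transitivity (re g x * im X x + im g x * re X x).
      by rewrite /re /im /X; case: (g x) (fourier _ x) => ? ? [? ?].
    by rewrite /X (mult_fourier_re sm sp) (mult_fourier_im sm sp); exact: lin2.
  have hre y : complex.Re (h y * psi y) =
     (re psi y * conv (re g) (kcos m) y - re psi y * conv (im g) (ksin m) y) -
     (im psi y * conv (re g) (ksin m) y + im psi y * conv (im g) (kcos m) y).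
    exact: hE1.
  have him y : complex.Im (h y * psi y) =
     (im psi y * conv (re g) (kcos m) y - im psi y * conv (im g) (ksin m) y) +
     (re psi y * conv (re g) (ksin m) y + re psi y * conv (im g) (kcos m) y).
    exact: hE2.
  have P f k q : inLp p f -> kern k -> rschwartz q ->
    [/\ intbl (fun y => q y * conv f k y), intbl (fun x => f x * adj k q x) &
      intR (fun x => f x * adj k q x) = intR (fun y => q y * conv f k y)].
    exact: conv_pair.
  have [i1c1 i1c2 e1c] := P _ _ _ L1 kc sa.
  have [i1s1 i1s2 e1s] := P _ _ _ L1 ks sa.
  have [i2c1 i2c2 e2c] := P _ _ _ L2 kc sa.
  have [i2s1 i2s2 e2s] := P _ _ _ L2 ks sa.
  have [j1c1 j1c2 f1c] := P _ _ _ L1 kc sb.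
  have [j1s1 j1s2 f1s] := P _ _ _ L1 ks sb.
  have [j2c1 j2c2 f2c] := P _ _ _ L2 kc sb.
  have [j2s1 j2s2 f2s] := P _ _ _ L2 ks sb.
  have Ire := intblB (intblB i1c1 i2s1) (intblD j1s1 j2c1).
  have Iim := intblD (intblB j1c1 j2s1) (intblD i1s1 i2c1).
  split; first by split; [exact: (eq_intbl (fun y => esym (hre y)) Ire)|
                          exact: (eq_intbl (fun y => esym (him y)) Iim)].
  rewrite /cint; congr (_ +i* _).
    transitivity (intR (fun x => complex.Re (g x * fourier (rmul m (inv_fourier psi)) x))); first by [].
    rewrite (eq_intR Ere) (intRB (intblB i1c2 i2s2) (intblD j1s2 j2c2)) (intRB i1c2 i2s2) (intRD j1s2 j2c2).
    transitivity (intR (fun x => complex.Re (h x * psi x))); last by [].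
    rewrite (eq_intR hre) (intRB (intblB i1c1 i2s1) (intblD j1s1 j2c1)) (intRB i1c1 i2s1) (intRD j1s1 j2c1).
    exact: (cong1 _ _ _ _ _ _ _ _ e1c e2s f1s f2c).
  transitivity (intR (fun x => complex.Im (g x * fourier (rmul m (inv_fourier psi)) x))); first by [].
  rewrite (eq_intR Eim) (intRD (intblB j1c2 j2s2) (intblD i1s2 i2c2)) (intRB j1c2 j2s2) (intRD i1s2 i2c2).
  transitivity (intR (fun x => complex.Im (h x * psi x))); last by [].
  rewrite (eq_intR him) (intRD (intblB j1c1 j2s1) (intblD i1s1 i2c1)) (intRB j1c1 j2s1) (intRD i1s1 i2c1).
  exact: (cong2 _ _ _ _ _ _ _ _ f1c f2s e1s e2c).
apply: (@le_trans _ _ ('N[leb3 R]_p%:E [(fun x => (cmod (h x))%:E)])%E).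
  by apply: ereal_inf_lbound; exists h.
have ka0 x : 0 <= kabs m x by rewrite addr_ge0.
have [IY leY] := young p1 Lc ka ka0 C0 mC.
pose I y := conv (fun x => `|(cmod \o g) x|) (kabs m) y.
have I0 y : 0 <= I y by apply: Rintegral_ge0 => x _; rewrite mulr_ge0.
have La : inLp p (fun x => `|(cmod \o g) x|).
  split; first exact: measurableT_comp.
  by apply: eq_intbl Lc.2 => x; rewrite normr_id.
have convle f k y : inLp p f -> (forall x, `|f x| <= `|(cmod \o g) x|) -> kern k ->
    `|conv f k y| <= conv (fun x => `|(cmod \o g) x|) (fun x => `|k x|) y.
  move=> Lf fg Kk; have [If _] := conv_section y p1 Lf Kk.
  apply: (le_trans (normr_intR If)); apply: intR_le.
  - exact: intbl_norm.
  - by have [] := conv_section y p1 La (kern_norm Kk).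
  - by move=> x; rewrite normrM ler_wpM2r.
have hI y : cmod (h y) <= 2 * I y.
  have r1 x : `|re g x| <= `|(cmod \o g) x|.
    by rewrite [leRHS]ger0_norm ?cmod_ge0//; exact: Re_le_cmod.
  have r2 x : `|im g x| <= `|(cmod \o g) x|.
    by rewrite [leRHS]ger0_norm ?cmod_ge0//; exact: Im_le_cmod.
  have EI : I y = conv (fun x => `|(cmod \o g) x|) (fun x => `|kcos m x|) y +
                  conv (fun x => `|(cmod \o g) x|) (fun x => `|ksin m x|) y.
    have [K1 _] := conv_section y p1 La (kern_norm kc).
    have [K2 _] := conv_section y p1 La (kern_norm ks).
    by rewrite /conv -intRD//; apply: eq_intR => x; rewrite -mulrDr.
  apply: (le_trans (cmod_le _)); rewrite /= EI.
  exact: (norm_cross (convle _ _ y L2 r2 ks) (convle _ _ y L2 r2 kc)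
    (convle _ _ y L1 r1 ks) (convle _ _ y L1 r1 kc)).
have mch : measurable_fun [set: M3 R] (cmod \o h).
  apply: (measurableT_comp (continuous_measurable_fun (@sqrt_continuous R))).
  by apply: measurable_funD; apply: measurable_funX; [exact: mh.1|exact: mh.2].
have Le y : `|cmod (h y)| `^ p <= 2 `^ p * I y `^ p.
  rewrite ger0_norm ?cmod_ge0// -powRM//; apply: ge0_ler_powR => //; first exact: ltW.
  - by rewrite nnegrE cmod_ge0.
  - by rewrite nnegrE mulr_ge0.
have IB : intbl (fun y => 2 `^ p * I y `^ p) by exact: intblZ.
have Ih : intbl (fun y => `|cmod (h y)| `^ p).
  apply: (intbl_le _ _ IB); last by move=> y; rewrite ger0_norm ?powR_ge0.
  apply: (measurableT_comp (measurable_powR p)).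
  exact: measurableT_comp.
rewrite !Lnorm_intR//; last exact: Lc.2.
rewrite -EFinM lee_fin.
have K0 : 0 <= intR (fun x => `|cmod (g x)| `^ p).
  by apply: Rintegral_ge0 => x _; exact: powR_ge0.
apply: (@le_trans _ _ (((2 * C) `^ p * intR (fun x => `|cmod (g x)| `^ p)) `^ p^-1)).
  apply: ge0_ler_powR; first by rewrite invr_ge0 ltW.
  - by rewrite nnegrE; apply: Rintegral_ge0 => x _; exact: powR_ge0.
  - by rewrite nnegrE mulr_ge0 ?powR_ge0.
  apply: (le_trans (intR_le Ih IB Le)).
  by rewrite (intRZ _ IY) (powRM p (ler0n _ 2) (ltW C0)) -mulrA ler_wpM2l ?powR_ge0.
rewrite powRM ?powR_ge0// -powRrM mulfV ?gt_eqF// powRr1 ?(ltW C20)//.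
Qed.

End multiplier_bound.

(** * The L^1 norm of a convolution kernel *)

Section kernel_bounds.
Context {R : realType}.
Implicit Types (f g m : R3 R -> R) (i : 'I_3) (b : seq 'I_3).

(** The index 18 is that of [tr_rSB] with 6 powers of decay, enough for integrability. *)
Lemma kabs_bound : exists2 C : R, 0 < C & forall m M, rschwartz m -> rSB 18 m M ->
  intR (kabs m) <= C * M.
Proof.
have [K K0 hK] := tr_rSB (R := R) 6.
have c0 : 0 <= cpi :> R by rewrite /cpi invr_ge0 exprn_ge0// mulr_ge0// pi_ge0.
exists (2 * cpi * K * wtI + 1) => [|m M sm hM].
  by rewrite ltr_pwDr// !mulr_ge0// wtI_ge0.
have M0 := rSB_ge0 hM.
have tb th x : `|tr th m x| <= K * M * wt3 x.
  by apply: jb6_wt3; exact: (hK th m M sm hM [::] x).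
have kb x : `|kabs m x| <= 2 * cpi * K * M * wt3 x.
  rewrite ger0_norm ?addr_ge0// /kabs /kcos /ksin !normrM (ger0_norm c0) -mulrDr.
  rewrite -!mulrA [2 * _]mulrCA ler_wpM2l// [2 * _]mulr_natl mulr2n mulrA.
  by apply: lerD; exact: tb.
have [mk _ _] := kern_kabs sm.
apply: (le_trans (ler_norm _)); apply: (le_trans (intR_wt mk kb)).
have -> : (2 * cpi * K * wtI + 1) * M = 2 * cpi * K * M * wtI + M by ring.
by rewrite lerDl.
Qed.

(** Change of variables in the frequency *)
Lemma tr_dil th m (a : R) z : 0 < a -> rschwartz m ->
  tr th m (a^-1 *: z) = a ^+ 3 * tr th (fun xi => m (a *: xi)) z.
Proof.
move=> a0 sm; have an0 : a != 0 by rewrite gt_eqF.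
have [_] := integral_affine_fin 0 an0 (rschwartz_intbl (wave_rschwartz th (a^-1 *: z) sm)).
rewrite (gtr0_norm a0) => E; rewrite /tr E; congr (_ * _); apply: eq_intR => xi.
rewrite addr0 /wave; congr (cos (_ + _) * _).
by rewrite dot3Zl dot3C dot3Zl dot3C mulrA mulVf// mul1r.
Qed.

(** The dilation of a symbol dilates its kernel and keeps the mass. *)
Lemma kabs_dil m (a : R) : 0 < a -> rschwartz m ->
  intR (kabs (fun xi => m (a *: xi))) = intR (kabs m).
Proof.
move=> a0 sm; have an0 : a^-1 != 0 by rewrite invr_neq0// gt_eqF.
have [_ _ Ik] := kern_kabs sm.
have [I1 ->] := integral_affine_fin 0 an0 Ik.
rewrite -intRZ//; apply: eq_intR => z.
have nE (u : R) : `|cpi * (a ^+ 3 * u)| = a ^+ 3 * `|cpi * u|.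
  by rewrite mulrCA normrM (gtr0_norm (exprn_gt0 3 a0)).
rewrite addr0 gtr0_norm ?invr_gt0// /kabs /kcos /ksin !tr_dil// !nE -mulrDr mulrA.
by rewrite -exprMn mulVf ?expr1n ?mul1r// gt_eqF.
Qed.

(** [kabs_bound] and [kabs_dil] in [dLnorm_mult]; the constant does not depend on the dilation. *)
Lemma mult_bound p : 1 <= p -> exists2 C : R, 0 < C &
  forall m M (a : R) (S G : pre_distribution R), rschwartz m -> rSB 18 m M -> 0 < M -> 0 < a ->
  (forall psi, schwartz psi -> S psi = fmult (fun xi => m (a *: xi)) G psi) ->
  (dLnorm p S <= (C * M)%:E * dLnorm p G)%E.
Proof.
move=> p1; have [K K0 hK] := kabs_bound.
exists (2 * K) => [|m M a S G sm hM M0 a0 SG]; first by rewrite mulr_gt0.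
rewrite -mulrA; apply: (@dLnorm_mult R p (fun xi => m (a *: xi)) S G (K * M) p1) => //.
- by apply: rschwartz_dil => //; rewrite gt_eqF.
- exact: mulr_gt0.
- by rewrite kabs_dil//; exact: hK.
Qed.

End kernel_bounds.

(** * Families of radial multipliers *)

Section multiplier_families.
Context {R : realType}.
Implicit Types (f g m : R3 R -> R) (i : 'I_3) (b : seq 'I_3).

(** In terms of the squared radius *)
Definition shell (c d : R) (x : R3 R) : bool := c <= rsq x <= d.

Definition vanish_off (c d : R) f : Prop := forall x, ~~ shell c d x -> f x = 0.

(** The complement of the shell is open. *)
Lemma vanish_off_rpd c d i f : vanish_off c d f -> vanish_off c d (rpd i f).
Proof.
move=> vf x nx.
have crs : {for x, continuous (@rsq R)}.
  exact: (differentiable_continuous (slow_diff3 (slow_rsq (R := R)) x)).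
have near0 : \forall y \near x, f y = 0.
  move: nx; rewrite /shell negb_and -!ltNge => /orP[xc|xd].
    have xn : \forall y \near x, rsq y < c by exact: crs _ (lt_nbhsl xc).
    near=> y; apply: vf; rewrite /shell negb_and -ltNge; apply/orP; left.
    by near: y.
  have xn : \forall y \near x, d < rsq y by exact: crs _ (lt_nbhsr xd).
  near=> y; apply: vf; rewrite /shell negb_and -!ltNge; apply/orP; right.
  by near: y.
rewrite /rpd (_ : 'D_(basis3 i) f x = 'D_(basis3 i) (cst 0) x); last exact: near_eq_derive.
by rewrite derive_cst.
Unshelve. all: by end_near.
Qed.

Context {A : Type} (sig : A -> A) (cc : A -> R) (F : A -> R -> R) (B : nat -> A -> R) (c d : R).

(** Profiles indexed by a type [A] on which differentiation acts by [sig], up to the factors [cc].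
   In the bounds [B k], one derivative with its factor is paid by passing from [k] to [k + 1]; so
   [k] measures a gain, such as a power of decay in the parameter, that derivatives consume. *)
Definition profile_family : Prop :=
  [/\ forall (a : A) (r : R), is_derive r (1 : R) (F a) (cc a * F (sig a) r),
      forall k (a : A), 0 <= B k a,
      forall k, exists2 D, 0 <= D & forall (a : A) (r : R), c <= r <= d -> `|F a r| <= D * B k a &
      forall k, exists2 D, 0 <= D & forall a : A, `|cc a| * B k.+1 (sig a) <= D * B k a].

Definition fam f a : R3 R -> R := fun x => F a (rsq x) * f x.

Context (hF : profile_family).

Lemma diff3_profile a : diff3 (fun x => F a (rsq x)).
Proof.
have [dF _ _ _] := hF.
apply: (@diff3_comp _ (F a) (fun r => cc a * F (sig a) r)); last exact/slow_diff3/slow_rsq.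
Qed.

Lemma rpd_profile a i :
  rpd i (fun x => F a (rsq x)) = fun x => cc a * F (sig a) (rsq x) * (2 * co i x).
Proof.
have [dF _ _ _] := hF.
rewrite (@rpd_comp _ i (F a) (fun r => cc a * F (sig a) r)); last exact/slow_diff3/slow_rsq.
by apply/funext => x; rewrite rpd_rsq.
Qed.

Lemma rsmooth_profile a : rsmooth (fun x => F a (rsq x)).
Proof.
apply: (@gen_rsmooth R (fun g => slow g \/ exists a, g = fun x => F a (rsq x))); last first.
  by apply: gen_base; right; exists a.
move=> g [sg|{a} [a ->]]; split.
- exact: slow_diff3.
- by move=> i; apply: gen_base; left; exact: slow_rpd.
- exact: diff3_profile.
- move=> i; rewrite rpd_profile; apply: genM; last by apply: gen_base; left; apply: slowZ; exact: slow_co.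
  by apply: genM; apply: gen_base; [left; exact: slow_cst|right; exists (sig a)].
Qed.

Lemma rsmooth_fam f a : rsmooth f -> rsmooth (fam f a).
Proof. by move=> sf; apply: rsmoothM => //; exact: rsmooth_profile. Qed.

Lemma rpd_fam i f a : rsmooth f ->
  rpd i (fam f a) = fun x => fam (rpd i f) a x + cc a * fam (fun x => 2 * (co i x * f x)) (sig a) x.
Proof.
move=> sf; rewrite rpdM ?rpd_profile; [|exact: diff3_profile|exact: rsmooth_diff3].
by apply/funext => x; rewrite /fam; ring.
Qed.

(** Induction on the order of differentiation, for all functions [f] and all [k] at once: a derivative
   of [F a (rsq x) * f x] falls on [f], or it produces the next profile, the factor [cc a], and
   the function [2 * (co i x * f x)], which vanishes off the same shell. *)
Lemma fam_bound N n f k : rschwartz f -> vanish_off c d f ->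
  exists2 C, 0 <= C & forall a b x, (size b <= n)%N -> jb x ^+ N * `|rpds b (fam f a) x| <= C * B k a.
Proof.
have [_ B0 FB cB] := hF.
elim: n f k => [|n IH] f k sf vf.
  have [D D0 hD] := FB k; have [M hM] := rschwartz_rapid sf N.
  have M0 : 0 <= M by apply: le_trans (hM 0); rewrite mulr_ge0// ltW// jbX_gt0.
  exists (D * M) => [|a b x]; first exact: mulr_ge0.
  rewrite leqn0 size_eq0 => /eqP -> /=; rewrite /fam normrM.
  have [xin|xout] := boolP (shell c d x); last first.
    by rewrite vf// normr0 !mulr0 !mulr_ge0.
  rewrite mulrCA [D * M * _]mulrAC; apply: ler_pM => //; first by rewrite mulr_ge0// ltW// jbX_gt0.
  exact: hD.
have [C C0 hC] := IH f k sf vf; have [D D0 hD] := cB k.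
have sc i : rschwartz (fun x => 2 * (co i x * f x)) by apply: rschwartzZ; exact: rschwartz_co.
have vc i : vanish_off c d (fun x => 2 * (co i x * f x)).
  by move=> x /vf ->; rewrite !mulr0.
have /choice[C1 hC1] : forall i, exists M, 0 <= M /\ forall a b x, (size b <= n)%N ->
    jb x ^+ N * `|rpds b (fam (rpd i f) a) x| <= M * B k a.
  by move=> i; have [M M0 hM] := IH _ k (rschwartz_rpd i sf) (vanish_off_rpd i vf); exists M.
have /choice[C2 hC2] : forall i, exists M, 0 <= M /\ forall a b x, (size b <= n)%N ->
    jb x ^+ N * `|rpds b (fam (fun x => 2 * (co i x * f x)) a) x| <= M * B k.+1 a.
  by move=> i; have [M M0 hM] := IH _ k.+1 (sc i) (vc i); exists M.
have C10 i : 0 <= C1 i by have [] := hC1 i.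
have C20 i : 0 <= C2 i by have [] := hC2 i.
have S0 : 0 <= \sum_i (C1 i + C2 i * D) by apply: sumr_ge0 => i _; rewrite addr_ge0// mulr_ge0.
exists (C + \sum_i (C1 i + C2 i * D)) => [|a b x]; first exact: addr_ge0.
case/lastP: b => [_|b i].
  by apply: (le_trans (hC a [::] x (leq0n _))); rewrite ler_wpM2r// lerDl.
rewrite size_rcons ltnS => bn; rewrite rpds_rcons rpd_fam; last by case: sf.
rewrite rpdsD; last 2 first.
- by apply: rsmooth_fam; case: (rschwartz_rpd i sf).
- by apply: rsmoothM; [exact: (slow_cst _).1|apply: rsmooth_fam; case: (sc i)].
rewrite rpdsZ; last by apply: rsmooth_fam; case: (sc i).
apply: (@le_trans _ _ ((C1 i + C2 i * D) * B k a)); last first.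
  rewrite ler_wpM2r// (bigD1 i)//= addrCA lerDl addr_ge0//.
  by rewrite sumr_ge0// => j _; rewrite addr_ge0// mulr_ge0.
apply: (@le_trans _ _ (jb x ^+ N * `|rpds b (fam (rpd i f) a) x| +
    `|cc a| * (jb x ^+ N * `|rpds b (fam (fun x => 2 * (co i x * f x)) (sig a)) x|))).
  rewrite [`|cc a| * _]mulrCA -mulrDr ler_wpM2l ?(ltW (jbX_gt0 _ _))// -normrM.
  exact: ler_normD.
rewrite mulrDl; apply: lerD; first exact: (hC1 i).2.
apply: (@le_trans _ _ (`|cc a| * (C2 i * B k.+1 (sig a)))).
  by rewrite ler_wpM2l//; exact: (hC2 i).2.
by rewrite mulrCA -mulrA ler_wpM2l.
Qed.

Lemma rschwartz_fam f a : rschwartz f -> vanish_off c d f -> rschwartz (fam f a).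
Proof.
move=> sf vf; split=> [|b N]; first by apply: rsmooth_fam; case: sf.
have [C _ hC] := fam_bound N (size b) 0 sf vf; exists (C * B 0 a) => x; exact: hC.
Qed.

Lemma rSB_fam n k f : rschwartz f -> vanish_off c d f ->
  exists2 C, 0 <= C & forall a, rSB n (fam f a) (C * B k a).
Proof.
move=> sf vf; have [C C0 hC] := fam_bound n n k sf vf; exists C => // a b x; exact: hC.
Qed.

End multiplier_families.

(** * Sequences of derivatives with exponential growth *)

Section exponential_type.
Context {R : realType}.
Implicit Types (a b c s t x y z K S M : R) (n k : nat).

Context (f : nat -> R -> R) (M : R).
Context (M0 : 0 < M) (cf : forall n, continuous (f n)).
Context (df : forall n s, 0 < s -> is_derive s 1 (f n) (f n.+1 s)).

(** The constant [K] depends on the point [s]; the rate [M] does not. *)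
Definition bounded_at K s : Prop := forall n, `|f n s| <= K * M ^+ n.
Definition bdd a b : Prop := exists K, forall s, a <= s <= b -> bounded_at K s.

Lemma mean_value n a b K : 0 <= a -> a <= b -> (forall s, a < s < b -> `|f n.+1 s| <= K) ->
  `|f n b - f n a| <= K * (b - a).
Proof.
move=> a0; rewrite le_eqVlt => /predU1P[<- _|ab hK]; first by rewrite !subrr normr0 mulr0.
have dab s : s \in `]a, b[ -> is_derive s 1 (f n) (f n.+1 s).
  by rewrite in_itv/= => /andP[sa _]; apply: df; exact: le_lt_trans sa.
have [s] := MVT ab dab (continuous_subspaceT (@cf n)).
rewrite in_itv/= => sab ->; rewrite normrM [`|b - a|]ger0_norm ?subr_ge0 ?(ltW ab)//.
by rewrite ler_wpM2r ?subr_ge0 ?(ltW ab)//; exact: hK.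
Qed.

Lemma mean_value_sym n a b K y z : 0 <= a -> a <= b -> b - a <= (2 * M)^-1 -> 0 <= K ->
  (forall s, a <= s <= b -> `|f n.+1 s| <= K) -> a <= y <= b -> a <= z <= b ->
  `|f n y| <= `|f n z| + K / (2 * M).
Proof.
move=> a0 ab bM K0 hK /andP[ay yb] /andP[az zb].
have main u v : a <= u -> u <= v -> v <= b -> `|f n v - f n u| <= K / (2 * M).
  move=> au uv vb; apply: (@le_trans _ _ (K * (v - u))).
    apply: mean_value => //; first exact: le_trans au.
    move=> s /andP[us sv]; apply: hK; rewrite (le_trans au (ltW us)) (le_trans (ltW sv) vb)//.
  by rewrite ler_wpM2l//; apply: le_trans bM; lra.
have : `|f n y - f n z| <= K / (2 * M).
  by have [yz|zy] := leP y z; [rewrite distrC; exact: main|apply: main => //; exact: ltW].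
by have := ler_normD (f n z) (f n y - f n z); rewrite addrCA subrr addr0; lra.
Qed.

(** By the mean value theorem, a uniform bound [S] improves to [K + S / 2]; iterate. *)
Lemma short_bound a b z K : 0 <= a -> a <= b -> b - a <= (2 * M)^-1 -> bdd a b ->
  a <= z <= b -> bounded_at K z -> forall s, a <= s <= b -> bounded_at (2 * K) s.
Proof.
move=> a0 ab bM [S hS] zab hz.
have K0 : 0 <= K by have := hz 0%N; rewrite expr0 mulr1; apply: le_trans.
have S0 : 0 <= S.
  have := hS a _ 0%N; rewrite lexx ab expr0 mulr1 => /(_ isT); exact: le_trans.
have half j : forall s, a <= s <= b -> bounded_at (2 * K + S / 2 ^+ j) s.
  elim: j => [|j IH] s sab n.
    rewrite expr0 divr1; apply: (le_trans (hS s sab n)).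
    by rewrite ler_wpM2r ?exprn_ge0 ?(ltW M0)// lerDr mulr_ge0.
  have Q0 : 0 <= 2 * K + S / 2 ^+ j by rewrite addr_ge0 ?mulr_ge0// divr_ge0// exprn_ge0.
  have h := mean_value_sym a0 ab bM (mulr_ge0 Q0 (exprn_ge0 n.+1 (ltW M0)))
    (fun r hr => IH r hr n.+1) sab zab.
  apply: (le_trans h); apply: (le_trans (lerD (hz n) (lexx _))).
  rewrite le_eqVlt; apply/orP; left; apply/eqP; rewrite [M ^+ n.+1]exprS [2 ^+ j.+1]exprS.
  have M1 : M != 0 by rewrite gt_eqF.
  have p2 : 2 ^+ j != 0 :> R by rewrite expf_neq0// pnatr_eq0.
  by field; rewrite ?M1 ?p2.
move=> s sab n; apply/ler_addgt0Pr => e e0.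
have Mn := exprn_gt0 n M0.
have [j hj] : exists j, S * M ^+ n / 2 ^+ j <= e.
  have /archi_boundP : 0 <= S * M ^+ n / e.
    by rewrite divr_ge0 ?(ltW e0)// mulr_ge0// ltW.
  set j := Num.Def.archi_bound _ => hj; exists j.
  rewrite ler_pdivrMr ?exprn_gt0// [leRHS]mulrC -ler_pdivrMr//.
  apply: (le_trans (ltW hj)); rewrite -natrX ler_nat ltnW//; exact: ltn_expl.
apply: (le_trans (half j s sab n)); rewrite mulrDl lerD2l.
by rewrite mulrAC.
Qed.

Lemma bdd_sub a b c d : c <= a -> b <= d -> bdd c d -> bdd a b.
Proof.
move=> ca bd [S hS]; exists S => s /andP[sa sb]; apply: hS.
by rewrite (le_trans ca sa) (le_trans sb bd).
Qed.

(** Each single bound is a closed condition. *)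
Lemma bounded_at_closed K s : (forall e : R, 0 < e -> exists2 r, `|s - r| < e & bounded_at K r) ->
  bounded_at K s.
Proof.
move=> h n; rewrite leNgt; apply/negP => lt.
have /cvgrPdist_lt/(_ (`|f n s| - K * M ^+ n)) : f n r @[r --> s] --> f n s by exact: cf.
rewrite subr_gt0 => /(_ lt) /nbhs_ballP[e /= e0 he].
have [r re br] := h e e0.
have := he r re; rewrite /= => h1; have := br n.
have := ler_normD (f n s - f n r) (f n r); rewrite subrK; lra.
Qed.

Context (pb : forall s, 0 <= s -> exists K, bounded_at K s).

(** Suppose that every subinterval that avoids the points with the bound [K'] has a uniform bound,
   where [K'] is at least [K] and bounds the left end.  For a point [t], let [x] be the last point
   before [t] with the bound [K'].  On [[s, t]] with [x < s] the bounds are uniform, hence by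
   [short_bound] at most twice the bound at [t], whatever [s] is; so they extend to [[x, t]].  Now
   [short_bound] applied at [x] gives the bound [2 K'] at [t], which does not depend on [t]. *)
Lemma bad_subinterval a b K : 0 <= a -> a <= b -> b - a <= (2 * M)^-1 -> ~ bdd a b ->
  exists c d, [/\ a <= c, c <= d, d <= b, ~ bdd c d & forall s, c <= s <= d -> ~ bounded_at K s].
Proof.
move=> a0 ab bM bad; apply: contrapT => nex; apply: bad.
have good c d : a <= c -> c <= d -> d <= b -> (forall s, c <= s <= d -> ~ bounded_at K s) -> bdd c d.
  by move=> ac cd db h; apply: contrapT => bad; apply: nex; exists c, d.
have [Ka hKa] := pb a0.
(* K' is enlarged so that the set of points with this bound contains the left end *)
pose K' := Num.max K Ka.
have mono L s : L <= K' -> bounded_at L s -> bounded_at K' s.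
  by move=> LK h n; apply: (le_trans (h n)); rewrite ler_wpM2r ?exprn_ge0 ?(ltW M0).
have aK : bounded_at K' a by apply: mono hKa; rewrite le_max lexx orbT.
have nK s : ~ bounded_at K' s -> ~ bounded_at K s.
  by move=> h h'; apply: h; apply: mono h'; rewrite le_max lexx.
have K'0 : 0 <= K' by have := aK 0%N; rewrite expr0 mulr1; apply: le_trans.
exists (2 * K') => t /andP[at_ tb].
have [tK|tK] := pselect (bounded_at K' t).
  by move=> n; apply: (le_trans (tK n)); rewrite ler_wpM2r ?exprn_ge0 ?(ltW M0)//; lra.
pose E := [set s | a <= s <= t /\ bounded_at K' s].
have Ea : E a by split => //; rewrite lexx.
have hsE : has_sup E by split; [exists a|exists t => s [/andP[]]].
pose x := sup E.
have ax : a <= x by apply: (ub_le_sup _ Ea); exact: hsE.2.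
have xt : x <= t by apply: (ge_sup hsE.1) => s [/andP[]].
have xK : bounded_at K' x.
  apply: bounded_at_closed => e e0; have [s Es xs] := sup_adherent e0 hsE.
  have sx : s <= x by apply: (ub_le_sup _ Es); exact: hsE.2.
  exists s; last exact: Es.2.
  by rewrite ger0_norm ?subr_ge0//; move: xs; rewrite -/x; lra.
have [Kt hKt] := pb (le_trans a0 at_).
(* beyond the supremum x no point up to t has the bound K' *)
have gap s : x < s -> s <= t -> ~ bounded_at K' s.
  move=> xs st sK; have as_ := le_trans ax (ltW xs); move: xs; rewrite ltNge => /negP; apply.
  by apply: (ub_le_sup hsE.2); split => //; rewrite st as_.
have right s : x < s -> s <= t -> bounded_at (2 * Kt) s.
  move=> xs st; have as_ : a <= s by exact: le_trans (ltW xs).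
  apply: (@short_bound s t t) => //.
  - exact: le_trans as_.
  - by apply: le_trans bM; lra.
  - by apply: good => // r /andP[sr rt]; apply/nK/gap => //; exact: lt_le_trans sr.
  - by rewrite st lexx.
  - by rewrite lexx st.
have xt' : x < t.
  by rewrite lt_neqAle xt andbT; apply/eqP => xe; apply: tK; rewrite -xe.
(* the bound by 2 * Kt passes to the left end x by continuity *)
have x2 : bounded_at (2 * Kt) x.
  apply: bounded_at_closed => e e0.
  pose s := Num.min t (x + e / 2).
  have xs : x < s by rewrite /s lt_min xt' ltrDl divr_gt0.
  have se : s <= x + e / 2 by rewrite /s ge_min lexx orbT.
  exists s; last by apply: right => //; rewrite /s ge_min lexx.
  by rewrite distrC gtr0_norm ?subr_gt0//; lra.
apply: (@short_bound x t x) => //.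
- exact: le_trans ax.
- by apply: le_trans bM; lra.
- exists (2 * Kt) => s /andP[]; rewrite le_eqVlt => /predU1P[<- //|xs st]; exact: right.
- by rewrite lexx.
- by rewrite xt lexx.
Qed.

(** Iterating [bad_subinterval] with the bounds 0, 1, 2, ... gives nested intervals; their common point
   satisfies none of these bounds. *)
Lemma short_good a b : 0 <= a -> a <= b -> b - a <= (2 * M)^-1 -> bdd a b.
Proof.
move=> a0 ab bM; apply: contrapT => bad.
pose ok (J : R * R) := [/\ 0 <= J.1, J.1 <= J.2, J.2 - J.1 <= (2 * M)^-1 & ~ bdd J.1 J.2].
pose T := {J : R * R | ok J}.
have stepP (J : T) (k : nat) : exists J' : T, [/\ (sval J).1 <= (sval J').1, (sval J').2 <= (sval J).2 &
    forall s, (sval J').1 <= s <= (sval J').2 -> ~ bounded_at k%:R s].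
  case: J => -[c d] /= [c0 cd dM bcd].
  have [c' [d' [cc' cd' dd' bcd' h]]] := bad_subinterval k%:R c0 cd dM bcd.
  have okJ : ok (c', d').
    by split => //=; [exact: le_trans cc'|apply: le_trans dM; lra].
  by exists (exist _ (c', d') okJ).
have [step hstep] : exists step : T -> nat -> T, forall J k,
    [/\ (sval J).1 <= (sval (step J k)).1, (sval (step J k)).2 <= (sval J).2 &
    forall s, (sval (step J k)).1 <= s <= (sval (step J k)).2 -> ~ bounded_at k%:R s].
  have /choice[g hg] : forall Jk : T * nat, exists J' : T,
      [/\ (sval Jk.1).1 <= (sval J').1, (sval J').2 <= (sval Jk.1).2 &
      forall s, (sval J').1 <= s <= (sval J').2 -> ~ bounded_at Jk.2%:R s].
    by case=> J k; exact: stepP.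
  by exists (fun J k => g (J, k)) => J k; exact: hg (J, k).
have ok0 : ok (a, b) by [].
pose seqJ := fix seqJ n : T := if n is m.+1 then step (seqJ m) m else exist _ (a, b) ok0.
(* the point common to all the intervals is the supremum of their left ends *)
pose lo n := (sval (seqJ n)).1; pose hi n := (sval (seqJ n)).2.
have lohi n : lo n <= hi n by rewrite /lo /hi; case: (seqJ n) => J [].
have mlo n k : lo n <= lo (k + n)%N.
  elim: k => // k IH; apply: (le_trans IH); rewrite addSn /lo /=.
  by have [] := hstep (seqJ (k + n)%N) (k + n)%N.
have mhi n k : hi (k + n)%N <= hi n.
  elim: k => // k IH; apply: le_trans IH; rewrite addSn /hi /=.
  by have [] := hstep (seqJ (k + n)%N) (k + n)%N.
have cross n k : lo n <= hi k.
  by apply: (le_trans (mlo n k)); apply: (le_trans (lohi _)); rewrite addnC; exact: mhi.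
pose x := sup (range lo).
have hsup : has_sup (range lo) by split; [exists (lo 0%N); exists 0%N|exists (hi 0%N) => _ [n _ <-]].
have lox n : lo n <= x by apply: (ub_le_sup hsup.2); exists n.
have xhi n : x <= hi n by apply: (ge_sup hsup.1) => _ [k _ <-].
have [K hK] := pb (le_trans a0 (lox 0%N)).
have K0 : 0 <= K by have := hK 0%N; rewrite expr0 mulr1; apply: le_trans.
have kK := archi_boundP K0; set k := Num.Def.archi_bound K in kK.
have [_ _ h] := hstep (seqJ k) k.
apply: (h x); first by rewrite [_ <= x](lox k.+1) [x <= _](xhi k.+1).
by move=> n; apply: (le_trans (hK n)); rewrite ler_wpM2r ?exprn_ge0 ?(ltW M0)// ltW.
Qed.

(** Cover the interval by short ones. *)
Lemma uniform_bound T : bdd 0 T.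
Proof.
have d0 : 0 < (2 * M)^-1 by rewrite invr_gt0 mulr_gt0.
have main j : bdd 0 (j%:R * (2 * M)^-1).
  elim: j => [|j [S hS]].
    by rewrite mul0r; apply: short_good => //; rewrite subrr ltW.
  have j0 : 0 <= j%:R * (2 * M)^-1 by rewrite mulr_ge0// ltW.
  have [S' hS'] : bdd (j%:R * (2 * M)^-1) (j.+1%:R * (2 * M)^-1).
    have -> : j.+1%:R * (2 * M)^-1 = j%:R * (2 * M)^-1 + (2 * M)^-1 by rewrite -natr1 mulrDl mul1r.
    apply: short_good => //; first by rewrite lerDl ltW.
    by rewrite addrAC subrr add0r.
  exists (Num.max S S') => s /andP[s0 sj] n.
  have [sl|sl] := leP s (j%:R * (2 * M)^-1).
    apply: (le_trans (hS s _ n)); first by rewrite s0.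
    by rewrite ler_wpM2r ?exprn_ge0 ?(ltW M0)// le_max lexx.
  apply: (le_trans (hS' s _ n)); first by rewrite (ltW sl).
  by rewrite ler_wpM2r ?exprn_ge0 ?(ltW M0)// le_max lexx orbT.
have [T0|T0] := leP 0 T; last first.
  by exists 0 => s /andP[s0 sT]; have := le_lt_trans (le_trans s0 sT) T0; rewrite ltxx.
have T20 : 0 <= T * (2 * M) by rewrite !mulr_ge0// ltW.
apply: (bdd_sub (lexx 0) _ (main (Num.Def.archi_bound (T * (2 * M))))).
by rewrite -ler_pdivrMr// invrK ltW// archi_boundP.
Qed.

End exponential_type.

(** * Taylor expansion with exponential growth *)

Section taylor.
Context {R : realType}.
Implicit Types (s t K S M r : R) (n k N : nat) (c : nat -> R).

(** The numbers [c k] are derivatives at the origin and not coefficients. *)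
Definition tpoly N c s : R := \sum_(k < N) c k * (s ^+ k / k`!%:R).

Lemma is_derive_monomial N s :
  is_derive s 1 (fun r => r ^+ N.+1 / N.+1`!%:R) (s ^+ N / N`!%:R).
Proof.
have h := @is_deriveX R R id N.+1 s 1 1 (is_derive_id _ _).
have h2 := is_deriveM h (is_derive_cst (N.+1`!%:R^-1 : R) s 1).
have -> : (fun r => r ^+ N.+1 / N.+1`!%:R) = (id ^+ N.+1 * cst (N.+1`!%:R^-1)) :> (R -> R).
  by rewrite exprfctE.
apply: is_derive_eq h2 _.
have f0 : N`!%:R != 0 :> R by rewrite pnatr_eq0 -lt0n fact_gt0.
rewrite /GRing.scale/= mulr1 mulr0 add0r /= factS natrM.
have f1 : N.+1%:R != 0 :> R by rewrite pnatr_eq0.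
by rewrite invfM; field; rewrite f0 nat1r f1.
Qed.

Lemma is_derive_tpoly N c s : is_derive s 1 (tpoly N.+1 c) (tpoly N (fun k => c k.+1) s).
Proof.
elim: N => [|N IH].
  rewrite /tpoly big_ord0 (_ : (fun r => _) = cst (c 0%N)); first exact: is_derive_cst.
  by apply/funext => r; rewrite big_ord_recl big_ord0 addr0 expr0 fact0 divr1 mulr1.
have -> : tpoly N.+2 c = tpoly N.+1 c \+ (fun r => c N.+1 *: (r ^+ N.+1 / N.+1`!%:R)).
  by apply/funext => r; rewrite /tpoly big_ord_recr.
rewrite /tpoly big_ord_recr /=; apply: is_deriveD => //.
apply: is_deriveZ; exact: is_derive_monomial.
Qed.

Lemma tpoly0 N c : tpoly N.+1 c 0 = c 0%N.
Proof.
rewrite /tpoly big_ord_recl expr0 fact0 divr1 mulr1 big1 ?addr0// => k _.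
by rewrite exprS mul0r mul0r mulr0.
Qed.

(** On the half-line, with a derivative that is only known for positive times *)
Lemma nonneg_derive (h dh : R -> R) T : 0 <= T -> continuous h -> (forall s, 0 < s -> is_derive s 1 h (dh s)) ->
  (forall s, 0 <= s <= T -> 0 <= dh s) -> h 0 <= h T.
Proof.
rewrite le_eqVlt => /predU1P[<- //|T0] ch dh' h0.
have d s : s \in `]0, T[ -> is_derive s 1 h (dh s).
  by rewrite in_itv/= => /andP[s0 _]; exact: dh'.
have [s] := MVT T0 d (continuous_subspaceT ch).
rewrite in_itv/= => /andP[s0 sT]; rewrite subr0 => E.
by rewrite -subr_ge0 E mulr_ge0 ?(ltW T0)// h0// !ltW.
Qed.

Context (f : nat -> R -> R) (M : R).
Context (M0 : 0 < M) (cf : forall n, continuous (f n)).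
Context (df : forall n s, 0 < s -> is_derive s 1 (f n) (f n.+1 s)).

Lemma continuous_tpoly N c : continuous (tpoly N.+1 c).
Proof.
move=> s; apply: differentiable_continuous; apply/derivable1_diffP.
by have := is_derive_tpoly N c s => h; exact: ex_derive.
Qed.

(** Induction on [N] for all [n]: the derivative of the remainder of [f n] is the remainder of
   [f n.+1] of lower order. *)
Lemma taylor_bound S T : (forall s, 0 <= s <= T -> bounded_at f M S s) ->
  forall N n s, 0 <= s <= T ->
  `|f n s - tpoly N (fun k => f (n + k)%N 0) s| <= S * M ^+ (n + N) * (s ^+ N / N`!%:R).
Proof.
move=> hS; elim => [|N IH] n s sT.
  by rewrite /tpoly big_ord0 subr0 expr0 fact0 divr1 mulr1 addn0; exact: hS.
have /andP[s0 sT'] := sT.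
pose A := S * M ^+ (n + N.+1).
pose g r := f n r - tpoly N.+1 (fun k => f (n + k)%N 0) r.
pose dg' r := f n.+1 r - tpoly N (fun k => f (n.+1 + k)%N 0) r.
have dg r : 0 < r -> is_derive r 1 g (dg' r).
  move=> r0; have := is_derive_tpoly N (fun k => f (n + k)%N 0) r.
  rewrite (_ : (fun k => f (n + k.+1)%N 0) = (fun k => f (n.+1 + k)%N 0)); last first.
    by apply/funext => k; rewrite addnS addSn.
  by move=> h; exact: (is_deriveB (df n r0) h).
have cg : continuous g.
  by move=> r; apply: cvgB; [exact: cf|exact: continuous_tpoly].
have g0 : g 0 = 0 by rewrite /g tpoly0 addn0 subrr.
have gb r : 0 <= r <= s -> `|dg' r| <= A * (r ^+ N / N`!%:R).
  move=> /andP[r0 rs]; rewrite /A addnS -addSn; apply: IH.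
  by rewrite r0 (le_trans rs sT').
rewrite -/(g s).
pose m r := A * (r ^+ N.+1 / N.+1`!%:R).
have dm r : is_derive r 1 m (A * (r ^+ N / N`!%:R)).
  by apply: (@is_deriveZ _ _ _ _ A); exact: is_derive_monomial.
have cm : continuous m.
  by move=> r; apply: differentiable_continuous; apply/derivable1_diffP.
have m0 : m 0 = 0 by rewrite /m exprS !mul0r mulr0.
rewrite ler_norml; apply/andP; split.
  rewrite -subr_ge0 opprK.
  have := @nonneg_derive (fun r => g r + m r) (fun r => dg' r + A * (r ^+ N / N`!%:R)) s s0.
  rewrite /= g0 m0 addr0; apply.
  - by move=> r; apply: cvgD; [exact: cg|exact: cm].
  - by move=> r r0; exact: is_deriveD (dg r r0) (dm r).
  - by move=> r rs; have := gb r rs; rewrite ler_norml => /andP[]; lra.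
rewrite -subr_ge0.
have := @nonneg_derive (fun r => m r - g r) (fun r => A * (r ^+ N / N`!%:R) - dg' r) s s0.
rewrite /= g0 m0 subr0; apply.
- by move=> r; apply: cvgB; [exact: cm|exact: cg].
- by move=> r r0; exact: is_deriveB (dm r) (dg r r0).
- by move=> r rs; have := gb r rs; rewrite ler_norml => /andP[]; lra.
Qed.

Lemma exp_coeff_cvg0 (S t : R) : (fun N => S * (t ^+ N / N`!%:R)) @ \oo --> 0.
Proof.
rewrite -[X in _ --> X](mulr0 S); apply: cvgMr.
exact: (cvg_exp_coeff t).
Qed.

(** The uniform bound and the exponential series *)
Lemma taylor_cvg T : 0 <= T -> (forall s, 0 <= s -> exists K, bounded_at f M K s) ->
  (fun N => tpoly N (f ^~ 0) T) @ \oo --> f 0%N T.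
Proof.
move=> T0 pb; have [S hS] := uniform_bound M0 cf df pb T.
apply/cvgrPdist_le => e e0.
have /cvgrPdist_le/(_ e e0) := exp_coeff_cvg0 S (M * T).
apply: filterS => N; rewrite sub0r normrN => h.
have TT : 0 <= T <= T by rewrite T0 lexx.
apply: le_trans (taylor_bound hS N 0 TT) _; apply: le_trans h.
by rewrite add0n exprMn -!mulrA ler_norm.
Qed.

End taylor.

(** * Three families of radial profiles *)

Section profile_instances.
Context {R : realType}.
Implicit Types (c d r s t tau : R) (f : R3 R -> R) (k n N : nat).

Lemma is_derive_expRl (a r : R) : is_derive r 1 (fun r => expR (a * r)) (a * expR (a * r)).
Proof.
have h : is_derive r (1 : R) (fun r => a *: r) (a *: 1).
  by apply: is_deriveZ; exact: is_derive_id.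
have h2 := is_derive1_comp (is_derive_expR (a * r)) h.
by apply: is_derive_eq h2 _; rewrite /GRing.scale/= mulr1 mulrC.
Qed.

(** A derivative costs a factor [tau], that is, one power of decay in [tau], of which there are
   arbitrarily many because the shell stays away from the origin. *)
Lemma heat_profile c d : 0 < c <= 1 ->
  profile_family id (fun tau => - `|tau|) (fun tau r => expR (- `|tau| * r))
    (fun k tau => ((1 + `|tau|) ^+ k)^-1) c d.
Proof.
move=> /andP[c0 c1]; split.
- by move=> tau r; exact: is_derive_expRl.
- by move=> k tau; rewrite invr_ge0 exprn_ge0// addr_ge0.
- move=> k; have [C C0 hC] := expR_dominates (R := R) k.
  exists (C * c^-1 ^+ k) => [|tau r /andP[cr _]].
    by rewrite mulr_ge0 ?(ltW C0)// exprn_ge0// invr_ge0 ltW.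
  have t0 : 0 <= `|tau| by [].
  move: `|tau| t0 => {}tau t0.
  have p0 : 0 < 1 + tau by rewrite ltr_pwDl.
  rewrite ger0_norm ?expR_ge0// ler_pdivlMr ?exprn_gt0// mulrC.
  have ct : 0 <= c * tau by rewrite mulr_ge0// ltW.
  have h1 : (1 + tau) ^+ k <= c^-1 ^+ k * (1 + c * tau) ^+ k.
    rewrite -exprMn lerXn2r ?nnegrE ?(ltW p0)//.
      by rewrite mulr_ge0 ?invr_ge0 ?(ltW c0)// addr_ge0.
    rewrite mulrDr mulr1 mulKf ?gt_eqF// lerD2r invf_ge1//.
  have h2 : expR (- tau * r) <= expR (- (c * tau)).
    by rewrite ler_expR mulNr lerN2 mulrC ler_wpM2l// ltW.
  apply: (le_trans (ler_pM _ _ h1 h2)); rewrite ?expR_ge0 ?exprn_ge0 ?(ltW p0)//.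
  by rewrite -mulrA [C * _]mulrC ler_wpM2l ?hC// exprn_ge0// invr_ge0 ltW.
- move=> k; exists 1 => // tau; rewrite normrN normr_id mul1r exprS invfM mulrA.
  rewrite ler_piMl ?invr_ge0 ?exprn_ge0 ?addr_ge0//.
  by rewrite ler_pdivrMr ?ltr_pwDl// mul1r lerDr.
Qed.

(** A derivative costs a factor [n]; the base [expR 1 * d] absorbs all the powers of [n]. *)
Lemma power_profile d : 1 <= d ->
  profile_family predn (fun n => - n%:R) (fun n r => (- r) ^+ n)
    (fun k n => (expR 1 * d) ^+ n / (1 + n%:R) ^+ k) 0 d.
Proof.
move=> d1; have d0 : 0 < d by exact: lt_le_trans d1.
have ed1 : 1 <= expR 1 * d by rewrite -[1]mulr1 ler_pM// ltW// expR_gt1.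
have ed0 : 0 <= expR 1 * d by exact: le_trans ed1.
have B0 k n : 0 <= (expR 1 * d) ^+ n / (1 + n%:R) ^+ k.
  by rewrite divr_ge0// exprn_ge0// addr_ge0.
split => //.
- move=> n r; have h := @is_deriveX R R -%R n r 1 (- 1) (is_deriveN (is_derive_id _ _)).
  rewrite exprfctE in h; apply: is_derive_eq h _.
  by rewrite /GRing.scale/= mulrN1 mulNr.
- move=> k; have [C C0 hC] := expR_dominates (R := R) k.
  exists C => [|n r /andP[r0 rd]]; first exact: ltW.
  rewrite normrX normrN (ger0_norm r0).
  apply: (@le_trans _ _ (d ^+ n)); first by rewrite lerXn2r// nnegrE// ltW.
  have -> : C * ((expR 1 * d) ^+ n / (1 + n%:R) ^+ k) = (C * expR n%:R / (1 + n%:R) ^+ k) * d ^+ n.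
    by rewrite exprMn -expRM_natl mulr1; ring.
  rewrite ler_peMl ?exprn_ge0 ?(ltW d0)// ler_pdivlMr ?exprn_gt0 ?ltr_pwDl// mul1r.
  by have := hC n%:R (ler0n _ _); rewrite expRN ler_pdivrMr ?expR_gt0.
- move=> k; exists (2 ^+ k) => [|n]; first by rewrite exprn_ge0.
  rewrite normrN; case: n => [|m]; first by rewrite normr0 mul0r mulr_ge0// exprn_ge0.
  rewrite [`|_|]ger0_norm// /=.
  have p1 : 0 < 1 + m%:R :> R by rewrite ltr_pwDl.
  have p2 : 0 < 1 + m.+1%:R :> R by rewrite ltr_pwDl.
  have -> : m.+1%:R * ((expR 1 * d) ^+ m / (1 + m%:R) ^+ k.+1) = (expR 1 * d) ^+ m / (1 + m%:R) ^+ k :> R.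
    by rewrite -nat1r exprS; field; rewrite expf_neq0 ?gt_eqF.
  have h : ((1 + m%:R) ^+ k)^-1 <= 2 ^+ k / (1 + m.+1%:R) ^+ k :> R.
    rewrite ler_pdivlMr ?exprn_gt0// mulrC ler_pdivrMr ?exprn_gt0// -exprMn.
    rewrite lerXn2r ?nnegrE ?mulr_ge0 ?(ltW p1) ?(ltW p2)//.
    by rewrite -natr1; have := ler0n R m; lra.
  rewrite exprSr; apply: (le_trans (ler_wpM2l (exprn_ge0 m ed0) h)).
  have -> : 2 ^+ k * ((expR 1 * d) ^+ m * (expR 1 * d) / (1 + m.+1%:R) ^+ k) =
      ((expR 1 * d) ^+ m * (2 ^+ k / (1 + m.+1%:R) ^+ k)) * (expR 1 * d) by ring.
  by rewrite ler_peMr// mulr_ge0 ?exprn_ge0// divr_ge0 ?exprn_ge0// ltW.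
Qed.

(** [taylor_bound] for the functions [(- r) ^+ n * expR (- r * s)] of [s] *)
Lemma exp_remainder t d r N : 0 <= t -> 0 < d -> 0 <= r <= d ->
  `|expR (- t * r) - tpoly N (fun k => (- t) ^+ k) r| <= (d * t) ^+ N / N`!%:R.
Proof.
move=> t0 d0 /andP[r0 rd].
pose f n s := (- r) ^+ n * expR (- r * s).
have df' n s : is_derive s 1 (f n) (f n.+1 s).
  have := @is_deriveZ _ _ _ _ ((- r) ^+ n) s 1 _ (is_derive_expRl (- r) s).
  by move=> h; apply: is_derive_eq h _; rewrite /f /GRing.scale/= exprSr mulrA.
have df n s : 0 < s -> is_derive s 1 (f n) (f n.+1 s) by move=> _; exact: df'.
have cf n : continuous (f n).
  move=> s; apply: differentiable_continuous; apply/derivable1_diffP.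
  by have h := df' n s; exact: ex_derive.
have hb s : 0 <= s <= t -> bounded_at f d 1 s.
  move=> /andP[s0 _] n; rewrite mul1r /f normrM normrX normrN (ger0_norm r0).
  rewrite -[leRHS]mulr1 ler_pM// ?exprn_ge0//; first by rewrite lerXn2r// nnegrE// ltW.
  by rewrite ger0_norm ?expR_ge0// expR_le1 mulNr oppr_le0 mulr_ge0.
have tt : 0 <= t <= t by rewrite t0 lexx.
have := taylor_bound cf df hb N 0 tt.
rewrite mul1r add0n mulrA -exprMn; apply: le_trans.
rewrite le_eqVlt; apply/orP; left; apply/eqP; congr `|_ - _|.
  by rewrite /f expr0 mul1r !mulNr mulrC.
rewrite /tpoly; apply: eq_bigr => k _; rewrite add0n /f mulr0 expR0 mulr1.
by rewrite [(- t) ^+ k]exprNn [(- r) ^+ k]exprNn; ring.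
Qed.

(** The derivative of a Taylor remainder is a multiple of the preceding remainder.  The remainders
   decay faster than any geometric progression, so the choice of the ratio 1/2 is arbitrary. *)
Lemma remainder_profile t d : 0 <= t -> 0 < d ->
  profile_family predn (fun=> - t) (fun N r => expR (- t * r) - tpoly N (fun k => (- t) ^+ k) r)
    (fun k N => (2 ^+ (N + k))^-1) 0 d.
Proof.
move=> t0 d0; split.
- move=> N r; have h := is_derive_expRl (- t) r.
  case: N => [|N] /=.
    have h2 : is_derive r 1 (tpoly 0 (fun k => (- t) ^+ k)) 0.
      rewrite (_ : tpoly 0 _ = cst 0); first exact: is_derive_cst.
      by apply/funext => s; rewrite /tpoly big_ord0.
    by apply: is_derive_eq (is_deriveB h h2) _; rewrite /tpoly big_ord0 !subr0.
  apply: is_derive_eq (is_deriveB h (is_derive_tpoly N _ r)) _.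
  rewrite [RHS]mulrBr; congr (_ - _); rewrite /tpoly mulr_sumr; apply: eq_bigr => k _.
  by rewrite exprS -mulrA.
- by move=> k N; rewrite invr_ge0 exprn_ge0.
- move=> k; have cv : cvgn (fun N : nat => 1 * ((2 * (d * t)) ^+ N / N`!%:R)).
    by apply/cvg_ex; exists 0; exact: exp_coeff_cvg0.
  have [D' [_ /(_ (D' + 1))]] := cvg_seq_bounded cv; rewrite ltrDl ltr01 => /(_ isT) hD.
  pose D := D' + 1.
  exists (`|D| * 2 ^+ k) => [|N r rd]; first by rewrite mulr_ge0// exprn_ge0.
  apply: (le_trans (exp_remainder N t0 d0 rd)).
  rewrite exprD invfM mulrACA mulfV ?mulr1 ?expf_neq0// ler_pdivlMr ?exprn_gt0//.
  rewrite mulrAC -exprMn mulrC [_ * 2]mulrC.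
  have := hD N I; rewrite /= mul1r => h.
  apply: le_trans (le_trans h (ler_norm _)); rewrite mulrC; exact: ler_norm.
- move=> k; exists t => // N; rewrite normrN (ger0_norm t0) ler_wpM2l//.
  rewrite lef_pV2 ?posrE ?exprn_gt0// ler_weXn2l ?ler1n//.
  by case: N => [|N] /=; rewrite ?add0n ?leqnSn// addSnnS.
Qed.

End profile_instances.

(** * Solutions of the heat equation in frequency *)

Section heat_representation.
Context {R : realType}.
Implicit Types (x y : R3 R) (chi m : R3 R -> R) (f g psi : R3 R -> R[i]) (T : pre_distribution R)
  (a c d s t : R) (n k N : nat).

Lemma re_lin a f g : re (fun x => a%:C * f x + g x) = fun x => a * re f x + re g x.
Proof. by apply/funext => x; rewrite /re; case: (f x) (g x) => ? ? [? ?] /=; rewrite mul0r subr0. Qed.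

Lemma im_lin a f g : im (fun x => a%:C * f x + g x) = fun x => a * im f x + im g x.
Proof. by apply/funext => x; rewrite /im; case: (f x) (g x) => ? ? [? ?] /=; rewrite mul0r addr0. Qed.

Lemma schwartz_lin a f g : schwartz f -> schwartz g -> schwartz (fun x => a%:C * f x + g x).
Proof.
move=> /schwartzP[f1 f2] /schwartzP[g1 g2]; apply/schwartzP; rewrite re_lin im_lin.
by split; apply: rschwartzD => //; exact: rschwartzZ.
Qed.

(** Real scalars are enough for Taylor sums. *)
Lemma fourier_lin a f g : schwartz f -> schwartz g ->
  fourier (fun x => a%:C * f x + g x) = fun x => a%:C * fourier f x + fourier g x.
Proof.
move=> sf sg; have /schwartzP[f1 f2] := sf; have /schwartzP[g1 g2] := sg.
have sl := schwartz_lin a sf sg.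
have L t (h k : R3 R -> R) x : rschwartz h -> rschwartz k ->
    tr t (fun x => a * h x + k x) x = a * tr t h x + tr t k x.
  by move=> sh sk; rewrite trD ?trZ//; exact: rschwartzZ.
have E1 (u v w z : R) : a * u + v + (a * w + z) = a * (u + w) + (v + z) by ring.
have E2 (u v w z : R) : a * u + v - (a * w + z) = a * (u - w) + (v - z) by ring.
apply: complex_ext => x.
  by rewrite re_lin !fourier_re// re_lin im_lin !L// E1.
by rewrite im_lin !fourier_im// re_lin im_lin !L// E2.
Qed.

Lemma sum_co_sqr x : \sum_(i < 3) co i x ^+ 2 = rsq x.
Proof. by rewrite !big_ord_recl big_ord0 addr0 /rsq /dot3 /co /= !expr2 addrA. Qed.

Lemma fourierD f g : schwartz f -> schwartz g ->
  fourier (fun x => f x + g x) = fun x => fourier f x + fourier g x.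
Proof.
move=> sf sg; have -> : (fun x => f x + g x) = (fun x => 1%:C * f x + g x).
  by apply/funext => x; rewrite mul1r.
by rewrite fourier_lin//; apply/funext => x; rewrite mul1r.
Qed.

Lemma schwartz0 : schwartz (fun _ : R3 R => 0 : R[i]).
Proof. by apply/schwartzP; split; exact: rschwartz0. Qed.

Lemma fourier0 x : fourier (fun _ : R3 R => 0 : R[i]) x = 0.
Proof.
have := congr1 (@^~ x) (fourierD schwartz0 schwartz0) => /=.
have -> : (fun _ : R3 R => 0 + 0 : R[i]) = (fun=> 0) by apply/funext => y; rewrite addr0.
by move=> E; apply: (addrI (fourier (fun=> 0) x)); rewrite addr0 -E.
Qed.

Lemma fourier_sum n (h : 'I_n -> R3 R -> R[i]) : (forall i, schwartz (h i)) ->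
  schwartz (fun x => \sum_i h i x) /\
  fourier (fun x => \sum_i h i x) = fun x => \sum_i fourier (h i) x.
Proof.
elim: n h => [|n IH] h sh.
  have -> : (fun x => \sum_i h i x) = fun=> 0 by apply/funext => x; rewrite big_ord0.
  by split; [exact: schwartz0|apply/funext => x; rewrite fourier0 big_ord0].
have [s1 E1] := IH (fun i => h (lift ord0 i)) (fun i => sh _).
have E : (fun x => \sum_i h i x) = (fun x => h ord0 x + \sum_i h (lift ord0 i) x).
  by apply/funext => x; rewrite big_ord_recl.
rewrite E fourierD// E1; split; last by apply/funext => x; rewrite big_ord_recl.
have := schwartz_lin 1 (sh ord0) s1; congr schwartz; apply/funext => x.
by rewrite mul1r.
Qed.

(** The equation for [u] becomes multiplication by [- rsq] under the Fourier transform. *)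
Lemma laplacian_fourier f : schwartz f ->
  laplacian (fourier f) = fourier (fun xi => (- rsq xi)%:C * f xi).
Proof.
move=> sf; have /schwartzP[f1 f2] := sf.
have sc h i : rschwartz h -> rschwartz (fun xi => - co i xi ^+ 2 * h xi).
  move=> sh; have := rschwartzZ (-1) (rschwartz_co i (rschwartz_co i sh)).
  by congr rschwartz; apply/funext => xi; ring.
have s2 i : schwartz (rmul (fun xi => - co i xi ^+ 2) f).
  by apply/schwartzP; rewrite re_rmul im_rmul; split; exact: sc.
have s1 i : schwartz (fun xi => - 'i * (co i xi)%:C * f xi).
  apply/schwartzP; split.
    have := rschwartz_co i f2; congr rschwartz; apply/funext => xi.
    by rewrite /re /im; case: (f xi) => u v /=; ring.
  have := rschwartzZ (-1) (rschwartz_co i f1); congr rschwartz; apply/funext => xi.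
  by rewrite /re /im; case: (f xi) => u v /=; ring.
have dd i : pd i (pd i (fourier f)) = fourier (rmul (fun xi => - co i xi ^+ 2) f).
  rewrite !pd_fourier//; congr fourier; apply/funext => xi; rewrite /rmul.
  by apply/eqP; rewrite eq_complex; case: (f xi) => u v /=; apply/andP; split; apply/eqP; ring.
have E : (fun xi => (- rsq xi)%:C * f xi) = fun xi => \sum_(i < 3) rmul (fun xi => - co i xi ^+ 2) f xi.
  apply/funext => xi; rewrite /rmul -mulr_suml -rmorph_sum /=; congr (_%:C * _).
  by rewrite -sum_co_sqr sumrN.
rewrite E (fourier_sum s2).2; apply/funext => x; rewrite /laplacian.
by apply: eq_bigr => i _; rewrite dd.
Qed.

(** Composition of the continuity of [T] with that of the Fourier transform *)
Lemma tempered_fourier T : tempered T -> exists n C, 0 <= C /\ forall f M, schwartz f -> cSB n f M ->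
  cmod (T (fourier f)) <= C * M.
Proof.
move=> [_ [C [k hT]]]; have [K K0 hK] := fourier_cSB (R := R) k.
exists (k + 6 + k)%N, (`|C| * (2 * K)); split => [|f M sf hM]; first by rewrite !mulr_ge0.
have M0 := rSB_ge0 hM.1.
apply: (@le_trans _ _ (C * (2 * (K * M)))).
  apply: hT; first exact: schwartz_fourier.
  by move=> b x bk; exact: cSB_cmod (hK f M sf hM) bk.
by rewrite -!mulrA ler_wpM2r ?ler_norm// !mulr_ge0.
Qed.

(** [rSB_fam] on both parts of a product with a fixed Schwartz function *)
Lemma cSB_fam (A : Type) (sig : A -> A) (cc : A -> R) (F : A -> R -> R) (B : nat -> A -> R) c d
    chi g n k : profile_family sig cc F B c d -> rschwartz chi -> vanish_off c d chi -> schwartz g ->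
  exists2 C : R, 0 <= C & forall a : A, cSB n (rmul (fam F chi a) g) (C * B k a).
Proof.
move=> hF sc vc /schwartzP[g1 g2].
have mk h : rschwartz h -> rschwartz (fun x => chi x * h x) /\ vanish_off c d (fun x => chi x * h x).
  move=> sh; split; first by apply: rschwartzM => //; exact: rschwartz_slow.
  by move=> x /vc ->; rewrite mul0r.
have [s1 v1] := mk _ g1; have [s2 v2] := mk _ g2.
have [C1 C10 h1] := rSB_fam hF n k s1 v1; have [C2 C20 h2] := rSB_fam hF n k s2 v2.
have B0 : forall k (a : A), 0 <= B k a by case: hF.
exists (C1 + C2) => [|a]; first exact: addr_ge0.
rewrite /cSB re_rmul im_rmul; split.
  have -> : (fun x => fam F chi a x * re g x) = fam F (fun x => chi x * re g x) a.
    by apply/funext => x; rewrite /fam mulrA.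
  by apply: rSB_leM (h1 a); rewrite ler_wpM2r// lerDl.
have -> : (fun x => fam F chi a x * im g x) = fam F (fun x => chi x * im g x) a.
  by apply/funext => x; rewrite /fam mulrA.
by apply: rSB_leM (h2 a); rewrite ler_wpM2r// lerDr.
Qed.

(** Freezing a function at its value at 0 for negative times makes it continuous on the line. *)
Lemma continuous_max0 (h : R -> R) : {within `[0, +oo[%classic, continuous h} ->
  continuous (fun s => h (Num.max s 0)).
Proof.
move=> ch s.
have m0 : (`[0, +oo[%classic : set R) (Num.max s 0).
  by rewrite /= in_itv/= andbT le_max lexx orbT.
have c1 : h @ within `[0, +oo[%classic (nbhs (Num.max s 0)) --> h (Num.max s 0).
  by have /subspace_continuousP/(_ _ m0) := ch.
have cm : (fun r : R => Num.max r 0) @ s --> Num.max s 0.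
  apply/cvgrPdist_le => e e0; have /cvgrPdist_le/(_ e e0) : r @[r --> s] --> s by exact: cvg_id.
  apply: filterS => r; apply: le_trans.
  have [s0|s0] := leP s 0; have [r0|r0] := leP r 0; rewrite ?subrr ?normr0// ?subr0 ?sub0r ?normrN.
    by rewrite (gtr0_norm r0) distrC ger0_norm ?subr_ge0; lra.
  by rewrite (gtr0_norm s0) ger0_norm ?subr_ge0; lra.
have c2 : (fun r : R => Num.max r 0) @ nbhs s --> within `[0, +oo[%classic (nbhs (Num.max s 0)).
  move=> A wA.
  have wA' : \forall r \near s, (`[0, +oo[%classic : set R) (Num.max r 0) -> A (Num.max r 0) := cm _ wA.
  apply: filterS wA' => r; apply.
  by rewrite /= in_itv/= andbT le_max lexx orbT.
exact: (cvg_comp _ _ c2 c1).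
Qed.

Lemma is_derive_max0 (h : R -> R) s (dh : R) : 0 < s -> is_derive s 1 h dh ->
  is_derive s 1 (fun r => h (Num.max r 0)) dh.
Proof.
move=> s0 [dh1 dh2].
have e : \forall r \near s, h r = h (Num.max r 0).
  near=> r; congr h; apply/esym/max_idPl; apply: ltW; near: r; exact: lt_nbhsr.
split; first exact: near_eq_derivable e dh1.
by rewrite -dh2; apply/esym; exact: near_eq_derive.
Unshelve. all: by end_near.
Qed.

Lemma fam_lin (A : Type) (F G H : A -> R -> R) chi g (a : R) (i j k : A) :
  (forall r, F i r = a * G j r + H k r) ->
  rmul (fam F chi i) g = fun x => a%:C * rmul (fam G chi j) g x + rmul (fam H chi k) g x.
Proof.
move=> E; apply/funext => x; rewrite /rmul mulrA -rmorphM -mulrDl -rmorphD; congr (_%:C * _).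
by rewrite /fam E/=; ring.
Qed.

Context (u0 : pre_distribution R) (u : R -> pre_distribution R) (hu : heat_solution u0 u).

(** Two successive remainders differ by a Taylor term, and [T] is linear. *)
Lemma tpoly_distribution T t chi g (d : R) N : tempered T -> 0 <= t -> 1 <= d ->
  rschwartz chi -> vanish_off 0 d chi -> schwartz g ->
  let F N r := expR (- t * r) - tpoly N (fun k => (- t) ^+ k) r in
  let P n r := (- r) ^+ n in
  T (fourier (rmul (fam F chi 0%N) g)) =
  \sum_(k < N) (t ^+ k / k`!%:R)%:C * T (fourier (rmul (fam P chi k) g)) +
  T (fourier (rmul (fam F chi N) g)).
Proof.
move=> [lT _] t0 d1 sc vc sg F P; have d0 : 0 < d by exact: lt_le_trans d1.
have sF n : schwartz (rmul (fam F chi n) g).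
  by apply: schwartz_rmul => //; exact: (rschwartz_fam (remainder_profile t0 d0) n sc vc).
have sP n : schwartz (rmul (fam P chi n) g).
  by apply: schwartz_rmul => //; exact: (rschwartz_fam (power_profile d1) n sc vc).
elim: N => [|N IH]; first by rewrite big_ord0 add0r.
rewrite IH big_ord_recr /= -addrA; congr (_ + _).
have E : rmul (fam F chi N) g = fun x => (t ^+ N / N`!%:R)%:C * rmul (fam P chi N) g x + rmul (fam F chi N.+1) g x.
  apply: fam_lin => r; rewrite /F /P /tpoly big_ord_recr /= opprD addrA.
  rewrite [(- t) ^+ N]exprNn [(- r) ^+ N]exprNn; ring.
rewrite E fourier_lin// lT//; exact: schwartz_fourier.
Qed.

(** Both sides are the sum of the same Taylor series in [t]: the left-hand side by [taylor_cvg],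
   the right-hand side because the remainders of the exponential tend to 0 in the Schwartz space. *)
Lemma heat_repr chi (d : R) psi t : 1 <= d -> rschwartz chi -> vanish_off 0 d chi -> schwartz psi ->
  0 <= t ->
  fmult chi (u t) psi = fmult (fun xi => expR (- t * rsq xi) * chi xi) u0 psi.
Proof.
move=> d1 sc vc sp t0; have [tu eu] := hu.
have d0 : 0 < d by exact: lt_le_trans d1.
pose g := inv_fourier psi; have sg : schwartz g by exact: schwartz_inv_fourier.
pose F N r := expR (- t * r) - tpoly N (fun k => (- t) ^+ k) r.
pose P n r : R := (- r) ^+ n.
pose Phi n := fourier (rmul (fam P chi n) g).
have sP n : schwartz (rmul (fam P chi n) g).
  by apply: schwartz_rmul => //; exact: (rschwartz_fam (power_profile d1) n sc vc).
have sPhi n : schwartz (Phi n) by exact: schwartz_fourier.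
have sF n : schwartz (rmul (fam F chi n) g).
  by apply: schwartz_rmul => //; exact: (rschwartz_fam (remainder_profile t0 d0) n sc vc).
have lapl n : laplacian (Phi n) = Phi n.+1.
  rewrite /Phi laplacian_fourier//; congr fourier; apply/funext => x.
  have E : fam P chi n.+1 x = - rsq x * fam P chi n x by rewrite /fam /P exprS mulrA.
  rewrite /rmul E; apply/eqP; rewrite eq_complex; case: (g x) => w1 w2 /=.
  by apply/andP; split; apply/eqP; ring.
have E0 : fmult chi (u t) psi = u t (Phi 0%N).
  rewrite fmultE /Phi; congr (u t (fourier (rmul _ _))); apply/funext => x.
  by rewrite /fam /P expr0 mul1r.
have E1 : fmult (fun xi => expR (- t * rsq xi) * chi xi) u0 psi = u 0 (fourier (rmul (fam F chi 0%N) g)).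
  have [-> _ _ _ _] := eu _ (schwartz_fourier (sF 0%N)).
  rewrite fmultE; congr (u0 (fourier (rmul _ _))); apply/funext => x.
  by rewrite /fam /F /tpoly big_ord0 subr0.
pose M := expR 1 * d.
have M0 : 0 < M by rewrite mulr_gt0// expR_gt0.
have pb s : 0 <= s -> exists K, forall n, cmod (u s (Phi n)) <= K * M ^+ n.
  move=> s0; have [n0 [C [C0 hC]]] := tempered_fourier (tu s s0).
  have [K K0 hK] := cSB_fam n0 0 (power_profile d1) sc vc sg.
  exists (C * K) => n; rewrite -mulrA; apply: hC => //.
  by have := hK n; rewrite expr0 divr1.
have [n0 [C [C0 hC]]] := tempered_fourier (tu 0 (lexx 0)).
have [K K0 hK] := cSB_fam n0 0 (remainder_profile t0 d0) sc vc sg.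
have rem N : cmod (u 0 (fourier (rmul (fam F chi N) g))) <= C * K / 2 ^+ N.
  by rewrite -mulrA; apply: hC => //; have := hK N; rewrite addn0.
have Tay N := tpoly_distribution N (tu 0 (lexx 0)) t0 d1 sc vc sg.
have main (part : R[i] -> R) : (forall z w, part (z + w) = part z + part w) ->
    (forall (a : R) z, part (a%:C * z) = a * part z) -> (forall z, `|part z| <= cmod z) ->
    (forall psi, schwartz psi -> {within `[0, +oo[%classic, continuous (fun t => part (u t psi))}) ->
    (forall psi t, schwartz psi -> 0 < t ->
      is_derive t 1 (fun r => part (u r psi)) (part (u t (laplacian psi)))) ->
    part (u t (Phi 0%N)) = part (u 0 (fourier (rmul (fam F chi 0%N) g))).
  move=> pD pZ pN pc pd.
  pose f n s := part (u (Num.max s 0) (Phi n)).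
  have cf n : continuous (f n) by apply: (@continuous_max0 (fun s => part (u s (Phi n)))); exact: pc.
  have df n s : 0 < s -> is_derive s 1 (f n) (f n.+1 s).
    move=> s0; rewrite /f (max_idPl (ltW s0)) -lapl.
    by apply: (@is_derive_max0 (fun s => part (u s (Phi n)))) => //; exact: pd.
  have bf s : 0 <= s -> exists K, bounded_at f M K s.
    move=> s0; have [K' hK'] := pb s s0; exists K' => n.
    by rewrite /f (max_idPl s0); apply: le_trans (hK' n).
  have cv := taylor_cvg M0 cf df t0 bf.
  have ft : f 0%N t = part (u t (Phi 0%N)) by rewrite /f (max_idPl t0).
  rewrite ft in cv.
  have p0 : part 0 = 0 by have := pZ 0 0; rewrite mulr0 mul0r.
  have psum N : part (\sum_(k < N) (t ^+ k / k`!%:R)%:C * u 0 (Phi k)) = tpoly N (f ^~ 0) t.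
    rewrite /tpoly (big_morph part pD p0); apply: eq_bigr => k _.
    by rewrite pZ /f maxxx mulrC.
  have cv2 : (fun N => tpoly N (f ^~ 0) t) @ \oo --> part (u 0 (fourier (rmul (fam F chi 0%N) g))).
    apply/cvgrPdist_le => e e0.
    have half : `|2^-1| < 1 :> R by rewrite ger0_norm ?invr_ge0// invf_lt1// ltr1n.
    have /cvgrPdist_le/(_ e e0) := cvg_geometric (C * K) half.
    apply: filterS => N; rewrite sub0r normrN => h.
    rewrite (Tay N) pD psum addrC addKr.
    apply: (le_trans (pN _)); apply: (le_trans (rem N)); apply: le_trans h.
    by rewrite /geometric/= exprVn; exact: ler_norm.
  exact: (cvg_unique _ cv cv2).
rewrite E0 E1.
have hre := main (@complex.Re R); have him := main (@complex.Im R).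
apply/eqP; rewrite eq_complex; apply/andP; split; apply/eqP.
  apply: hre.
  - by move=> [? ?] [? ?].
  - by move=> a [? ?] /=; rewrite mul0r subr0.
  - exact: Re_le_cmod.
  - by move=> f sf; have [] := eu f sf.
  - by move=> f s sf s0; have [_ _ _ + _] := eu f sf; exact.
apply: him.
- by move=> [? ?] [? ?].
- by move=> a [? ?] /=; rewrite mul0r addr0.
- exact: Im_le_cmod.
- by move=> f sf; have [] := eu f sf.
- by move=> f s sf s0; have [_ _ _ _] := eu f sf; exact.
Qed.

End heat_representation.

(** * Littlewood-Paley blocks of the heat flow *)

Section cutoffs.
Context {R : realType}.
Implicit Types (x y xi : R3 R) (psi : R3 R -> R[i]) (j : int) (k : nat) (t : R).

Lemma esum_single (F : int -> \bar R) (i : int) : (0 <= F i)%E ->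
  \esum_(j in [set: int]) (if j \in [set i] then F j else 0%E) = F i.
Proof. by move=> F0; rewrite -esum_mkcond esum_set1. Qed.

Context (phi : R3 R -> R) (hphi : LP_cutoff phi).

Lemma rschwartz_phi : rschwartz phi.
Proof. by have [/schwartzP[s1 _] _ _ _ _] := hphi. Qed.

Lemma enorm_scale (a : R) x : 0 <= a -> enorm (a *: x) = a * enorm x.
Proof. by move=> a0; rewrite enormZ ger0_norm. Qed.

Lemma phi_shell xi : phi xi != 0 -> 3 / 4 <= enorm xi <= 8 / 3.
Proof. by have [_ _ _ h _] := hphi; exact: h. Qed.

Lemma shell_enorm (c d : R) xi : 0 <= c -> c <= enorm xi <= d -> shell (c ^+ 2) (d ^+ 2) xi.
Proof.
move=> c0 /andP[cx xd]; have x0 := enorm_ge0 xi.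
by rewrite /shell /rsq -enorm_sqr !lerXn2r// nnegrE//; exact: le_trans xd.
Qed.

Lemma vanish_phi (a : R) : 0 < a ->
  vanish_off ((3 / 4 / a) ^+ 2) ((8 / 3 / a) ^+ 2) (fun xi => phi (a *: xi)).
Proof.
move=> a0 xi; apply: contraNeq => /phi_shell; rewrite enorm_scale ?(ltW a0)// => /andP[h1 h2].
apply: shell_enorm; first by rewrite divr_ge0// ltW.
by rewrite ler_pdivrMr// ler_pdivlMr// [enorm xi * a]mulrC h1 h2.
Qed.

(** The fattened cutoff: the blocks next to [phi] complete it to 1 on its support. *)
Definition phit xi : R := phi (2 *: xi) + phi xi + phi (2^-1 *: xi).

Lemma rschwartz_phit : rschwartz phit.
Proof.
have sp := rschwartz_phi.
have d (a : R) : a != 0 -> rschwartz (fun xi => phi (a *: xi)) by move=> a0; exact: rschwartz_dil.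
by apply: rschwartzD; [apply: rschwartzD => //|]; apply: d; rewrite ?invr_neq0// pnatr_eq0.
Qed.

Lemma vanish_weaken (c d c' d' : R) f : c' <= c -> d <= d' -> vanish_off c d f -> vanish_off c' d' f.
Proof.
move=> cc dd vf x nx; apply: vf; apply: contra nx => /andP[h1 h2].
by rewrite /shell (le_trans cc h1) (le_trans h2 dd).
Qed.

Lemma vanish_phit : vanish_off (9 / 64) (256 / 9) phit.
Proof.
move=> xi nx; rewrite /phit.
have v (a : R) : 0 < a -> 9 / 64 <= (3 / 4 / a) ^+ 2 -> (8 / 3 / a) ^+ 2 <= 256 / 9 -> phi (a *: xi) = 0.
  by move=> a0 h1 h2; apply: (vanish_weaken h1 h2 (vanish_phi a0)).
have e1 : (3 / 4 / 2) ^+ 2 = 9 / 64 :> R by field.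
have e2 : (8 / 3 / 2) ^+ 2 = 16 / 9 :> R by field.
have e3 : (3 / 4 / 1) ^+ 2 = 9 / 16 :> R by field.
have e4 : (8 / 3 / 1) ^+ 2 = 64 / 9 :> R by field.
have e5 : (3 / 4 / 2^-1) ^+ 2 = 9 / 4 :> R by field.
have e6 : (8 / 3 / 2^-1) ^+ 2 = 256 / 9 :> R by field.
have := v 1; rewrite scale1r e3 e4 => ->; [|by []|lra|lra].
rewrite (v 2) ?e1 ?e2//; last lra.
by rewrite (v 2^-1) ?e5 ?e6 ?addr0//; lra.
Qed.

(** On the support of [phi] all blocks but three vanish, since the shell has ratio 32/9 < 4. *)
Lemma phit1 xi : phi xi != 0 -> phit xi = 1.
Proof.
move=> nz; have /andP[h1 h2] := phi_shell nz; have [_ _ p01 _ psum] := hphi.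
have xi0 : xi != 0.
  by apply/eqP => x0; move: h1; rewrite x0 -(scale0r (0 : R3 R)) enorm_scale// mul0r; lra.
pose F j : \bar R := (phi ((2 : R) ^ (- j) *: xi))%:E.
have F0 j : (0 <= F j)%E by rewrite lee_fin; have /andP[] := p01 ((2 : R) ^ (- j) *: xi).
have e j : ((2 : R) ^ (- j) *: xi) != 0 -> 0 < (2 : R) ^ (- j) by move=> _; rewrite exprz_gt0.
have far j : j != 1 -> j != 0 -> j != -1 -> F j = 0%E.
  move=> j1 j0 jm; rewrite /F; congr EFin; apply/eqP; apply: contraT => /phi_shell.
  rewrite enorm_scale ?exprz_ge0// => /andP[g1 g2].
  have [jge|jle] : (2%:Z <= j) \/ (j <= - 2%:Z) by lia.
    have : (2 : R) ^ (- j) <= 2 ^ (- 2%:Z) by rewrite ler_eXz2l ?ltr1n// lerN2.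
    rewrite -[2 ^ (- 2%:Z)]/((2 ^+ 2)^-1) => q.
    have : (2 : R) ^ (- j) * enorm xi <= (2 ^+ 2)^-1 * (8 / 3).
      by rewrite ler_pM ?exprz_ge0 ?enorm_ge0.
    by have -> : (2 ^+ 2)^-1 * (8 / 3) = 2 / 3 :> R; [field|lra].
  have : 2 ^ 2%:Z <= (2 : R) ^ (- j) by rewrite ler_eXz2l ?ltr1n//; lia.
  rewrite -[2 ^ 2%:Z]/(2 ^+ 2) => q.
  have : 2 ^+ 2 * (3 / 4) <= (2 : R) ^ (- j) * enorm xi.
    by rewrite ler_pM ?exprn_ge0//; lra.
  by have -> : 2 ^+ 2 * (3 / 4) = 3 :> R; [field|lra].
have := psum xi xi0.
rewrite (@eq_esum _ _ _ _ (fun j => (if j \in [set (-1)%Z] then F j else 0) +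
   (if j \in [set 0%Z] then F j else 0) + (if j \in [set 1%Z] then F j else 0))%E); last first.
  move=> j _; rewrite !in_set1.
  have [->|jm] := eqVneq j (-1)%Z; first by rewrite /= !adde0.
  have [->|j0] := eqVneq j 0%Z; first by rewrite /= add0e adde0.
  have [->|j1] := eqVneq j 1%Z; first by rewrite /= !add0e.
  by rewrite !adde0; exact: far.
have I0 (i j : int) : (0 <= (if j \in [set i] then F j else 0))%E by case: ifP.
rewrite !esumD//; last by move=> j _; rewrite adde_ge0.
rewrite !esum_single// /F -!EFinD => -[E].
have e1 : (2 : R) ^ (- (-1)%Z) = 2 by rewrite -[(- (-1)%Z)]/(1%Z : int) expr1z.
have e2 : (2 : R) ^ (- 0%Z) = 1 by rewrite oppr0 expr0z.
have e3 : (2 : R) ^ (- 1%Z) = 2^-1 by rewrite exprN1.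
by move: E; rewrite e1 e2 e3 scale1r.
Qed.

Lemma phi_phit xi : phi xi * phit xi = phi xi.
Proof.
have [->|nz] := eqVneq (phi xi) 0; first by rewrite mul0r.
by rewrite phit1// mulr1.
Qed.

Lemma pow2_gt0 j : 0 < (2 : R) ^ (- j). Proof. by rewrite exprz_gt0. Qed.

Lemma rschwartz_phij j : rschwartz (fun xi => phi ((2 : R) ^ (- j) *: xi)).
Proof. by apply: rschwartz_dil; [rewrite gt_eqF// pow2_gt0|exact: rschwartz_phi]. Qed.

Lemma rsqZ (a : R) x : rsq (a *: x) = a ^+ 2 * rsq x.
Proof. by rewrite /rsq dot3Zl dot3C dot3Zl mulrA -expr2. Qed.

(** Multiplying the symbol of a block by a dilated symbol acts on the block by the dilated symbol. *)
Lemma block_mult p : 1 <= p -> exists2 C : R, 0 < C &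
  forall m M j (S G : pre_distribution R), rschwartz m -> rSB 18 m M -> 0 < M ->
  (forall psi, schwartz psi -> S psi =
     fmult (fun xi => phi ((2 : R) ^ (- j) *: xi) * m ((2 : R) ^ (- j) *: xi)) G psi) ->
  (dLnorm p S <= (C * M)%:E * dLnorm p (LPblock phi j G))%E.
Proof.
move=> p1; have [C C0 hC] := mult_bound (R := R) p1; exists C => // m M j S G sm hM M0 hS.
apply: (hC m M _ S _ sm hM M0 (pow2_gt0 j)) => psi sp.
have sma : rschwartz (fun xi => m ((2 : R) ^ (- j) *: xi)).
  by apply: rschwartz_dil sm; rewrite gt_eqF// pow2_gt0.
rewrite (hS psi sp) -(fmult_fmult (fun xi => phi ((2 : R) ^ (- j) *: xi)) G sma sp).
exact: erefl.
Qed.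

Context (u0 : pre_distribution R) (u : R -> pre_distribution R) (hu : heat_solution u0 u).

(** On the block j, [expR (- t * rsq xi)] is the dilation of the profile with parameter
   [tau = t 4^j], and [phit] localises this profile in a fixed shell. *)
Lemma heat_block p k : 1 <= p -> exists2 C : R, 0 < C & forall j t, 0 <= t ->
  (dLnorm p (LPblock phi j (u t)) <=
   (C / (1 + t / ((2 : R) ^ (- j)) ^+ 2) ^+ k)%:E * dLnorm p (LPblock phi j u0))%E.
Proof.
move=> p1; have [C C0 hC] := block_mult p1.
have c01 : 0 < (9 / 64 : R) <= 1 by apply/andP; split; lra.
have hp := heat_profile (256 / 9) c01.
have [K K0 hK] := rSB_fam hp 18 k rschwartz_phit vanish_phit.
exists (C * (K + 1)) => [|j t t0]; first by rewrite mulr_gt0// ltr_wpDl.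
have a0 := pow2_gt0 j; set a := (2 : R) ^ (- j) in a0 *.
(* a is 2 ^ (- j), so that t / a ^+ 2 is t 4^j *)
have tau0 : 0 <= t / a ^+ 2 by rewrite divr_ge0// exprn_ge0// ltW.
set tau := t / a ^+ 2 in tau0 *.
have p0 : 0 < (1 + tau) ^+ k by rewrite exprn_gt0// ltr_pwDl.
rewrite -mulrA; apply: (hC _ _ _ _ _ (rschwartz_fam hp tau rschwartz_phit vanish_phit)).
- apply: rSB_leM (hK tau); rewrite ger0_norm// ler_wpM2r ?invr_ge0 ?(ltW p0)// lerDl//.
- by rewrite divr_gt0// ltr_wpDl.
move=> psi sp; rewrite /LPblock -/a.
(* any radius at least 1 that contains the support of the block *)
pose d := Num.max 1 ((8 / 3 / a) ^+ 2).
have vd : vanish_off 0 d (fun xi => phi (a *: xi)).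
  by apply: vanish_weaken (vanish_phi a0); rewrite ?sqr_ge0// /d le_max lexx orbT.
have d1 : 1 <= d by rewrite /d le_max lexx.
rewrite (heat_repr hu d1 (rschwartz_phij j) vd sp t0).
congr (fmult _ u0 psi); apply/funext => xi.
rewrite /fam rsqZ (ger0_norm tau0) mulrCA phi_phit; congr (expR _ * _).
by rewrite /tau; field; rewrite gt_eqF.
Qed.

End cutoffs.

(** * The triangle inequality for distributions given by functions *)

Section distribution_norms.
Context {R : realType}.
Implicit Types (x y xi : R3 R) (f g psi : R3 R -> R[i]) (T S G : pre_distribution R)
  (i : 'I_3) (j : int) (p : R) (b : seq 'I_3).

Lemma measurable_cmod f : cmeasurable f -> measurable_fun [set: M3 R] (cmod \o f).
Proof.
move=> [m1 m2]; apply: (measurableT_comp (continuous_measurable_fun (@sqrt_continuous R))).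
by apply: measurable_funD; apply: measurable_funX.
Qed.

Lemma dLnorm_ge0 p S : (0 <= dLnorm p S)%E.
Proof. by apply/ereal_infP => _ [g _ <-]; exact: Lnorm_ge0. Qed.

Lemma Re_mul (z w : R[i]) : complex.Re (z * w) = complex.Re z * complex.Re w - complex.Im z * complex.Im w.
Proof. by case: z w => ? ? [? ?]. Qed.

Lemma Im_mul (z w : R[i]) : complex.Im (z * w) = complex.Re z * complex.Im w + complex.Im z * complex.Re w.
Proof. by case: z w => ? ? [? ?]. Qed.

Lemma ReD (z w : R[i]) : complex.Re (z + w) = complex.Re z + complex.Re w.
Proof. by case: z w => ? ? [? ?]. Qed.

Lemma ImD (z w : R[i]) : complex.Im (z + w) = complex.Im z + complex.Im w.
Proof. by case: z w => ? ? [? ?]. Qed.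

Lemma cint_lin (c : R[i]) f g : cintegrable f -> cintegrable g ->
  cintegrable (fun x => c * f x + g x) /\ cint (fun x => c * f x + g x) = c * cint f + cint g.
Proof.
move=> [f1 f2] [g1 g2]; case: c => u v.
have Er x : complex.Re ((u +i* v) * f x + g x) = u * re f x - v * im f x + re g x.
  by rewrite ReD Re_mul.
have Ei x : complex.Im ((u +i* v) * f x + g x) = u * im f x + v * re f x + im g x.
  by rewrite ImD Im_mul.
have I1 := intblB (intblZ u f1) (intblZ v f2); have I2 := intblD (intblZ u f2) (intblZ v f1).
split.
  by split; [exact: eq_intbl (fun x => esym (Er x)) (intblD I1 g1)|
             exact: eq_intbl (fun x => esym (Ei x)) (intblD I2 g2)].
have e1 : intR (fun x => complex.Re ((u +i* v) * f x + g x)) =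
    u * intR (re f) - v * intR (im f) + intR (re g).
  by rewrite (eq_intR Er) (intRD I1 g1) (intRB (intblZ u f1) (intblZ v f2)) (intRZ u f1) (intRZ v f2).
have e2 : intR (fun x => complex.Im ((u +i* v) * f x + g x)) =
    u * intR (im f) + v * intR (re f) + intR (im g).
  by rewrite (eq_intR Ei) (intRD I2 g2) (intRD (intblZ u f2) (intblZ v f1)) (intRZ u f2) (intRZ v f1).
rewrite /cint -/(intR (fun x => complex.Re ((u +i* v) * f x + g x))).
rewrite -/(intR (fun x => complex.Im ((u +i* v) * f x + g x))) e1 e2.
by apply/eqP; rewrite eq_complex /=; apply/andP; split.
Qed.

Lemma cmeasurable_lin (c : R[i]) f g : cmeasurable f -> cmeasurable g ->
  cmeasurable (fun x => c * f x + g x).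
Proof.
move=> [f1 f2] [g1 g2]; case: c => u v; split.
  have -> : (fun x => complex.Re ((u +i* v) * f x + g x)) = fun x => u * re f x - v * im f x + re g x.
    by apply/funext => x; rewrite ReD Re_mul.
  by apply: measurable_funD => //; apply: measurable_funB; exact: measurable_funM.
have -> : (fun x => complex.Im ((u +i* v) * f x + g x)) = fun x => u * im f x + v * re f x + im g x.
  by apply/funext => x; rewrite ImD Im_mul.
by apply: measurable_funD => //; apply: measurable_funD; exact: measurable_funM.
Qed.

Lemma le_inf_add (A B : set (\bar R)) (x : \bar R) : (forall a : \bar R, A a -> 0 <= a)%E ->
  (forall b : \bar R, B b -> 0 <= b)%E -> (forall a b : \bar R, A a -> B b -> x <= a + b)%E ->
  (x <= ereal_inf A + ereal_inf B)%E.
Proof.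
move=> A0 B0 h.
have iA : (0 <= ereal_inf A)%E by apply/ereal_infP.
have iB : (0 <= ereal_inf B)%E by apply/ereal_infP.
have step (y z : \bar R) (D : set (\bar R)) : (0 <= z)%E -> (forall b : \bar R, D b -> 0 <= b)%E ->
    (forall b : \bar R, D b -> y <= z + b)%E -> (y <= z + ereal_inf D)%E.
  move=> z0 D0 hD; have iD : (0 <= ereal_inf D)%E by apply/ereal_infP.
  have [zoo|] := eqVneq z +oo%E; first by rewrite zoo addye ?leey// gt_eqF// (lt_le_trans _ iD).
  rewrite -ltey => zoo; have zf : z \is a fin_num by rewrite ge0_fin_numE.
  rewrite -leeBlDl//; apply/ereal_infP => b Db; rewrite leeBlDl//; exact: hD.
apply: (step _ _ _ iA B0) => b Bb; rewrite addeC; apply: (step _ _ _ (B0 b Bb) A0).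
by move=> a Aa; rewrite addeC; exact: h.
Qed.

(** Representing functions add up; Minkowski's inequality and an infimum in two variables *)
Lemma dLnorm_comb p S T G (c : R[i]) : 1 <= p -> cmod c <= 1 ->
  (forall psi, schwartz psi -> S psi = c * T psi + G psi) ->
  (dLnorm p S <= dLnorm p T + dLnorm p G)%E.
Proof.
move=> p1 c1 hS; have p0 : 0 < p by exact: lt_le_trans p1.
apply: le_inf_add; [by move=> _ [g _ <-]; exact: Lnorm_ge0|by move=> _ [g _ <-]; exact: Lnorm_ge0|].
move=> _ _ [f [mf hf] <-] [g [mg hg] <-].
have ml := cmeasurable_lin c mf mg.
have rl : represents (fun x => c * f x + g x) S.
  split => // psi sp; have [fi fe] := hf psi sp; have [gi ge] := hg psi sp.
  have [li le] := cint_lin c fi gi.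
  have E : (fun x => c * (f x * psi x) + g x * psi x) = (fun x => (c * f x + g x) * psi x).
    by apply/funext => x; rewrite mulrDl mulrA.
  by rewrite -E le hS// fe ge.
apply: (@le_trans _ _ ('N[leb3 R]_p%:E [(fun x => (cmod (c * f x + g x))%:E)])%E).
  by apply: ereal_inf_lbound; exists (fun x => c * f x + g x).
have m1 := measurable_cmod mf; have m2 := measurable_cmod mg.
apply: (@le_trans _ _ ('N[leb3 R]_p%:E [(fun x => ((cmod \o f) x + (cmod \o g) x)%:E)])%E); last first.
  exact: (@minkowski_EFin _ _ _ (leb3 R) (cmod \o f) (cmod \o g) p m1 m2 p1).
rewrite !Lnorm.unlock; apply: gt0_ler_poweR => //.
- by rewrite invr_ge0 ltW.
- by rewrite in_itv/= leey andbT; apply: integral_ge0 => x _; rewrite lee_fin powR_ge0.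
- by rewrite in_itv/= leey andbT; apply: integral_ge0 => x _; rewrite lee_fin powR_ge0.
apply: ge0_le_integral => //.
- by move=> x _; exact: poweR_ge0.
- have -> : (fun x => `|(cmod (c * f x + g x))%:E| `^ p)%E = EFin \o (fun x => `|cmod (c * f x + g x)| `^ p).
    by apply/funext => x.
  apply/measurable_EFinP; apply: (measurableT_comp (measurable_powR p)).
  by apply: measurableT_comp => //; exact: measurable_cmod.
- have -> : (fun x => `|((cmod \o f) x + (cmod \o g) x)%:E| `^ p)%E = EFin \o (fun x => `|(cmod \o f) x + (cmod \o g) x| `^ p).
    by apply/funext => x.
  apply/measurable_EFinP; apply: (measurableT_comp (measurable_powR p)).
  by apply: measurableT_comp => //; exact: measurable_funD.
- move=> x _; rewrite /= lee_fin.
  rewrite !ger0_norm ?addr_ge0 ?cmod_ge0//; apply: ge0_ler_powR; rewrite ?nnegrE ?addr_ge0 ?cmod_ge0//.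
    exact: ltW.
  apply: (le_trans (cmod_triangle _ _)); rewrite lerD2r cmodM.
  by rewrite ler_piMl// cmod_ge0.
Qed.

End distribution_norms.

(** * Blocks of derivatives *)

Section bernstein.
Context {R : realType}.
Implicit Types (x y xi : R3 R) (f g h psi : R3 R -> R[i]) (T S G : pre_distribution R)
  (i : 'I_3) (j : int) (p : R) (b : seq 'I_3) (n : nat).

Definition clinear T : Prop := forall (a : R[i]) f g, schwartz f -> schwartz g ->
  T (fun x => a * f x + g x) = a * T f + T g.

Lemma clinear0 T : clinear T -> T (fun=> 0) = 0.
Proof.
move=> lT; have s0 := @schwartz0 R; have := lT 1 _ _ s0 s0.
have -> : (fun _ : R3 R => 1 * 0 + 0 : R[i]) = (fun=> 0) by apply/funext => y; rewrite mul1r addr0.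
by rewrite mul1r => E; apply: (addrI (T (fun=> 0))); rewrite addr0 -E.
Qed.

Lemma clinearZ T (a : R[i]) f : clinear T -> schwartz f -> T (fun x => a * f x) = a * T f.
Proof.
move=> lT sf; have := lT a f _ sf (@schwartz0 R); rewrite clinear0// addr0 => <-.
by congr T; apply/funext => x; rewrite addr0.
Qed.

Lemma clinear_sum T n (h : 'I_n -> R3 R -> R[i]) : clinear T -> (forall k, schwartz (h k)) ->
  T (fun x => \sum_k h k x) = \sum_k T (h k).
Proof.
move=> lT; elim: n h => [|n IH] h sh.
  rewrite big_ord0; apply: etrans (clinear0 lT); congr T.
  by apply/funext => x; rewrite big_ord0.
have [s1 _] := fourier_sum (fun k : 'I_n => sh (lift ord0 k)).
rewrite big_ord_recl -IH// -[T (h ord0)]mul1r -lT//; congr T; apply/funext => x.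
by rewrite mul1r big_ord_recl.
Qed.

Lemma schwartz_pd i f : schwartz f -> schwartz (pd i f).
Proof.
by move=> /schwartzP[f1 f2]; apply/schwartzP; rewrite pd_re pd_im; split; exact: rschwartz_rpd.
Qed.

Lemma pd_lin i (a : R[i]) f g : schwartz f -> schwartz g ->
  pd i (fun x => a * f x + g x) = fun x => a * pd i f x + pd i g x.
Proof.
move=> /schwartzP[f1 f2] /schwartzP[g1 g2]; case: a => u v.
have [d1 d2] := (rschwartz_diff3 f1, rschwartz_diff3 f2).
have [d3 d4] := (rschwartz_diff3 g1, rschwartz_diff3 g2).
apply: complex_ext => x.
  rewrite pd_re (_ : re _ = fun x => u * re f x + (- v * im f x + re g x)); last first.
    by apply/funext => y; rewrite /re ReD Re_mul /= mulNr addrA.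
  rewrite !rpdD ?rpdZ//; do ?[exact: d1|exact: d2|exact: d3|exact: d4|apply: diff3D|apply: diff3Z].
  by rewrite -!pd_re -pd_im /re /im ReD Re_mul /= mulNr addrA.
rewrite pd_im (_ : im _ = fun x => u * im f x + (v * re f x + im g x)); last first.
  by apply/funext => y; rewrite /im ImD Im_mul /= addrA.
rewrite !rpdD ?rpdZ//; do ?[exact: d1|exact: d2|exact: d3|exact: d4|apply: diff3D|apply: diff3Z].
by rewrite -!pd_im -pd_re /re /im ImD Im_mul /= addrA.
Qed.

Lemma clinear_dpd i T : clinear T -> clinear (dpd i T).
Proof.
move=> lT a f g sf sg; rewrite /dpd pd_lin// lT; [|exact: schwartz_pd..].
by rewrite opprD mulrN.
Qed.

Lemma fourierNi f : schwartz f -> fourier (fun x => - 'i * f x) = fun x => - 'i * fourier f x.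
Proof.
move=> sf; have /schwartzP[f1 f2] := sf.
have er : re (fun x => - 'i * f x) = im f.
  by apply/funext => x; rewrite /re /im; case: (f x) => u v /=; ring.
have ei : im (fun x => - 'i * f x) = fun x => -1 * re f x.
  by apply/funext => x; rewrite /re /im; case: (f x) => u v /=; ring.
have sm : schwartz (fun x => - 'i * f x) by apply/schwartzP; rewrite er ei; split => //; exact: rschwartzZ.
have r1 (z : R[i]) : complex.Re (- 'i * z) = complex.Im z by case: z => u v /=; ring.
have r2 (z : R[i]) : complex.Im (- 'i * z) = - complex.Re z by case: z => u v /=; ring.
apply: complex_ext => x.
  rewrite fourier_re// er ei /re r1 -/(im (fourier f) x) fourier_im// trZ//.
  by rewrite mulN1r.
rewrite fourier_im// er ei /im r2 -/(re (fourier f) x) fourier_re// trZ//.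
by rewrite mulN1r opprD.
Qed.

Lemma dpd_fourier i T f : clinear T -> schwartz f ->
  dpd i T (fourier f) = 'i * T (fourier (rmul (co i) f)).
Proof.
move=> lT sf; rewrite /dpd pd_fourier//.
have sr : schwartz (rmul (co i) f) by apply: schwartz_rmul_slow => //; exact: slow_co.
rewrite (_ : (fun xi => _) = fun xi => - 'i * rmul (co i) f xi); last first.
  by apply/funext => xi; rewrite /rmul mulrA.
rewrite fourierNi// clinearZ//; last exact: schwartz_fourier.
by rewrite mulNr opprK.
Qed.

Lemma dLnorm_zero p : 1 <= p -> (dLnorm p (fun=> 0%R) <= 0)%E.
Proof.
move=> p1; have p0 : p != 0 by rewrite gt_eqF// (lt_le_trans ltr01).
apply: (@le_trans _ _ ('N[leb3 R]_p%:E [(fun x => (cmod (0%R : R[i]))%:E)])%E).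
  apply: ereal_inf_lbound; exists (fun=> 0) => //; split; first by split; exact: measurable_cst.
  move=> psi sp; have E : (fun x => 0 * psi x) = (fun=> 0 : R[i]) by apply/funext => x; rewrite mul0r.
  rewrite E; split; first by split; exact: integrable0.
  by rewrite /cint /= /Rintegral integral0.
rewrite Lnorm.unlock.
have -> : (fun x : M3 R => (`|(cmod (0%R : R[i]))%:E| `^ p)%E) = cst 0%E.
  apply/funext => x; rewrite abse_EFin poweR_EFin; congr EFin.
  by rewrite /cmod /= expr0n /= addr0 sqrtr0 normr0 powR0.
by rewrite integral0 poweR0r// invr_neq0.
Qed.

Lemma dLnorm_sum p n (c : R[i]) (S_ : 'I_n -> pre_distribution R) S : 1 <= p -> cmod c <= 1 ->
  (forall psi, schwartz psi -> S psi = \sum_k c * S_ k psi) ->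
  (dLnorm p S <= \sum_k dLnorm p (S_ k))%E.
Proof.
move=> p1 c1; elim: n S_ S => [|n IH] S_ S hS.
  rewrite big_ord0; apply: le_trans (dLnorm_zero p1).
  apply: le_trans (_ : dLnorm p (fun=> 0%R) + dLnorm p (fun=> 0%R) <= _)%E; last first.
    have z : dLnorm p (fun=> 0%R) = 0%E.
      by apply/eqP; rewrite eq_le dLnorm_zero// dLnorm_ge0.
    by rewrite z adde0.
  by apply: (dLnorm_comb p1 c1) => psi sp; rewrite hS// big_ord0 mulr0 addr0.
rewrite big_ord_recl.
have := @dLnorm_comb R p S (S_ ord0) (fun psi => \sum_k c * S_ (lift ord0 k) psi) c p1 c1.
move=> /(_ _)/le_trans; apply; first by move=> psi sp; rewrite hS// big_ord_recl.
by rewrite leeD2l//; exact: IH.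
Qed.

Context (phi : R3 R -> R) (hphi : LP_cutoff phi).

(** On the support of [phi] this is [co i xi / rsq xi].  The square keeps the denominator positive
   everywhere, so that the symbol is smooth. *)
Definition grad_symbol i : R3 R -> R := fun xi => co i xi * (phit phi xi / (rsq xi + (1 - phit phi xi) ^+ 2)).

Lemma rschwartz_grad_symbol i : rschwartz (grad_symbol i).
Proof.
have st := rschwartz_phit hphi; have sl := rschwartz_slow st.
apply: rschwartz_co; apply: (rschwartzM st).
apply: (@slow_inv _ _ (9 / 64)); first lra.
- apply: slowD; [exact: slow_rsq|apply: slowX].
  have := slowD (slow_cst 1) (slowZ (-1) sl); congr slow; apply/funext => x; rewrite mulN1r//.
- move=> x; have r0 : 0 <= rsq x by exact: dot3_ge0.
  have [xin|xout] := boolP (shell (9 / 64) (256 / 9) x).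
    by have /andP[h _] := xin; apply: (le_trans h); rewrite lerDl sqr_ge0.
  by rewrite (vanish_phit hphi)// subr0 expr1n; lra.
Qed.

(** The partition [1 = \sum_i xi_i ^ 2 / rsq xi] on the frequencies of a block *)
Lemma grad_symbol_sum (a : R) xi : 0 < a ->
  \sum_(i < 3) co i xi * (phi (a *: xi) * (a * grad_symbol i (a *: xi))) = phi (a *: xi).
Proof.
move=> a0; have [->|nz] := eqVneq (phi (a *: xi)) 0.
  by rewrite big1// => i _; rewrite mul0r mulr0.
have r0 : rsq xi != 0.
  have := phi_shell hphi nz; rewrite enorm_scale ?(ltW a0)// => /andP[h _].
  apply/eqP => r0; move: h; rewrite /enorm -/(rsq xi) r0 sqrtr0 mulr0; lra.
transitivity (\sum_(i < 3) co i xi ^+ 2 * (phi (a *: xi) * (rsq xi)^-1)).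
  apply: eq_bigr => i _; rewrite /grad_symbol (phit1 hphi nz) coZ rsqZ subrr expr0n /= addr0.
  by field; rewrite r0 gt_eqF.
by rewrite -mulr_suml sum_co_sqr mulrCA mulfV ?mulr1.
Qed.

(** By [grad_symbol_sum] the block of [T] is a combination of blocks of the derivatives of [T],
   through symbols of size [2 ^ (- j)]. *)
Lemma bernstein1 p : 1 <= p -> exists2 C : R, 0 < C & forall T j, clinear T ->
  (dLnorm p (LPblock phi j T) <=
   \sum_(i < 3) (C * (2 : R) ^ (- j))%:E * dLnorm p (LPblock phi j (dpd i T)))%E.
Proof.
move=> p1; have [C C0 hC] := block_mult phi p1.
have /choice[M hM] : forall i, exists M, rSB 18 (grad_symbol i) M.
  by move=> i; exact/rschwartz_rSB/rschwartz_grad_symbol.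
have M0 i : 0 <= M i := rSB_ge0 (hM i).
pose K := 1 + \sum_i M i.
have K0 : 0 < K by rewrite ltr_pwDl// sumr_ge0.
have MK i : M i <= K.
  by rewrite /K (bigD1 i)//= addrCA lerDl addr_ge0// sumr_ge0.
exists (C * K) => [|T j lT]; first exact: mulr_gt0.
have a0 := pow2_gt0 (R := R) j; set a := (2 : R) ^ (- j) in a0 *.
pose m i xi := a * grad_symbol i xi.
have sm i : rschwartz (m i) by apply: rschwartzZ; exact: rschwartz_grad_symbol.
have bm i : rSB 18 (m i) (K * a).
  have [sg _] := rschwartz_grad_symbol i.
  apply: rSB_leM (rSB_Z a sg (hM i)).
  by rewrite gtr0_norm// mulrC ler_wpM2r// ltW.
pose S i := fmult (fun xi => phi (a *: xi) * m i (a *: xi)) (dpd i T).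
have le_S i : (dLnorm p (S i) <= (C * K * a)%:E * dLnorm p (LPblock phi j (dpd i T)))%E.
  by rewrite -mulrA; apply: (hC (m i)) => //; exact: mulr_gt0.
apply: (@le_trans _ _ (\sum_(i < 3) dLnorm p (S i))%E); last by apply: lee_sum => i _; exact: le_S.
have c1 : cmod (- 'i : R[i]) <= 1.
  by rewrite /cmod /= oppr0 expr0n /= add0r sqrrN expr1n sqrtr1.
apply: (dLnorm_sum p1 c1) => psi sp.
have sg := schwartz_inv_fourier sp.
have spm i : rschwartz (fun xi => phi (a *: xi) * m i (a *: xi)).
  apply: rschwartzM; first exact: rschwartz_phij.
  by apply: rschwartz_slow; apply: rschwartz_dil => //; rewrite gt_eqF.
pose q i := rmul (fun xi => co i xi * (phi (a *: xi) * m i (a *: xi))) (inv_fourier psi).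
have sq i : schwartz (q i) by apply: schwartz_rmul => //; exact: rschwartz_co.
have SE i : - 'i * S i psi = T (fourier (q i)).
  rewrite /S fmultE dpd_fourier//; last exact: schwartz_rmul.
  have -> : rmul (co i) (rmul (fun xi => phi (a *: xi) * m i (a *: xi)) (inv_fourier psi)) = q i.
    by apply/funext => xi; rewrite /q /rmul mulrA -rmorphM.
  by rewrite mulrA mulNr -expr2 sqr_i opprK mul1r.
rewrite (eq_bigr _ (fun i _ => SE i)) -clinear_sum//; last by move=> i; exact: schwartz_fourier.
rewrite -(fourier_sum sq).2 /LPblock fmultE -/a; congr (T (fourier _)); apply/funext => xi.
rewrite /q /rmul -mulr_suml -rmorph_sum /=; congr (_%:C * _).
by rewrite grad_symbol_sum.
Qed.

Fixpoint words n : seq (seq 'I_3) :=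
  if n is m.+1 then [seq i :: b | b <- words m, i <- index_enum 'I_3] else [:: [::]].

Lemma size_words n b : b \in words n -> size b = n.
Proof.
elim: n b => [|n IH] b /=; first by rewrite inE => /eqP ->.
by move=> /allpairsP[[c i] [/IH h _ ->]] /=; rewrite h.
Qed.

Lemma clinear_dpds b T : clinear T -> clinear (dpds b T).
Proof. by move=> lT; elim: b => //= i b; exact: clinear_dpd. Qed.

(** Iteration of [bernstein1] *)
Lemma bernstein p n : 1 <= p -> exists2 C : R, 0 < C & forall T j, clinear T ->
  (dLnorm p (LPblock phi j T) <=
   \sum_(b <- words n) (C * ((2 : R) ^ (- j)) ^+ n)%:E * dLnorm p (LPblock phi j (dpds b T)))%E.
Proof.
move=> p1; have [K K0 hK] := bernstein1 p1.
elim: n => [|n [C C0 hC]].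
  by exists 1 => // T j lT; rewrite big_seq1 expr0 mulr1 mul1e.
exists (C * K) => [|T j lT]; first exact: mulr_gt0.
have a0 := pow2_gt0 (R := R) j; set a := (2 : R) ^ (- j) in a0 *.
apply: (le_trans (hC T j lT)); rewrite /= big_allpairs_dep; apply: lee_sum => b _.
have Ca : 0 <= C * a ^+ n by rewrite mulr_ge0 ?exprn_ge0 ?(ltW C0) ?(ltW a0).
apply: (le_trans (lee_wpmul2l _ (hK _ j (clinear_dpds b lT)))); first by rewrite lee_fin.
rewrite ge0_sume_distrr; last first.
  by move=> i; rewrite mule_ge0 ?dLnorm_ge0// lee_fin mulr_ge0 ?(ltW K0)// ltW.
rewrite le_eqVlt; apply/orP; left; apply/eqP; apply: eq_bigr => i _.
by rewrite muleA -EFinM -/a; congr (_%:E * _)%E; rewrite exprSr; ring.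
Qed.

End bernstein.

(** * Summation over the blocks *)

Section assembly.
Context {R : realType}.
Implicit Types (j : int) (t q l s sigma p : R) (k n N : nat) (T : pre_distribution R).

Lemma esumZ_le (c : R) (F : int -> \bar R) : 0 <= c -> (forall j, (0 <= F j)%E) ->
  (\esum_(j in [set: int]) (c%:E * F j) <= c%:E * \esum_(j in [set: int]) F j)%E.
Proof.
move=> c0 F0; apply: ge_ereal_sup => _ [A fA <-].
rewrite -ge0_mule_fsumr//; apply: lee_wpmul2l; first by rewrite lee_fin.
by apply: esum_ge; exists A.
Qed.

(** For [q <= 1] use [q ^ 2 (1 + t) <= 1 + t q ^ 2], and for [q >= 1] use
   [1 + t <= 1 + t q ^ 2]. *)
Lemma weight_bound q t l s sigma k : 0 < q -> 0 <= t -> - s <= l <= sigma -> (l + s) / 2 <= k%:R ->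
  q `^ l / (1 + t * q ^+ 2) ^+ k <= (1 + t) `^ (- ((l + s) / 2)) * (q `^ (- s) + q `^ sigma).
Proof.
move=> q0 t0 /andP[sl lN] ak; set a := (l + s) / 2 in ak *.
have a0 : 0 <= a by rewrite /a; lra.
have ae : a = (l + s) / 2 by []; clearbody a.
have t1 : 0 < 1 + t by rewrite ltr_pwDl.
have tau0 : 0 <= t * q ^+ 2 by rewrite mulr_ge0// exprn_ge0// ltW.
have b1 : 1 <= 1 + t * q ^+ 2 by rewrite lerDl.
have b0 : 0 < 1 + t * q ^+ 2 by exact: lt_le_trans b1.
apply: (@le_trans _ _ (q `^ l * (1 + t * q ^+ 2) `^ (- a))).
  rewrite ler_wpM2l ?powR_ge0// powRN lef_pV2 ?posrE ?exprn_gt0 ?powR_gt0//.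
  by rewrite -(powR_mulrn k (ltW b0)); exact: ler_powR.
rewrite mulrDr; have [q1|q1] := leP q 1.
  apply: (@le_trans _ _ ((1 + t) `^ (- a) * q `^ (- s))); last by rewrite lerDl mulr_ge0 ?powR_ge0.
  have h : (q ^+ 2 * (1 + t)) `^ a <= (1 + t * q ^+ 2) `^ a.
    apply: ge0_ler_powR; rewrite ?nnegrE ?mulr_ge0 ?exprn_ge0 ?(ltW q0) ?(ltW t1) ?(ltW b0)//.
    have := exprn_ile1 2 (ltW q0) q1; lra.
  have q2 : 0 < q ^+ 2 by exact: exprn_gt0.
  move: h; rewrite (powRM a (ltW q2) (ltW t1)) => h.
  have e : q `^ l = (q ^+ 2) `^ a * q `^ (- s).
    rewrite -powR_mulrn ?(ltW q0)// -powRrM -powRD; last by rewrite (gt_eqF q0) implybT.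
    by congr (_ `^ _); rewrite ae; field.
  rewrite e !powRN ler_pdivrMr ?powR_gt0//.
  rewrite [leRHS]mulrAC ler_wpM2r ?invr_ge0 ?powR_ge0//.
  by rewrite mulrC ler_pdivlMr ?powR_gt0.
apply: (@le_trans _ _ ((1 + t) `^ (- a) * q `^ sigma)); last by rewrite lerDr mulr_ge0 ?powR_ge0.
rewrite mulrC; apply: ler_pM; rewrite ?powR_ge0//; last by apply: ler_powR => //; exact: ltW.
rewrite !powRN lef_pV2 ?posrE ?powR_gt0//; apply: ge0_ler_powR; rewrite ?nnegrE ?(ltW t1) ?(ltW b0)//.
by rewrite lerD2l ler_peMr// exprn_ege1// ltW.
Qed.

Lemma pow2E j (r : R) : (2 : R) `^ (j%:~R * r) = ((2 : R) ^ j) `^ r.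
Proof. by rewrite powRrM powR_intmul. Qed.

Context (phi : R3 R -> R) (hphi : LP_cutoff phi).

(** Both cases of the definition of the space give summable blocks, the second through [bernstein]. *)
Lemma besov_summable p k T : 1 <= p -> besov phi p k%:R T -> (besov_norm phi p k%:R T < +oo)%E.
Proof.
move=> p1 [[_ []//]|[n [_ [lT _] hb]]].
have [C C0 hC] := bernstein hphi n.+1 p1.
pose sg : R := k%:R - n%:R - 1.
have D0 b j : (0 <= (2 `^ (j%:~R * sg))%:E * dLnorm p (LPblock phi j (dpds b T)))%E.
  by rewrite mule_ge0 ?dLnorm_ge0// lee_fin powR_ge0.
apply: (@le_lt_trans _ _ (\sum_(b <- words n.+1) C%:E * besov_norm phi p sg (dpds b T))%E); last first.
  rewrite big_seq; apply: lte_sum_pinfty => b /size_words /hb[_ + _].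
  rewrite -/sg => h; have b0 : (0 <= besov_norm phi p sg (dpds b T))%E by apply: esum_ge0 => j _.
  by rewrite lte_mul_pinfty// lee_fin ltW.
apply: (@le_trans _ _ (\sum_(b <- words n.+1) \esum_(j in [set: int])
    (C%:E * ((2 `^ (j%:~R * sg))%:E * dLnorm p (LPblock phi j (dpds b T))))))%E; last first.
  by apply: lee_sum => b _; apply: esumZ_le => //; exact: ltW.
rewrite -esum_sum; last by move=> j b _ _; rewrite mule_ge0// lee_fin ltW.
apply: le_esum => j _.
apply: (le_trans (lee_wpmul2l _ (hC T j lT))); first by rewrite lee_fin powR_ge0.
rewrite ge0_sume_distrr; last first.
  move=> b _; rewrite mule_ge0 ?dLnorm_ge0// lee_fin mulr_ge0 ?(ltW C0)// exprn_ge0// ltW//.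
  exact: pow2_gt0.
rewrite le_eqVlt; apply/orP; left; apply/eqP; apply: eq_bigr => b _.
rewrite !muleA -!EFinM; congr (_%:E * _)%E; rewrite mulrCA; congr (_ * _).
have q0 : 0 < (2 : R) ^ j by rewrite exprz_gt0.
rewrite !pow2E -invr_expz -powR_mulrn ?invr_ge0 ?(ltW q0)// -[_^-1]powR_inv1 ?(ltW q0)// -powRrM.
rewrite -powRD; last by rewrite (gt_eqF q0) implybT.
by congr (_ `^ _); rewrite /sg -natr1; ring.
Qed.

(** A nonpositive regularity is at most [3 / p], so only the first case of the definition occurs. *)
Lemma besov_neg p s T : 1 <= p -> 0 <= s -> besov phi p (- s) T -> (besov_norm phi p (- s) T < +oo)%E.
Proof.
move=> p1 s0 [[_ []//]|[n [/andP[h _] _ _]]].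
have p3 : 0 <= 3 / p by rewrite divr_ge0// (le_trans ler01).
by exfalso; have := ler0n R n; lra.
Qed.

End assembly.

Theorem theorem1p2 (R : realType) (phi : R3 R -> R) (hphi : LP_cutoff phi)
    (N : nat) (s p : R) (hs : 0 <= s) (hp : 1 <= p)
    (u0 : pre_distribution R) (u : R -> pre_distribution R)
    (hu : heat_solution u0 u)
    (hu0N : besov phi p N%:R u0) (hu0s : besov phi p (- s) u0)
    (l : R) (hl : - s <= l <= N%:R) :
  exists C0 : R, forall t : R, 0 <= t ->
    (besov_norm phi p l (u t) <= (C0 * (1 + t) `^ (- ((l + s) / 2)))%:E)%E.
Proof.
pose a := (l + s) / 2; pose k := Num.Def.archi_bound a.
have a0 : 0 <= a by rewrite /a; move/andP: hl => [? _]; lra.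
have ak : a <= k%:R := ltW (archi_boundP a0).
have [C C0 hC] := heat_block hphi hu k hp.
have finN := besov_summable hphi hp hu0N; have fins := besov_neg hp hs hu0s.
pose D j := dLnorm p (LPblock phi j u0).
have D0 j : (0 <= D j)%E := dLnorm_ge0 p _.
pose W (r : R) j := ((2 `^ (j%:~R * r))%:E * D j)%E.
have W0 r j : (0 <= W r j)%E by rewrite mule_ge0// lee_fin powR_ge0.
have normE r : besov_norm phi p r u0 = \esum_(j in [set: int]) W r j by [].
rewrite normE in finN; rewrite normE in fins.
have F1 : \esum_(j in [set: int]) W (- s) j \is a fin_num.
  by rewrite ge0_fin_numE//; apply: esum_ge0.
have F2 : \esum_(j in [set: int]) W N%:R j \is a fin_num.
  by rewrite ge0_fin_numE//; apply: esum_ge0.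
exists (C * (fine (\esum_(j in [set: int]) W (- s) j) + fine (\esum_(j in [set: int]) W N%:R j))) => t t0.
rewrite mulrAC EFinM EFinD !fineK//.
rewrite -esumD; [|by move=> j _; exact: W0..].
pose c := C * (1 + t) `^ (- a).
have c0 : 0 <= c by rewrite mulr_ge0 ?powR_ge0// ltW.
apply: le_trans (esumZ_le c0 _); last by move=> j; rewrite adde_ge0.
apply: le_esum => j _.
apply: (le_trans (lee_wpmul2l _ (hC j t t0))); first by rewrite lee_fin powR_ge0.
rewrite muleA -EFinM /W -ge0_muleDl ?lee_fin ?powR_ge0// -EFinD muleA -EFinM -/(D j).
apply: lee_wpmul2r => //; rewrite lee_fin /c.
have q0 : 0 < (2 : R) ^ j by rewrite exprz_gt0.
have -> : t / ((2 : R) ^ (- j)) ^+ 2 = t * ((2 : R) ^ j) ^+ 2.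
  by rewrite -invr_expz exprVn invrK.
rewrite !pow2E mulrCA -[leRHS]mulrA ler_wpM2l ?(ltW C0)//.
exact: weight_bound.
Qed.
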